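(* Let $U,V$ be separable Banach spaces, $W=(W(t):t\ge0)$ a strongly cylindrical Wiener process in $U$ with covariance operator $Q$, reproducing kernel Hilbert space $H$ and inclusion mapping $i_Q:H\to U$, and let $T>0$. For non-random $\Phi\in M_T(U,V)$ (i.e. $\Phi$ does not depend on $\omega\in\Omega$) the following are equivalent: (a) the cylindrical stochastic integral $\int_0^T\Phi(s)\,dW(s)$ is induced by a $V$-valued random variable; (b) there exists a Gaussian measure $\mu$ on $V$ with covariance operator $R$ such that $$\int_0^T\|i_Q^\ast\Phi^\ast(s)v^\ast\|_H^2\,ds=\langle Rv^\ast,v^\ast\rangle\qquad\text{for all }v^\ast\in V^\ast.$$
   Context: $\langle\cdot,\cdot\rangle$ denotes dual pairings, $L(U,V)$ the bounded linear operators from $U$ to $V$, $\Phi^\ast(s)$ the dual operator of $\Phi(s)$. $(\Omega,\mathcal{A},P)$ is a probability space with a filtration $(\mathcal{F}_t)_{t\ge0}$; $L^0(\Omega)$ is the space of real random variables. A cylindrical random variable in $U$ is a linear map $X:U^\ast\to L^0(\Omega)$; a cylindrical process is a family $(X(t):t\ge0)$ of cylindrical random variables, adapted if $X(t)u^\ast$ is $\mathcal{F}_t$-measurable for all $t\ge0$, $u^\ast\in U^\ast$. An $\mathbb{R}^n$-valued Wiener process is an adapted stochastic process $B=(B(t):t\ge0)$ with independent, stationary increments $B(t)-B(s)$ which are normally distributed with expectation $0$ and covariance $|t-s|C$ for a non-negative definite symmetric matrix $C$; it is standard if $C=\mathrm{Id}$. A strongly cylindrical Wiener process in $U$ is an adapted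 cylindrical process $W$ such that for all $n\in\mathbb{N}$ and $u_1^\ast,\dots,u_n^\ast\in U^\ast$ the process $((W(t)u_1^\ast,\dots,W(t)u_n^\ast):t\ge0)$ is an $\mathbb{R}^n$-valued Wiener process, and such that the cylindrical distribution of $W(1)$ is strongly Gaussian, i.e. it is centred, $W(1)u^\ast$ is Gaussian for every $u^\ast\in U^\ast$, and the covariance operator $Q$, $(Qu^\ast)v^\ast=\mathrm{Cov}[W(1)u^\ast,W(1)v^\ast]$, which a priori takes values in the algebraic dual of $U^\ast$, takes values in $U$. The reproducing kernel Hilbert space $H$ of $Q$ is the completion of the range of $Q$ under the inner product $[Qu^\ast,Qv^\ast]_H:=\langle Qu^\ast,v^\ast\rangle$; the inclusion of the range of $Q$ into $U$ extends to a bounded injective operator $i_Q:H\to U$ with $Q=i_Qi_Q^\ast$. For $W$ one uses the representation $W(t)u^\ast=\sum_{k=1}^\infty\langle i_Qe_k,u^\ast\rangle B_k(t)$ in $L^2(\Omega)$ for all $u^\ast\in U^\ast$, where $(e_k)_{k\in\mathbb{N}}$ is an orthonormal basis of $H$ and the independent real-valued standard Wiener processes $B_k$ are given by $B_k(t)=W(t)u_k^\ast$ for some $u_k^\ast\in U^\ast$ with $i_Q^\ast u_k^\ast=e_k$. $M_T(U,V)$ is the set of all $\Phi:[0,T]\times\Omega\to L(U,V)$ such that for every $v^\ast\in V^\ast$: $(t,\omega)\mapsto\Phi^\ast(t,\omega)v^\ast$ is $\mathcal{B}[0,T]\otimes\mathcal{A}$-measurable; $\omega\mapsto\Phi^\ast(t,\omega)v^\ast$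 is $\mathcal{F}_t$-measurable for each $t\in[0,T]$; and $\int_0^TE\|\Phi^\ast(s,\cdot)v^\ast\|_{U^\ast}^2\,ds<\infty$. The cylindrical stochastic integral of $\Phi\in M_T(U,V)$ is the cylindrical random variable in $V$ given by $$\Big(\int_0^t\Phi(s)\,dW(s)\Big)v^\ast:=\sum_{k=1}^\infty\int_0^t\langle\Phi(s)i_Qe_k,v^\ast\rangle\,dB_k(s)\quad\text{in }L^2(\Omega),\quad v^\ast\in V^\ast,\ t\in[0,T],$$ with real-valued Itô integrals on the right. A cylindrical random variable $X:V^\ast\to L^0(\Omega)$ is induced by a random variable $Z:\Omega\to V$ if $P$-a.s. $Xv^\ast=\langle Z,v^\ast\rangle$ for all $v^\ast\in V^\ast$. A measure on $\mathcal{B}(V)$ is Gaussian if its image under each $v^\ast\in V^\ast$ is Gaussian on $\mathbb{R}$ (point masses allowed); its covariance operator $R:V^\ast\to V$ is given by $\langle Rv^\ast,w^\ast\rangle=\int\langle v,v^\ast\rangle\langle v,w^\ast\rangle\,\mu(dv)-\int\langle v,v^\ast\rangle\,\mu(dv)\int\langle v,w^\ast\rangle\,\mu(dv)$. *)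

(* Defs.v *)
From HB Require Import structures.
From mathcomp Require Import all_boot all_order all_algebra.
From mathcomp Require Import all_classical all_reals all_analysis.

Set Implicit Arguments.
Unset Strict Implicit.
Unset Printing Implicit Defensive.

Import Order.TTheory GRing.Theory Num.Theory.
Import numFieldNormedType.Exports.

Local Open Scope classical_set_scope.
Local Open Scope ring_scope.

(* For linear maps between normed spaces, continuous is the same as bounded
   (linear_bounded_continuous). *)
Record bounded_op (R : realType) (U V : normedModType R) := BoundedOp {
  bop :> {linear U -> V} ;
  bop_continuous : continuous bop }.

Notation "''L(' U , V )" := (bounded_op U V)
  (at level 8, U at level 99, V at level 99, format "''L(' U ,  V )").

Definition dual_space (R : realType) (U : normedModType R) := 'L(U, R^o).

Definition opnorm (R : realType) (U V : normedModType R) (f : U -> V) : R :=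
  sup [set `|f x| | x in [set x | `|x| <= 1]].

Section operators.
Context {R : realType}.
Implicit Types U V X : normedModType R.

Fact bop_comp_continuous U V X (g : 'L(V, X)) (f : 'L(U, V)) :
  continuous (g \o f).
Proof.
by move=> x; apply: continuous_comp; [exact: bop_continuous|
  exact: bop_continuous].
Qed.

Definition bop_comp U V X (g : 'L(V, X)) (f : 'L(U, V)) : 'L(U, X) :=
  BoundedOp (bop := g \o f) (@bop_comp_continuous _ _ _ g f).

Fact bop_lincomb_continuous U V (a : R) (f g : 'L(U, V)) :
  continuous ((a \*: f) \+ g).
Proof.
move=> x; apply: cvgD; last exact: bop_continuous.
by apply: cvgZl_tmp; exact: bop_continuous.
Qed.

Definition bop_lincomb U V (a : R) (f g : 'L(U, V)) : 'L(U, V) :=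
  BoundedOp (bop := (a \*: f) \+ g) (@bop_lincomb_continuous _ _ a f g).

Definition dual_op U V (A : 'L(U, V)) (v : dual_space V) : dual_space U := bop_comp v A.

Definition dual_open U (A : set (dual_space U)) :=
  forall f, A f -> exists2 r : R, 0 < r &
    forall g : dual_space U, opnorm (g \- f : U -> R^o) < r -> A g.

Definition dual_borel U : set (set (dual_space U)) := <<s @dual_open U >>.

End operators.

Definition separable_space (T : topologicalType) :=
  exists2 D : set T, countable D & dense D.

Definition borelType (T : ptopologicalType) := g_sigma_algebraType (@open T).

Section hilbert.
Context {R : realType}.

Definition hilbert_norm (H : completeNormedModType R)
    (ip : {dot H for idfun}) :=
  forall h : H, `|h| ^+ 2 = ip h h.

(* The Hilbert space adjoint i^* : U^* -> H, with H^* identified with H by the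
   Riesz representation theorem. *)
Definition hilbert_adjoint (H : completeNormedModType R)
    (ip : {dot H for idfun}) (U : normedModType R) (i : 'L(H, U))
    (u : dual_space U) : H :=
  xget 0 [set h | forall x, ip h x = u (i x)].

(* The basis is indexed by an arbitrary K : pred nat, so that H may be of
   finite dimension. *)
Definition orthonormal_basis (H : completeNormedModType R)
    (ip : {dot H for idfun}) (K : pred nat) (e : nat -> H) :=
  (forall k l, K k -> K l -> ip (e k) (e l) = (k == l)%:R) /\
  dense [set h | exists (n : nat) (c : nat -> R),
                   h = \sum_(k < n | K k) c k *: e k].

(* H, with the isometric embedding j, is a completion of range Q under the
   inner product [Q u, Q v] := <Q u, v>, and i : H -> U is the extension of the
   inclusion of range Q into U.  Such a completion is unique up to isometry. *)
Definition reproducing_kernel_space (U : normedModType R) (Q : dual_space U -> U)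
    (H : completeNormedModType R) (ip : {dot H for idfun}) (i : 'L(H, U)) :=
  hilbert_norm ip /\
  exists j : U -> H,
    [/\ forall u v, ip (j (Q u)) (j (Q v)) = v (Q u),
        dense (j @` range Q) &
        forall x, range Q x -> i (j x) = x].

End hilbert.

Section gaussian.
Context {R : realType}.

(* normal_prob takes the standard deviation and is not a point mass for
   standard deviation 0. *)
Definition gaussian_law (m v : R) (A : set R) : \bar R :=
  if v == 0 then \d_m A else normal_prob m (Num.sqrt v) A.

Definition has_gaussian_law d (T : measurableType d) (mu : probability T R)
    (X : T -> R) (m v : R) :=
  forall A, measurable A -> mu (X @^-1` A) = gaussian_law m v A.

Definition is_gaussian d (T : measurableType d) (mu : probability T R)
    (X : T -> R) :=
  exists m v : R, 0 <= v /\ has_gaussian_law mu X m v.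

(* N(0, C) on R^n, C possibly singular. *)
Definition gaussian_vector d (T : measurableType d) (mu : probability T R)
    n (X : 'I_n -> T -> R) (C : 'M[R]_n) :=
  forall a : 'rV[R]_n,
    has_gaussian_law mu (fun w => \sum_i a 0 i * X i w) 0
      ((a *m C *m a^T) 0 0).

Definition gaussian_measure (V : normedModType R)
    (mu : probability (borelType V) R) :=
  forall v : dual_space V, is_gaussian mu (v : V -> R).

Definition covariance_operator (V : normedModType R)
    (mu : probability (borelType V) R) (C : dual_space V -> V) :=
  forall v w : dual_space V,
    ((w (C v))%:E = \int[mu]_x ((v x : R) * (w x : R))%:E
      - \int[mu]_x (v x : R)%:E * \int[mu]_x (w x : R)%:E)%E.

End gaussian.

Section processes.
Context {R : realType} {d : measure_display} {Omega : measurableType d}.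
Variables (P : probability Omega R) (F : R -> set (set Omega)).

Definition filtration :=
  (forall t, 0 <= t -> sigma_algebra setT (F t) /\ F t `<=` measurable) /\
  (forall s t, 0 <= s -> s <= t -> F s `<=` F t).

Definition measurable_wrt (G : set (set Omega)) (X : Omega -> R) :=
  forall A, measurable A -> G (X @^-1` A).

Definition generated_by n (X : 'I_n -> Omega -> R) : set (set Omega) :=
  <<s [set E | exists i A, measurable A /\ E = X i @^-1` A] >>.

Definition indep_sigma (G1 G2 : set (set Omega)) :=
  forall A B, G1 A -> G2 B -> P (A `&` B) = (P A * P B)%E.

(* Increments are independent of the past F s, as Ito integration of adapted
   integrands requires; stationarity is part of the last clause. *)
Definition wiener_process n (B : R -> 'I_n -> Omega -> R) :=
  [/\ forall t i, 0 <= t -> measurable_wrt (F t) (B t i),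
      forall i, {ae P, forall w, B 0 i w = 0},
      forall s t, 0 <= s -> s <= t ->
        indep_sigma (F s) (generated_by (fun i => B t i \- B s i)) &
      exists C : 'M[R]_n,
        [/\ C^T = C, forall a : 'rV[R]_n, 0 <= (a *m C *m a^T) 0 0 &
            forall s t, 0 <= s -> s <= t ->
              gaussian_vector P (fun i => B t i \- B s i) ((t - s) *: C)]].

(* Equality in L^0 is almost sure equality. *)
Definition cylindrical_rv (U : normedModType R) (X : dual_space U -> Omega -> R) :=
  (forall u, measurable_fun setT (X u)) /\
  (forall a u v,
     {ae P, forall w, X (bop_lincomb a u v) w = a * X u w + X v w}).

Definition strongly_gaussian (U : normedModType R)
    (X : dual_space U -> Omega -> R) (Q : dual_space U -> U) :=
  [/\ forall u, 'E_P[X u]%E = 0%E,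
      forall u, is_gaussian P (X u) &
      forall u v, covariance P (X u) (X v) = (v (Q u))%:E].

Definition strongly_cylindrical_wiener (U : normedModType R)
    (W : R -> dual_space U -> Omega -> R) (Q : dual_space U -> U) :=
  [/\ forall t, 0 <= t -> cylindrical_rv (W t),
      forall t u, 0 <= t -> measurable_wrt (F t) (W t u),
      forall n (u : 'I_n -> dual_space U), wiener_process (fun t i => W t (u i)) &
      strongly_gaussian (W 1) Q].

Definition M_space (U V : normedModType R) (T : R)
    (Phi : R -> Omega -> 'L(U, V)) :=
  forall v : dual_space V,
    [/\ forall A, dual_borel A ->
          measurable ((`[0, T] `*` setT) `&`
            [set p : R * Omega | A (dual_op (Phi p.1 p.2) v)]),
        forall t A, 0 <= t <= T -> dual_borel A ->
          F t [set w | A (dual_op (Phi t w) v)] &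
        (\int[lebesgue_measure]_(s in `[0%R, T])
           'E_P[fun w => (opnorm (dual_op (Phi s w) v) ^+ 2)%R] < +oo)%E].

Definition induced_by_rv (V : completeNormedModType R) (X : dual_space V -> Omega -> R) :=
  exists2 Z : Omega -> V,
    measurable_fun setT (Z : Omega -> borelType V) &
    forall v, {ae P, forall w, X v w = v (Z w)}.

Definition cvg_L2 (X : nat -> Omega -> R) (Y : Omega -> R) :=
  (fun n => 'E_P[fun w => ((X n w - Y w) ^+ 2)%R])%E @ \oo --> 0%E.

(* The simple process \sum_(i < n) xi_i 1_{]t_i, t_i.+1]} on [0, T]. *)
Record simple_process (T : R) := SimpleProcess {
  sp_size : nat ;
  sp_time : nat -> R ;
  sp_value : nat -> Omega -> R ;
  sp_time_itv : forall i, 0 <= sp_time i <= T ;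
  sp_time_le : forall i, sp_time i <= sp_time i.+1 ;
  sp_adapted : forall i, measurable_wrt (F (sp_time i)) (sp_value i) ;
  sp_bounded : exists M : R, forall i w, `|sp_value i w| <= M }.

Definition sp_fun T (f : simple_process T) (s : R) (w : Omega) : R :=
  \sum_(i < sp_size f)
    sp_value f i w * \1_(`]sp_time f i, sp_time f i.+1]) s.

Definition sp_integral T (f : simple_process T) (B : R -> Omega -> R)
    (w : Omega) : R :=
  \sum_(i < sp_size f)
    sp_value f i w * (B (sp_time f i.+1) w - B (sp_time f i) w).

Definition is_ito_integral (T : R) (f B : R -> Omega -> R) (Z : Omega -> R) :=
  measurable_fun setT Z /\
  exists S : nat -> simple_process T,
    (fun n => \int[lebesgue_measure]_(s in `[0%R, T])
        'E_P[fun w => ((sp_fun (S n) s w - f s w) ^+ 2)%R])%E @ \oo --> 0%E /\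
    cvg_L2 (fun n => sp_integral (S n) B) Z.

(* Chosen up to almost sure equality; cst 0 is a junk value, used only when the
   integral does not exist. *)
Definition ito_integral (T : R) (f B : R -> Omega -> R) : Omega -> R :=
  xget (cst 0) [set Z | is_ito_integral T f B Z].

(* The integral of Phi over [0, t], expanded along an orthonormal basis
   (e k)_(K k) of H with driving Wiener processes B k := W (u k). *)
Definition cylindrical_integral (U V H : normedModType R)
    (W : R -> dual_space U -> Omega -> R) (i : 'L(H, U)) (K : pred nat)
    (e : nat -> H) (u : nat -> dual_space U) (Phi : R -> Omega -> 'L(U, V)) (t : R)
    (v : dual_space V) : Omega -> R :=
  xget (cst 0) [set X | measurable_fun setT X /\
    cvg_L2 (fun n w => \sum_(k < n | K k)
      ito_integral t (fun s w' => v (Phi s w' (i (e k))))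
        (fun s => W s (u k)) w) X].

End processes.

(* Main.v *)
Require Import Defs.
From HB Require Import structures.
From mathcomp Require Import all_boot all_order all_algebra.
From mathcomp Require Import all_classical all_reals all_analysis.
From mathcomp Require Import ring lra measurable_realfun.
From Stdlib Require List.

Set Implicit Arguments.
Unset Strict Implicit.
Unset Printing Implicit Defensive.

Import Order.TTheory GRing.Theory Num.Theory.
Import numFieldNormedType.Exports.

Local Open Scope classical_set_scope.
Local Open Scope ring_scope.

(** Since Φ is deterministic, the whole statement lives at the level of Gaussian laws. For fixed [v]
    the integral is an L² limit of finite sums of Itô integrals of deterministic functions, hence
    centred Gaussian with variance [energy v], the time integral of the squared H-norm of the
    adjoint applied to the dual operator of Φ(s) at [v] ([cylindrical_integral_law]). It is also
    almost surely linear in [v] ([cylindrical_integral_lincomb]). Condition (b) therefore says that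
    a cylindrical Gaussian variable has the variances of a Gaussian measure on V.

    Gaussianity of the finite sums comes from approximating all integrands by step functions on one
    common dyadic grid. On each cell the increments of the driving processes combine into the
    increment of W along a single functional, and each such increment is independent of the past
    ([gaussian_dyadic_sum], [gaussian_ito_sum]). The Itô isometry and Parseval's identity identify
    the variances.

    From (a) to (b): if Z induces the integral, the law of Z is Gaussian, and what has to be found
    is a covariance operator with values in V itself. The variances are bounded over the contractive
    functionals ([bounded_variance]), and C v is the weak integral of v(Z) Z. It is a norm limit of
    finite combinations of points of a dense sequence, because Z takes values in a separable space
    ([pettis_integral]).

    From (b) to (a): under the product of μ with itself, (x - y)/√2 is a centred V-valued variable
    with the covariance of μ, so it has the characteristic functional of the integral
    ([symmetrized_cf]). The inducing variable must however live on the given Ω, and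
    [induced_transfer] builds it there. With a dense sequence x_j and a countable norming family
    w_n, the property that the numbers X(w_n) are the coordinates of a point of V is a countable
    combination of events {X(w_n) in an interval}. The same combination written for the symmetrised
    variable is the sure event, so the event on Ω has probability one, and there completeness of V
    yields Z. Adding one more functional v to the events shows X v = v(Z) almost surely.

    The equality of joint laws used here is proved without passing to product spaces
    ([cf_event_prob]): two linear families with equal characteristic functions agree on products of
    sines and cosines, hence on bounded pointwise limits of these, hence on indicators of half-lines
    and on all events generated from them. *)

(** * Bounded measurable functions and dominated convergence *)

Section bounded_measurable.
Context d (T : measurableType d) (R : realType).
Implicit Types f g : T -> R.

Definition bdmeas f :=
  measurable_fun setT f /\ exists M, forall x, `|f x| <= M.

Lemma bdmeas_cst c : bdmeas (fun=> c).
Proof. by split => //; exists `|c|. Qed.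

Lemma bdmeasD f g : bdmeas f -> bdmeas g -> bdmeas (fun x => f x + g x).
Proof.
move=> [mf [M fM]] [mg [N gN]]; split; first exact: measurable_funD.
by exists (M + N) => x; rewrite (le_trans (ler_normD _ _))// lerD.
Qed.

Lemma bdmeasM f g : bdmeas f -> bdmeas g -> bdmeas (fun x => f x * g x).
Proof.
move=> [mf [M fM]] [mg [N gN]]; split; first exact: measurable_funM.
by exists (M * N) => x; rewrite normrM ler_pM.
Qed.

Lemma bdmeas_cos f : measurable_fun setT f -> bdmeas (fun x => cos (f x)).
Proof.
move=> mf; split; last by exists 1 => x; rewrite ler_norml cos_geN1 cos_le1.
by apply: measurableT_comp => //; apply: continuous_measurable_fun; exact: continuous_cos.
Qed.

Lemma bdmeas_sin f : measurable_fun setT f -> bdmeas (fun x => sin (f x)).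
Proof.
move=> mf; split; last by exists 1 => x; rewrite ler_norml sin_geN1 sin_le1.
by apply: measurableT_comp => //; apply: continuous_measurable_fun; exact: continuous_sin.
Qed.

Lemma bdmeas_indic (A : set T) : measurable A -> bdmeas (\1_A : T -> R).
Proof.
move=> mA; split; first exact: measurable_indic.
by exists 1 => x; rewrite indicE; case: (_ \in _); rewrite ?normr1 ?normr0.
Qed.

Lemma bdmeas_integrable (P : probability T R) f :
  bdmeas f -> P.-integrable setT (EFin \o f).
Proof.
move=> [mf [M fM]]; apply: measurable_bounded_integrable => //.
  by apply: (le_lt_trans (probability_le1 P measurableT)); rewrite ltry.
by exists M; split; [exact: num_real|move=> x Mx y _ /=; rewrite (le_trans (fM y))// ltW].
Qed.

Lemma cvg_Rintegral (mu : {measure set T -> \bar R}) (F : nat -> T -> R) f g :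
  (forall n, measurable_fun setT (F n)) -> (forall x, F n x @[n --> \oo] --> f x) ->
  mu.-integrable setT (EFin \o g) -> (forall n x, `|F n x| <= g x) ->
  mu.-integrable setT (EFin \o f) /\
  (\int[mu]_x F n x @[n --> \oo] --> \int[mu]_x f x).
Proof.
move=> mF Ff ig Fg.
have mf : measurable_fun setT f by apply: (measurable_fun_cvg mF) => x _; exact: Ff.
have [|||||intf _ cvgf] := @dominated_convergence _ T R mu setT measurableT
  (fun n => EFin \o F n) (EFin \o f) (EFin \o g).
- by move=> n; exact/measurable_EFinP.
- exact/measurable_EFinP.
- by apply: aeW => x _ /=; apply: cvg_EFin; [exact: nearW|exact: Ff].
- exact: ig.
- by apply: aeW => x n _ /=; rewrite lee_fin.
split => //; apply: fine_cvg; rewrite fineK; first exact: cvgf.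
exact: integrable_fin_num.
Qed.

End bounded_measurable.

(** * Indicators of half-lines as limits of trigonometric polynomials *)

Section threshold.
Context {R : realType}.

(** With q the square root of r, n r^n is (n q^n) q^n, and Bernoulli's inequality for 1/q bounds n
    q^n by q/(1 - q). *)
Lemma cvg_nXn (r : R) : 0 <= r < 1 -> n%:R * r ^+ n @[n --> \oo] --> 0.
Proof.
move=> /andP[r0 r1]; have [->|rneq0] := eqVneq r 0.
  apply: cvg_near_cst; near=> n; rewrite expr0n gtn_eqF ?mulr0//.
  by near: n; exact: nbhs_infty_gt.
pose q := Num.sqrt r.
have q0 : 0 < q by rewrite sqrtr_gt0 lt_neqAle eq_sym rneq0.
have q1 : q < 1 by rewrite -sqrtr1 ltr_sqrt.
have nq n : n%:R * q ^+ n <= q / (1 - q).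
  have : (1 + (q^-1 - 1)) ^+ n >= 1 + n%:R * (q^-1 - 1).
    elim: n => [|n IH]; first by rewrite expr0 mul0r addr0.
    have h0 : 0 <= q^-1 - 1 by rewrite subr_ge0 invf_ge1// ltW.
    rewrite exprS; set h := q^-1 - 1 in h0 IH *.
    apply: le_trans (_ : (1 + h) * (1 + n%:R * h) <= _); last first.
      by rewrite ler_wpM2l// addr_ge0.
    rewrite -natr1; have : 0 <= n%:R * h * h by rewrite !mulr_ge0.
    lra.
  rewrite [1 + (q^-1 - 1)]addrC subrK exprVn => B.
  have {}B : n%:R * (q^-1 - 1) <= (q ^+ n)^-1 by apply: le_trans B; lra.
  have qn0 : 0 < q ^+ n by exact: exprn_gt0.
  have {}B : n%:R * (q^-1 - 1) * q ^+ n <= 1 by rewrite -ler_pdivlMr// mul1r.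
  rewrite ler_pdivlMr ?subr_gt0//.
  have -> : n%:R * q ^+ n * (1 - q) = q * (n%:R * (q^-1 - 1) * q ^+ n).
    by field; lra.
  by rewrite -[leRHS]mulr1 ler_wpM2l// ltW.
have -> : (fun n => n%:R * r ^+ n) = (fun n => (n%:R * q ^+ n) * q ^+ n).
  by apply/funext => n; rewrite -mulrA -exprMn -expr2 sqr_sqrtr.
apply: (@squeeze_cvgr _ _ _ _ (fun=> 0) (fun n => q / (1 - q) * q ^+ n)).
- near=> n; rewrite !mulr_ge0 ?exprn_ge0 ?(ltW q0)//=.
  by rewrite ler_wpM2r// exprn_ge0// ltW.
- exact: cvg_cst.
- rewrite -[0](mulr0 (q / (1 - q))); apply: cvgMr.
  by apply: cvg_expr; rewrite ger0_norm ?(ltW q0).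
Unshelve. all: by end_near. Qed.

(* The lattice form of the Stone-Weierstrass trick: powers of a bounded
   function separate the values below and above 1/2. *)
Lemma cvg_threshold (g : R) : 0 <= g <= 1 ->
  (1 - g ^+ n) ^+ (n * 2 ^ n) @[n --> \oo] --> ((g < 2^-1)%R%:R : R).
Proof.
move=> /andP[g0 g1].
have gn n : 0 <= g ^+ n <= 1 by rewrite exprn_ge0//= exprn_ile1.
have [gh|gh] := ltP g 2^-1.
(* With m = n 2^n, Bernoulli gives (1 - g^n)^m >= 1 - m g^n, and m g^n = n (2g)^n tends to 0. *)
- apply: (@squeeze_cvgr _ _ _ _ (fun n => 1 - n%:R * (2 * g) ^+ n) (fun=> 1)).
  + near=> n; have /andP[gn0 gn1] := gn n.
    rewrite exprn_ile1 ?andbT; last 2 first.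
      by rewrite subr_ge0.
      by rewrite lerBlDr lerDl.
    have -> : n%:R * (2 * g) ^+ n = (n * 2 ^ n)%:R * g ^+ n.
      by rewrite exprMn natrM natrX mulrA.
    elim: (n * 2 ^ n)%N => [|m IH]; first by rewrite mul0r subr0 expr0.
    rewrite exprS; apply: le_trans (_ : (1 - g ^+ n) * (1 - m%:R * g ^+ n) <= _).
      rewrite -natr1; have : 0 <= m%:R * g ^+ n * g ^+ n by rewrite !mulr_ge0.
      lra.
    by rewrite ler_wpM2l// subr_ge0.
  + rewrite -[X in _ --> X]subr0; apply: cvgB; first exact: cvg_cst.
    by apply: cvg_nXn; lra.
  + exact: cvg_cst.
(* Here m g^n = n (2g)^n is at least n, while (1 - t)^m (1 + m t) <= 1 for t in [0, 1]. *)
- apply: (@squeeze_cvgr _ _ _ _ (fun=> 0) (fun n => n.+1%:R^-1)).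
  + near=> n; have /andP[gn0 gn1] := gn n.
    rewrite exprn_ge0 ?subr_ge0//=.
    have N1 : (1 + n%:R : R) <= 1 + (n * 2 ^ n)%:R * g ^+ n.
      have g2 : 1 <= 2 * g by lra.
      by rewrite lerD2l natrM natrX -mulrA -exprMn ler_peMr// exprn_ege1.
    have B m : (1 - g ^+ n) ^+ m * (1 + m%:R * g ^+ n) <= 1.
      elim: m => [|m IH]; first by rewrite expr0 mul0r addr0 mulr1.
      apply: le_trans IH; rewrite exprSr -mulrA ler_wpM2l ?exprn_ge0 ?subr_ge0//.
      rewrite -natr1; have : 0 <= m%:R * g ^+ n * g ^+ n by rewrite !mulr_ge0.
      have : 0 <= g ^+ n * g ^+ n by rewrite !mulr_ge0.
      lra.
    have -> : n.+1%:R^-1 = 1 / (1 + n%:R) :> R by rewrite -natr1 addrC mul1r.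
    rewrite ler_pdivlMr ?ltr_pwDl//.
    apply: le_trans (B (n * 2 ^ n)%N).
    by rewrite ler_wpM2l// exprn_ge0// subr_ge0.
  + exact: cvg_cst.
  + exact: cvg_harmonic.
Unshelve. all: by end_near. Qed.

(** As soon as |y| < π (l + 1), the sine has the sign of y, so the sequence is eventually
    constant. *)
Lemma cvg_sin_sign (y : R) :
  ((1 + sin (y / l.+1%:R)) / 2 < 2^-1)%R%:R @[l --> \oo] --> ((y < 0)%R%:R : R).
Proof.
apply: cvg_near_cst; near=> l.
have l0 : (0 : R) < l.+1%:R by [].
have H : `|y / l.+1%:R| < pi.
  rewrite normrM normfV (gtr0_norm l0) ltr_pdivrMr//.
  have pi1 : (1 : R) < pi by have := @pi_ge2 R; lra.
  have : `|y| < l.+1%:R.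
    near: l; exists (Num.truncn `|y|) => // k /= yk.
    by rewrite (lt_le_trans (truncnS_gt _))// ler_nat.
  by move=> /lt_le_trans -> //; rewrite ler_peMl// ltW.
suff -> : ((1 + sin (y / l.+1%:R)) / 2 < 2^-1) = (y < 0) by [].
have -> : ((1 + sin (y / l.+1%:R)) / 2 < 2^-1) = (sin (y / l.+1%:R) < 0).
  by apply/idP/idP; lra.
have [y0|y0|->] := ltgtP y 0.
- have z0 : y / l.+1%:R < 0 by rewrite pmulr_llt0// invr_gt0.
  rewrite -[y / _]opprK sinN oppr_lt0; apply: sin_gt0_pi.
  by move: H; rewrite ltr0_norm// oppr_gt0 z0.
- have z0 : 0 < y / l.+1%:R by rewrite divr_gt0.
  apply/negbTE; rewrite -leNgt ltW//; apply: sin_gt0_pi.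
  by move: H; rewrite gtr0_norm// z0.
- by rewrite mul0r sin0 ltxx.
Unshelve. all: by end_near. Qed.

End threshold.

(** * Characteristic functions determine joint laws *)

Section characteristic_functions.
Context {R : realType} d1 (T1 : measurableType d1) (P1 : probability T1 R)
  d2 (T2 : measurableType d2) (P2 : probability T2 R).
(** [L] pairs corresponding variables of two models. Closure under linear combinations makes
    equality of the one-dimensional characteristic functions an equality of all joint ones. *)
Variable L : (T1 -> R) -> (T2 -> R) -> Prop.
Hypothesis L_meas : forall x y, L x y ->
  measurable_fun setT x /\ measurable_fun setT y.
Hypothesis L0 : L (fun=> 0) (fun=> 0).
Hypothesis LD : forall a x y x' y', L x y -> L x' y' ->
  L (fun w => a * x w + x' w) (fun w => a * y w + y' w).
Hypothesis L_cf : forall x y, L x y ->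
  \int[P1]_w cos (x w) = \int[P2]_w cos (y w) /\
  \int[P1]_w sin (x w) = \int[P2]_w sin (y w).

(* [matched F G]: the weighted laws of all pairs in L have the same
   characteristic functions. *)
Definition matched (F : T1 -> R) (G : T2 -> R) := [/\ bdmeas F, bdmeas G &
  forall x y, L x y ->
    \int[P1]_w (F w * cos (x w)) = \int[P2]_w (G w * cos (y w)) /\
    \int[P1]_w (F w * sin (x w)) = \int[P2]_w (G w * sin (y w))].

Lemma matched_lin a F G F' G' : matched F G -> matched F' G' ->
  matched (fun w => a * F w + F' w) (fun w => a * G w + G' w).
Proof.
move=> [bF bG FG] [bF' bG' FG']; split.
- by apply: bdmeasD => //; apply: bdmeasM => //; exact: bdmeas_cst.
- by apply: bdmeasD => //; apply: bdmeasM => //; exact: bdmeas_cst.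
have lin d (T : measurableType d) (P : probability T R) (f f' g : T -> R) :
    bdmeas f -> bdmeas f' -> bdmeas g ->
    \int[P]_w ((a * f w + f' w) * g w) =
      a * \int[P]_w (f w * g w) + \int[P]_w (f' w * g w).
  move=> bf bf' bg; rewrite -RintegralZl//; last first.
    by apply: bdmeas_integrable; exact: bdmeasM.
  rewrite -RintegralD//.
  - by apply: eq_Rintegral => w _; rewrite mulrDl mulrA.
  - apply: (bdmeas_integrable P (f := fun w => a * (f w * g w))).
    by apply: bdmeasM; [exact: bdmeas_cst|exact: bdmeasM].
  - by apply: (bdmeas_integrable P (f := fun w => f' w * g w)); exact: bdmeasM.
move=> x y xy; have [mx my] := L_meas xy.
have [FGc FGs] := FG _ _ xy; have [FGc' FGs'] := FG' _ _ xy.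
by split; (rewrite !lin//; [|exact: bdmeas_cos || exact: bdmeas_sin..]);
  congr (_ * _ + _).
Qed.

(** Dominated convergence with the common bound [M]; this is the passage from trigonometric
    polynomials to indicators. *)
Lemma matched_lim (F : nat -> T1 -> R) (G : nat -> T2 -> R) (f : T1 -> R) (g : T2 -> R) (M : R) :
  (forall n, matched (F n) (G n)) ->
  (forall n w, `|F n w| <= M) -> (forall n w, `|G n w| <= M) ->
  (forall w, F n w @[n --> \oo] --> f w) ->
  (forall w, G n w @[n --> \oo] --> g w) -> matched f g.
Proof.
move=> FG FM GM Ff Gg.
have bl d (T : measurableType d) (H : nat -> T -> R) (h : T -> R) :
    (forall n, bdmeas (H n)) -> (forall n w, `|H n w| <= M) ->
    (forall w, H n w @[n --> \oo] --> h w) -> bdmeas h.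
  move=> bH HM Hh; split.
    apply: (measurable_fun_cvg (h := H)) => [n|x _]; last exact: Hh.
    by have [] := bH n.
  exists M => w; have : `|H n w| @[n --> \oo] --> `|h w| by exact: cvg_norm.
  move=> c; rewrite -(cvg_lim _ c)//; apply: limr_le; first by apply/cvg_ex; exists `|h w|.
  by near=> n.
have cv d (T : measurableType d) (P : probability T R) (H : nat -> T -> R) (h k : T -> R) :
    (forall n, bdmeas (H n)) -> (forall n w, `|H n w| <= M) ->
    (forall w, H n w @[n --> \oo] --> h w) ->
    bdmeas k -> (forall w, `|k w| <= 1) ->
    \int[P]_w (H n w * k w) @[n --> \oo] --> \int[P]_w (h w * k w).
  move=> bH HM Hh bk k1.
  have [||||//] := @cvg_Rintegral _ T R P (fun n w => H n w * k w)
     (fun w => h w * k w) (fun=> M).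
  - by move=> n; have [] := bdmeasM (bH n) bk.
  - by move=> w; apply: cvgMl.
  - by apply: bdmeas_integrable; exact: bdmeas_cst.
  - by move=> n w; rewrite normrM -[M]mulr1 ler_pM.
have bF n : bdmeas (F n) by have [] := FG n.
have bG n : bdmeas (G n) by have [] := FG n.
split; [exact: bl Ff|exact: bl Gg|move=> x y xy].
have [mx my] := L_meas xy.
have cos1 (z : R) : `|cos z| <= 1 by rewrite ler_norml cos_geN1 cos_le1.
have sin1 (z : R) : `|sin z| <= 1 by rewrite ler_norml sin_geN1 sin_le1.
split.
- have := cv _ _ P1 F f _ bF FM Ff (bdmeas_cos mx) (fun w => cos1 _).
  have := cv _ _ P2 G g _ bG GM Gg (bdmeas_cos my) (fun w => cos1 _).
  rewrite (_ : (fun n => _) = (fun n => \int[P1]_w (F n w * cos (x w)))); last first.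
    by apply/funext => n; have [_ _ /(_ _ _ xy)[]] := FG n.
  by move=> /cvg_lim <-// /cvg_lim <-.
- have := cv _ _ P1 F f _ bF FM Ff (bdmeas_sin mx) (fun w => sin1 _).
  have := cv _ _ P2 G g _ bG GM Gg (bdmeas_sin my) (fun w => sin1 _).
  rewrite (_ : (fun n => _) = (fun n => \int[P1]_w (F n w * sin (x w)))); last first.
    by apply/funext => n; have [_ _ /(_ _ _ xy)[]] := FG n.
  by move=> /cvg_lim <-// /cvg_lim <-.
Unshelve. all: by end_near. Qed.

Lemma familyZ a x y : L x y -> L (fun w => a * x w) (fun w => a * y w).
Proof.
move=> xy; have := LD a xy L0.
by rewrite /=; under eq_fun do rewrite addr0; under [X in L _ X]eq_fun do rewrite addr0.
Qed.

Lemma familyD x y x' y' : L x y -> L x' y' ->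
  L (fun w => x w + x' w) (fun w => y w + y' w).
Proof.
move=> xy xy'; have := LD 1 xy xy'.
by rewrite /=; under eq_fun do rewrite mul1r; under [X in L _ X]eq_fun do rewrite mul1r.
Qed.

Lemma familyB x y x' y' : L x y -> L x' y' ->
  L (fun w => x w - x' w) (fun w => y w - y' w).
Proof.
move=> xy xy'; have := familyD xy (familyZ (-1) xy').
by rewrite /=; under eq_fun do rewrite mulN1r; under [X in L _ X]eq_fun do rewrite mulN1r.
Qed.

Lemma cos_cos (a b : R) : cos a * cos b = 2^-1 * cos (b + a) + 2^-1 * cos (b - a).
Proof. by rewrite cosB cosD; field. Qed.
Lemma sin_sin (a b : R) : sin a * sin b = 2^-1 * cos (b - a) + (-2^-1) * cos (b + a).
Proof. by rewrite cosB cosD; field. Qed.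
Lemma cos_sin (a b : R) : cos a * sin b = 2^-1 * sin (b + a) + 2^-1 * sin (b - a).
Proof. by rewrite sinB sinD; field. Qed.
Lemma sin_cos (a b : R) : sin a * cos b = 2^-1 * sin (b + a) + (-2^-1) * sin (b - a).
Proof. by rewrite sinB sinD; field. Qed.

(** The product-to-sum formulas turn a product of two trigonometric factors into functions of x' + x
    and x' - x, which again belong to the family. *)
Lemma matched_trig F G x y : matched F G -> L x y ->
  matched (fun w => F w * cos (x w)) (fun w => G w * cos (y w)) /\
  matched (fun w => F w * sin (x w)) (fun w => G w * sin (y w)).
Proof.
move=> [bF bG FG] xy; have [mx my] := L_meas xy.
have lin d (T : measurableType d) (P : probability T R) (f g h : T -> R) a b :
    bdmeas f -> bdmeas g -> bdmeas h ->
    \int[P]_w (f w * (a * g w + b * h w)) =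
      a * \int[P]_w (f w * g w) + b * \int[P]_w (f w * h w).
  move=> bf bg bh.
  rewrite -!RintegralZl//; [|by apply: bdmeas_integrable; exact: bdmeasM..].
  rewrite -RintegralD//.
  - by apply: eq_Rintegral => w _; ring.
  - apply: (bdmeas_integrable P (f := fun w => a * (f w * g w))).
    by apply: bdmeasM; [exact: bdmeas_cst|exact: bdmeasM].
  - apply: (bdmeas_integrable P (f := fun w => b * (f w * h w))).
    by apply: bdmeasM; [exact: bdmeas_cst|exact: bdmeasM].
have B d (T : measurableType d) (f g : T -> R) : measurable_fun setT f ->
    measurable_fun setT g -> [/\ bdmeas (fun w => cos (f w + g w)),
      bdmeas (fun w => cos (f w - g w)), bdmeas (fun w => sin (f w + g w)) &
      bdmeas (fun w => sin (f w - g w))].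
  move=> mf mg; split; by [apply: bdmeas_cos; exact: measurable_funD|
    apply: bdmeas_cos; exact: measurable_funB|
    apply: bdmeas_sin; exact: measurable_funD|
    apply: bdmeas_sin; exact: measurable_funB].
split; split.
- by apply: bdmeasM => //; exact: bdmeas_cos.
- by apply: bdmeasM => //; exact: bdmeas_cos.
- move=> x' y' xy'; have [mx' my'] := L_meas xy'.
  have [b1 b2 b3 b4] := B _ _ _ _ mx' mx; have [c1 c2 c3 c4] := B _ _ _ _ my' my.
  have [Dc Ds] := FG _ _ (familyD xy' xy); have [Mc Ms] := FG _ _ (familyB xy' xy).
  split.
    under eq_Rintegral do rewrite -mulrA cos_cos.
    under [RHS]eq_Rintegral do rewrite -mulrA cos_cos.
    by rewrite !lin//; congr (_ * _ + _ * _).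
  under eq_Rintegral do rewrite -mulrA cos_sin.
  under [RHS]eq_Rintegral do rewrite -mulrA cos_sin.
  by rewrite !lin//; congr (_ * _ + _ * _).
- by apply: bdmeasM => //; exact: bdmeas_sin.
- by apply: bdmeasM => //; exact: bdmeas_sin.
- move=> x' y' xy'; have [mx' my'] := L_meas xy'.
  have [b1 b2 b3 b4] := B _ _ _ _ mx' mx; have [c1 c2 c3 c4] := B _ _ _ _ my' my.
  have [Dc Ds] := FG _ _ (familyD xy' xy); have [Mc Ms] := FG _ _ (familyB xy' xy).
  split.
    under eq_Rintegral do rewrite -mulrA sin_cos.
    under [RHS]eq_Rintegral do rewrite -mulrA sin_cos.
    by rewrite !lin//; congr (_ * _ + _ * _).
  under eq_Rintegral do rewrite -mulrA sin_sin.
  under [RHS]eq_Rintegral do rewrite -mulrA sin_sin.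
  by rewrite !lin//; congr (_ * _ + _ * _).
Qed.

(* Multiplication by F preserves matching. *)
Definition multiplier (f : T1 -> R) (g : T2 -> R) := forall F G, matched F G ->
  matched (fun w => F w * f w) (fun w => G w * g w).

Lemma multiplier_cst c : multiplier (fun=> c) (fun=> c).
Proof.
move=> F G FG; have := matched_lin (c - 1) FG FG.
under eq_fun do rewrite mulrBl mul1r subrK mulrC.
by under [X in matched _ X]eq_fun do rewrite mulrBl mul1r subrK mulrC.
Qed.

Lemma multiplierD f g f' g' : multiplier f g -> multiplier f' g' ->
  multiplier (fun w => f w + f' w) (fun w => g w + g' w).
Proof.
move=> fg fg' F G FG; have := matched_lin 1 (fg _ _ FG) (fg' _ _ FG).
under eq_fun do rewrite mul1r -mulrDr.
by under [X in matched _ X]eq_fun do rewrite mul1r -mulrDr.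
Qed.

Lemma multiplierM f g f' g' : multiplier f g -> multiplier f' g' ->
  multiplier (fun w => f w * f' w) (fun w => g w * g' w).
Proof.
move=> fg fg' F G FG; have := fg' _ _ (fg _ _ FG).
under eq_fun do rewrite -mulrA.
by under [X in matched _ X]eq_fun do rewrite -mulrA.
Qed.

Lemma multiplierX f g n : multiplier f g ->
  multiplier (fun w => f w ^+ n) (fun w => g w ^+ n).
Proof.
move=> fg; elim: n => [|n IH]; first exact: multiplier_cst.
have := multiplierM fg IH.
under eq_fun do rewrite -exprS.
by under [X in multiplier _ X]eq_fun do rewrite -exprS.
Qed.

Lemma multiplier_lim (f : nat -> T1 -> R) (g : nat -> T2 -> R) (f' : T1 -> R) (g' : T2 -> R) :
  (forall n, multiplier (f n) (g n)) ->
  (forall n w, `|f n w| <= 1) -> (forall n w, `|g n w| <= 1) ->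
  (forall w, f n w @[n --> \oo] --> f' w) ->
  (forall w, g n w @[n --> \oo] --> g' w) -> multiplier f' g'.
Proof.
move=> fg f1 g1 ff' gg' F G FG; have [[mF [M FM]] [mG [N GN]] _] := FG.
have ? : 0 <= `|M| + `|N| by rewrite addr_ge0.
apply: (@matched_lim (fun n w => F w * f n w) (fun n w => G w * g n w) _ _
  (`|M| + `|N|)) => [n|n w|n w|w|w].
- exact: fg.
- rewrite normrM -[leRHS]mulr1 ler_pM// (le_trans (FM _))//.
  by rewrite (le_trans (ler_norm M))// lerDl.
- rewrite normrM -[leRHS]mulr1 ler_pM// (le_trans (GN _))//.
  by rewrite (le_trans (ler_norm N))// lerDr.
- exact: cvgMr.
- exact: cvgMr.
Qed.

(** Two successive limits. For fixed l, (1 + sin((x - c)/(l + 1)))/2 is a multiplier with values in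
    [0, 1], and [cvg_threshold] gives the indicator that it is below 1/2. Letting l grow,
    [cvg_sin_sign] turns this into the indicator of x < c. *)
Lemma multiplier_lt x y c : L x y ->
  multiplier (fun w => (x w < c)%R%:R) (fun w => (y w < c)%R%:R).
Proof.
move=> xy.
have trig01 (z : R) : 0 <= (1 + sin z) / 2 <= 1.
  by have := sin_le1 z; have := sin_geN1 z; lra.
have msin l : multiplier (fun w => (1 + sin ((x w - c) / l.+1%:R)) / 2)
                         (fun w => (1 + sin ((y w - c) / l.+1%:R)) / 2).
  have xyl := familyZ (l.+1%:R^-1) xy.
  have -> : (fun w => (1 + sin ((x w - c) / l.+1%:R)) / 2) =
     (fun w => 2^-1 + (2^-1 * cos (c / l.+1%:R)) * sin (l.+1%:R^-1 * x w) +
        (- 2^-1 * sin (c / l.+1%:R)) * cos (l.+1%:R^-1 * x w)).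
    apply/funext => w; rewrite mulrBl sinB ![l.+1%:R^-1 * _]mulrC.
    by set s := sin (x w / _); set t := cos (x w / _); field.
  have -> : (fun w => (1 + sin ((y w - c) / l.+1%:R)) / 2) =
     (fun w => 2^-1 + (2^-1 * cos (c / l.+1%:R)) * sin (l.+1%:R^-1 * y w) +
        (- 2^-1 * sin (c / l.+1%:R)) * cos (l.+1%:R^-1 * y w)).
    apply/funext => w; rewrite mulrBl sinB ![l.+1%:R^-1 * _]mulrC.
    by set s := sin (y w / _); set t := cos (y w / _); field.
  apply: multiplierD; last first.
    by apply: multiplierM; [exact: multiplier_cst|move=> F G FG;
      exact: (matched_trig FG xyl).1].
  apply: multiplierD; first exact: multiplier_cst.
  by apply: multiplierM; [exact: multiplier_cst|move=> F G FG;
      exact: (matched_trig FG xyl).2].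
have b1 (z : R) n m : `|(1 - ((1 + sin z) / 2) ^+ n) ^+ m| <= 1.
  have /andP[z0 z1] := trig01 z.
  have : 0 <= ((1 + sin z) / 2) ^+ n <= 1 by rewrite exprn_ge0//= exprn_ile1.
  move: (_ ^+ n) => t /andP[t0 t1].
  by rewrite ger0_norm ?exprn_ile1 ?exprn_ge0 ?subr_ge0// lerBlDr lerDl.
have bool1 (b : bool) : `|b%:R : R| <= 1 by case: b; rewrite ?normr1 ?normr0.
have mhalf l : multiplier (fun w => ((1 + sin ((x w - c) / l.+1%:R)) / 2 < 2^-1)%R%:R)
                   (fun w => ((1 + sin ((y w - c) / l.+1%:R)) / 2 < 2^-1)%R%:R).
  apply: (@multiplier_lim
    (fun n w => (1 + (-1) * ((1 + sin ((x w - c) / l.+1%:R)) / 2) ^+ n) ^+ (n * 2 ^ n))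
    (fun n w => (1 + (-1) * ((1 + sin ((y w - c) / l.+1%:R)) / 2) ^+ n) ^+ (n * 2 ^ n)))
    => [n|n w|n w|w|w].
  - apply: multiplierX; apply: multiplierD; first exact: multiplier_cst.
    by apply: multiplierM; [exact: multiplier_cst|exact: multiplierX].
  - by rewrite mulN1r.
  - by rewrite mulN1r.
  - by under eq_fun do rewrite mulN1r; exact: cvg_threshold.
  - by under eq_fun do rewrite mulN1r; exact: cvg_threshold.
have -> : (fun w => (x w < c)%R%:R) = (fun w => (x w - c < 0)%R%:R :> R).
  by apply/funext => w; rewrite subr_lt0.
have -> : (fun w => (y w < c)%R%:R) = (fun w => (y w - c < 0)%R%:R :> R).
  by apply/funext => w; rewrite subr_lt0.
apply: (multiplier_lim mhalf) => // w; exact: cvg_sin_sign.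
Qed.

(* Pairs of events on which the two models agree, jointly with everything
   already matched; they form a sigma-algebra of pairs. *)
Definition cf_event (A : set T1) (B : set T2) :=
  [/\ measurable A, measurable B & multiplier \1_A \1_B].

(** The constants 1 are matched by [L_cf], hence so are the two indicators; testing them on the pair
    of zero variables, where the cosine is 1, gives the probabilities. *)
Lemma cf_event_prob A B : cf_event A B -> P1 A = P2 B.
Proof.
move=> [mA mB mAB].
have M1 : matched (fun=> 1) (fun=> 1).
  split; [exact: bdmeas_cst|exact: bdmeas_cst|move=> x y xy].
  have [Ec Es] := L_cf xy.
  split.
    under eq_Rintegral do rewrite mul1r.
    by rewrite Ec; under [RHS]eq_Rintegral do rewrite mul1r.
  under eq_Rintegral do rewrite mul1r.
  by rewrite Es; under [RHS]eq_Rintegral do rewrite mul1r.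
have [_ _ /(_ _ _ L0)[+ _]] := mAB _ _ M1.
under eq_Rintegral do rewrite cos0 mulr1 mul1r.
under [X in _ = X -> _]eq_Rintegral do rewrite cos0 mulr1 mul1r.
rewrite /Rintegral !integral_indic// !setIT => E.
by rewrite -[LHS]fineK ?fin_num_measure// E fineK ?fin_num_measure.
Qed.

Lemma cf_event_lt x y c : L x y ->
  cf_event (x @^-1` `]-oo, c[) (y @^-1` `]-oo, c[).
Proof.
move=> xy; have [mx my] := L_meas xy; split.
- by rewrite -[X in measurable X]setTI; exact: mx.
- by rewrite -[X in measurable X]setTI; exact: my.
- have := multiplier_lt c xy; congr multiplier.
    by apply/funext => w; rewrite indicE; congr (nat_of_bool _)%:R;
      apply/idP/idP; rewrite inE /= in_itv.
  by apply/funext => w; rewrite indicE; congr (nat_of_bool _)%:R;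
      apply/idP/idP; rewrite inE /= in_itv.
Qed.

Lemma cf_event0 : cf_event set0 set0.
Proof. by split => //; rewrite !indic0; exact: multiplier_cst. Qed.

Lemma cf_eventC A B : cf_event A B -> cf_event (~` A) (~` B).
Proof.
move=> [mA mB AB]; split; [exact: measurableC|exact: measurableC|].
have := multiplierD (multiplier_cst 1) (multiplierM (multiplier_cst (-1)) AB).
congr multiplier; apply/funext => w; rewrite !indicE in_setC.
  by case: (w \in A); rewrite mulN1r ?subrr ?subr0.
by case: (w \in B); rewrite mulN1r ?subrr ?subr0.
Qed.

Lemma cf_eventI A B A' B' : cf_event A B -> cf_event A' B' ->
  cf_event (A `&` A') (B `&` B').
Proof.
move=> [mA mB AB] [mA' mB' AB']; split; [exact: measurableI|exact: measurableI|].
have := multiplierM AB AB'.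
by congr multiplier; apply/funext => w; rewrite indicI.
Qed.

Lemma cf_event_bigcap (A : nat -> set T1) (B : nat -> set T2) :
  (forall n, cf_event (A n) (B n)) -> cf_event (\bigcap_n A n) (\bigcap_n B n).
Proof.
move=> AB; have fin n : cf_event (\big[setI/setT]_(i < n) A i) (\big[setI/setT]_(i < n) B i).
  elim: n => [|n IH]; last by rewrite !big_ord_recr; exact: cf_eventI.
  by rewrite !big_ord0 -setC0 -[X in cf_event _ X]setC0; exact: cf_eventC cf_event0.
have cv T (D : nat -> set T) w :
    (\1_(\big[setI/setT]_(i < n) D i) w : R) @[n --> \oo] --> (\1_(\bigcap_n D n) w : R).
  apply: cvg_near_cst; have [Dw|nDw] := pselect (forall n, D n w).
    apply: nearW => n; rewrite !indicE !mem_set//.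
    by rewrite -bigcap_mkord => i _; exact: Dw.
  have [m nDm] : exists m, ~ D m w by exact/existsNP.
  exists m.+1 => // n /= mn; rewrite !indicE !memNset//.
    by move=> /(_ m I).
  by rewrite -bigcap_mkord => /(_ m mn).
have i1 T (D : set T) w : `|\1_D w : R| <= 1.
  by rewrite indicE; case: (_ \in _); rewrite ?normr1 ?normr0.
split.
- by apply: bigcapT_measurable => n; have [] := AB n.
- by apply: bigcapT_measurable => n; have [] := AB n.
- apply: (@multiplier_lim (fun n => \1_(\big[setI/setT]_(i < n) A i))
      (fun n => \1_(\big[setI/setT]_(i < n) B i))) => // n.
  by have [] := fin n.
Qed.

Lemma cf_event_bigcup (A : nat -> set T1) (B : nat -> set T2) :
  (forall n, cf_event (A n) (B n)) -> cf_event (\bigcup_n A n) (\bigcup_n B n).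
Proof.
move=> AB; rewrite -[\bigcup_n A n]setCK -[\bigcup_n B n]setCK !setC_bigcup.
by apply: cf_eventC; apply: cf_event_bigcap => n; exact: cf_eventC.
Qed.

(** The sets D with this property form a sigma-algebra that contains the half-lines. *)
Lemma cf_event_preimage x y (D : set R) : L x y -> measurable D ->
  cf_event (x @^-1` D) (y @^-1` D).
Proof.
move=> xy mD; have : (@RGenInftyO.G R).-sigma.-measurable D.
  by rewrite -RGenInftyO.measurableE.
move: D {mD}; apply: smallest_sub => //=.
  split => /=.
  - by rewrite !preimage_set0; exact: cf_event0.
  - by move=> D HD; rewrite setTD; exact: (cf_eventC HD).
  - by move=> D HD; rewrite !preimage_bigcup; exact: (cf_event_bigcup HD).
by move=> _ [c ->] /=; exact: cf_event_lt.
Qed.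

End characteristic_functions.

(** * The characteristic function of the normal density *)

Section integral_over_the_line.
Context {R : realType}.
Notation leb := (@lebesgue_measure R).

(** The fundamental theorem on [-(n+1), n+1], then dominated convergence. *)
Lemma Rintegral_derivative0 (F f : R -> R) :
  (forall x : R, is_derive x (1 : R) F (f x)) -> continuous f ->
  leb.-integrable setT (EFin \o f) ->
  F n.+1%:R @[n --> \oo] --> (0 : R) -> F (- n.+1%:R) @[n --> \oo] --> (0 : R) ->
  \int[leb]_x f x = 0.
Proof.
move=> dF cf intf F0 F0'.
have mf : measurable_fun setT f by exact: continuous_measurable_fun.
have cF (x : R) : {for x, continuous F}.
  by apply/differentiable_continuous/derivable1_diffP; exact: ex_derive.
pose I (n : nat) : set R := `[- n.+1%:R, n.+1%:R]%classic.
have E n : \int[leb]_x (f x * \1_(I n) x) = F n.+1%:R - F (- n.+1%:R).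
  transitivity (\int[leb]_(x in I n) f x).
    rewrite [RHS]Rintegral_mkcond; apply: eq_Rintegral => x _.
    by rewrite patchE indicE; case: (x \in _); rewrite ?mulr1 ?mulr0.
  rewrite /Rintegral (@continuous_FTC2 _ f F)//.
  - by rewrite gtrN.
  - exact: continuous_subspaceT.
  - split => //.
    + by apply: cvg_at_right_filter; exact: cF.
    + by apply: cvg_at_left_filter; exact: cF.
  - by move=> x _; rewrite derive1E; exact: derive_val.
have intn : leb.-integrable setT (EFin \o (fun x => `|f x|)).
  by have := integrable_abse intf.
have [||||_] := @cvg_Rintegral _ _ R leb (fun n x => f x * \1_(I n) x) f
  (fun x => `|f x|).
- by move=> n; apply: measurable_funM => //; apply: measurable_indic; exact: measurable_itv.
- move=> x; apply: cvg_near_cst; near=> n.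
  rewrite indicE mem_set ?mulr1// /I /= in_itv /= -ler_norml.
  near: n; exists (Num.truncn `|x|) => // k /= xk.
  by rewrite (le_trans (ltW (truncnS_gt _)))// ler_nat ltnS.
- exact: intn.
- move=> n x; rewrite normrM indicE; case: (_ \in _); rewrite ?normr1 ?normr0 ?mulr1 ?mulr0//.
move=> A; have : (fun n => \int[leb]_x (f x * \1_(I n) x)) @ \oo --> (0 : R).
  rewrite (funext E); have := cvgB F0 F0'; rewrite subrr; exact.
by move=> B; rewrite -(cvg_lim _ A)// (cvg_lim _ B).
Unshelve. all: by end_near. Qed.

End integral_over_the_line.

Section normal_density.
Context {R : realType}.
Variables (m s : R).
Hypothesis s_gt0 : 0 < s.
Notation leb := (@lebesgue_measure R).
Notation phi := (normal_pdf m s).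
Let s_neq0 : s != 0. Proof. by rewrite gt_eqF. Qed.

(** The density is almost everywhere the Radon-Nikodym derivative of the normal law, since both have
    the same integral over every measurable set. *)
Lemma Rintegral_normal_prob (f : R -> R) : bdmeas f ->
  \int[normal_prob m s]_x f x = \int[leb]_x (f x * phi x).
Proof.
move=> bf; pose nu : probability _ R := normal_prob m s.
have intf : nu.-integrable setT (EFin \o f) by exact: bdmeas_integrable.
congr fine.
have dom : nu `<< leb by exact: normal_prob_dominates.
rewrite -[LHS](Radon_Nikodym_change_of_variables dom)//.
have mphi : measurable_fun setT (fun x => (phi x)%:E).
  by apply/measurable_EFinP; exact: measurable_normal_pdf.
have dom' : charge_of_finite_measure nu `<< leb by exact: dom.
apply: ae_eq_integral => //.
- by apply: emeasurable_funM => //; exact: measurable_int intf.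
- by apply/measurable_EFinP/measurable_funM; [case: bf|exact: measurable_normal_pdf].
- have : ae_eq leb setT (Radon_Nikodym (charge_of_finite_measure nu) leb)
      (fun x => (phi x)%:E).
    apply: integral_ae_eq => //; first exact: Radon_Nikodym_integrable.
    by move=> E _ mE; rewrite -Radon_Nikodym_integral.
  by apply: filterS => x /= /(_ I) ->.
Qed.

Lemma is_derive_normal_pdf (x : R) :
  is_derive x (1 : R) phi (- ((x - m) / s ^+ 2) * phi x).
Proof.
rewrite normal_pdfE// /normal_fun.
apply: is_derive_eq.
rewrite /GRing.scale /=.
by set E := expR _; field.
Qed.

(** With y = |x - m|/s, linear growth is absorbed by |x - m| + 1 <= (s + 1) exp(y²/4). The factor
    exp(-y²/4) that remains is the unnormalised normal density of standard deviation √2 s, and [C]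
    collects s + 1 and the two normalisations. *)
Lemma integrable_normal_pdfM (f : R -> R) : measurable_fun setT f ->
  (forall x, `|f x| <= `|x - m| + 1) ->
  leb.-integrable setT (EFin \o (fun x => f x * phi x)).
Proof.
move=> mf fm; pose s' := Num.sqrt 2 * s.
have s'0 : s' != 0 by rewrite mulf_neq0// gt_eqF// sqrtr_gt0.
have := @integrable_normal_pdf R m s'.
pose C := (s + 1) * normal_peak s / normal_peak s'.
move=> /(integrableZl measurableT C); apply: le_integrable => //.
  by apply/measurable_EFinP/measurable_funM => //; exact: measurable_normal_pdf.
move=> x _ /=; rewrite lee_fin [leRHS]ger0_norm; last first.
  by rewrite !mulr_ge0 ?invr_ge0 ?normal_peak_ge0 ?normal_pdf_ge0// addr_ge0// ltW.
rewrite !normal_pdfE// normrM [X in _ * X]ger0_norm ?mulr_ge0 ?normal_peak_ge0 ?normal_fun_ge0//.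
have -> : C * (normal_peak s' * normal_fun m s' x) = (s + 1) * normal_peak s * normal_fun m s' x.
  by rewrite /C; field; rewrite gt_eqF// normal_peak_gt0.
suff h : `|f x| * normal_fun m s x <= (s + 1) * normal_fun m s' x.
  by have := ler_wpM2l (normal_peak_ge0 s) h; lra.
pose y := `|x - m| / s.
have y0 : 0 <= y by rewrite divr_ge0// ltW.
have fy : `|f x| <= (s + 1) * expR (y ^+ 2 / 4).
  apply: (le_trans (fm x)); have -> : `|x - m| = s * y by rewrite /y mulrC divfK.
  have y1 : y <= expR (y ^+ 2 / 4).
    apply: le_trans (expR_ge1Dx _); have := sqr_ge0 (y / 2 - 1); lra.
  have y2 : 1 <= expR (y ^+ 2 / 4) by rewrite -[leLHS]expR0 ler_expR; have := sqr_ge0 y; lra.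
  by rewrite mulrDl mul1r lerD// ler_wpM2l// ltW.
have E1 : normal_fun m s x = expR (- (y ^+ 2 / 2)).
  by rewrite /normal_fun /y exprMn real_normK ?num_real//; congr expR; field.
have E2 : normal_fun m s' x = expR (- (y ^+ 2 / 4)).
  rewrite /normal_fun /s' /y [(_ * s) ^+ 2]exprMn sqr_sqrtr// exprMn real_normK ?num_real//.
  by congr expR; field.
rewrite E1 E2.
apply: (@le_trans _ _ ((s + 1) * expR (y ^+ 2 / 4) * expR (- (y ^+ 2 / 2)))).
  by rewrite ler_wpM2r// expR_ge0.
rewrite -mulrA -expRD; apply: ler_wpM2l; first by have := s_gt0; lra.
by rewrite ler_expR; lra.
Qed.

Lemma cvg_normal_pdf0 (x : nat -> R) : (forall n, `|x n| = n.+1%:R) ->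
  phi (x n) @[n --> \oo] --> (0 : R).
Proof.
move=> xn; apply/cvgrPdist_le => /= e e0.
pose p := normal_peak s; have p0 : 0 <= p by exact: normal_peak_ge0.
near=> n; rewrite sub0r normrN ger0_norm ?normal_pdf_ge0// normal_pdfE// -/p.
pose y := `|x n - m|; pose u := y ^+ 2 / (s ^+ 2 *+ 2).
have s20 : 0 < s ^+ 2 by rewrite exprn_gt0.
have yn : p * s ^+ 2 / e + 1 <= y.
  have : p * s ^+ 2 / e + 1 + `|m| <= n.+1%:R.
    near: n; exists (Num.truncn (p * s ^+ 2 / e + 1 + `|m|)) => // k /= xk.
    by rewrite (le_trans (ltW (truncnS_gt _)))// ler_nat ltnS.
  by rewrite -xn /y => h; have := ler_normB (x n - m) (- m); rewrite opprK subrK normrN; lra.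
have u1 : p / e <= u.
  rewrite /u ler_pdivlMr ?mulrn_wgt0//.
  have -> : p / e * (s ^+ 2 *+ 2) = 2 * (p * s ^+ 2 / e) by rewrite -mulr_natr; ring.
  by have := sqr_ge0 (y - 1); have := sqr_ge0 y; lra.
have -> : normal_fun m s (x n) = (expR u)^-1.
  by rewrite -expRN /normal_fun /u /y real_normK ?num_real// mulNr.
rewrite ler_pdivrMr ?expR_gt0// mulrC -ler_pdivrMr//.
by apply: (le_trans u1); apply: le_trans (expR_ge1Dx u); lra.
Unshelve. all: by end_near. Qed.

(* Integrate the derivative of sin(t(x-m)+c) phi(x) over the line. *)
Lemma normal_pdf_by_parts (t c : R) :
  \int[leb]_x ((x - m) * sin (t * (x - m) + c) * phi x) =
  t * s ^+ 2 * \int[leb]_x (cos (t * (x - m) + c) * phi x).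
Proof.
pose F x := sin (t * (x - m) + c) * phi x.
pose f x := t * (cos (t * (x - m) + c) * phi x) +
   (- (s ^+ 2)^-1) * ((x - m) * sin (t * (x - m) + c) * phi x).
have cphi : continuous phi by exact: continuous_normal_pdf.
have clin : continuous (fun x : R => t * (x - m) + c).
  move=> x; apply: cvgD; last exact: cvg_cst.
  by apply: cvgMr; apply: cvgB; [exact: cvg_id|exact: cvg_cst].
have csin : continuous (fun x : R => sin (t * (x - m) + c)).
  by move=> x; apply: continuous_comp; [exact: clin|exact: continuous_sin].
have ccos : continuous (fun x : R => cos (t * (x - m) + c)).
  by move=> x; apply: continuous_comp; [exact: clin|exact: continuous_cos].
have cos1 (z : R) : `|cos z| <= 1 by rewrite ler_norml cos_geN1 cos_le1.
have sin1 (z : R) : `|sin z| <= 1 by rewrite ler_norml sin_geN1 sin_le1.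
have cx : continuous (fun x : R => x - m).
  by move=> x; apply: cvgB; [exact: cvg_id|exact: cvg_cst].
have ic : leb.-integrable setT (EFin \o (fun x => cos (t * (x - m) + c) * phi x)).
  apply: integrable_normal_pdfM => [|x]; first exact: continuous_measurable_fun.
  by rewrite (le_trans (cos1 _))// lerDr.
have is_ : leb.-integrable setT
    (EFin \o (fun x => (x - m) * sin (t * (x - m) + c) * phi x)).
  apply: integrable_normal_pdfM => [|x].
    by apply: continuous_measurable_fun => x; apply: cvgM; [exact: cx|exact: csin].
  by rewrite normrM (@le_trans _ _ `|x - m|)// ?lerDl// ler_piMr.
have i1 : leb.-integrable setT (EFin \o (fun x => t * (cos (t * (x - m) + c) * phi x))).
  exact: (integrableZl measurableT t ic).
have i2 : leb.-integrable setT
   (EFin \o (fun x => (- (s ^+ 2)^-1) * ((x - m) * sin (t * (x - m) + c) * phi x))).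
  exact: (integrableZl measurableT _ is_).
have F0 (x : nat -> R) : (forall n, `|x n| = n.+1%:R) ->
    F (x n) @[n --> \oo] --> (0 : R).
  move=> xn; apply: norm_cvg0.
  apply: (squeeze_cvgr _ (cvg_cst 0) (cvg_normal_pdf0 xn)).
  apply: nearW => n; rewrite normr_ge0 /F normrM [X in _ * X]ger0_norm ?normal_pdf_ge0//.
  by rewrite ler_piMl ?normal_pdf_ge0.
have : \int[leb]_x f x = 0.
  apply: (@Rintegral_derivative0 _ F).
  - move=> x; have := is_derive_normal_pdf x => dphi.
    rewrite /F; apply: is_derive_eq; rewrite /f /GRing.scale /=.
    by set S := sin _; set C := cos _; set p := phi x; field.
  - move=> x; apply: cvgD; apply: cvgMr; apply: cvgM; try exact: cphi.
      exact: ccos.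
    by apply: cvgM; [exact: cx|exact: csin].
  - have := integrableD measurableT i1 i2.
    by apply: eq_integrable.
  - by apply: F0 => n; rewrite normr_nat.
  - by apply: F0 => n; rewrite normrN normr_nat.
rewrite /f RintegralD// !RintegralZl// => /eqP; rewrite addr_eq0 => /eqP.
rewrite mulNr opprK => E.
by rewrite [t * s ^+ 2]mulrC -mulrA E mulVKf// sqrf_eq0.
Qed.

End normal_density.

Section normal_characteristic_function.
Context {R : realType}.
Variables (m s : R).
Hypothesis s_gt0 : 0 < s.
Notation leb := (@lebesgue_measure R).
Notation phi := (normal_pdf m s).

(** The phase [c] makes one differential equation serve for both transforms: a shift by -π/2 turns
    the cosine into the sine. *)
Let psi (c t : R) := \int[leb]_x (cos (t * (x - m) + c) * phi x).

Let cos1 (z : R) : `|cos z| <= 1. Proof. by rewrite ler_norml cos_geN1 cos_le1. Qed.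
Let sin1 (z : R) : `|sin z| <= 1. Proof. by rewrite ler_norml sin_geN1 sin_le1. Qed.

(** Differentiation under the integral sign, dominated by |x - m| times the density, followed by
    [normal_pdf_by_parts]. *)
Let is_derive_psi c (t : R) : is_derive t (1 : R) (psi c) (- (t * s ^+ 2) * psi c t).
Proof.
pose f (t x : R) := cos (t * (x - m) + c) * phi x.
pose G (x : R) := `|x - m| * phi x.
have d1 (a x : R) : is_derive a (1 : R) (f ^~ x) (- ((x - m) * sin (a * (x - m) + c) * phi x)).
  rewrite /f; apply: is_derive_eq; rewrite /GRing.scale /=.
  by set S := sin _; set p := phi x; ring.
have mlin a : measurable_fun setT (fun x : R => a * (x - m) + c).
  by apply: measurable_funD => //; apply: measurable_funM => //; exact: measurable_funB.
have intf a : leb.-integrable setT (EFin \o f a).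
  apply: (integrable_normal_pdfM s_gt0) => [|x].
    by have [] := bdmeas_cos (mlin a).
  by rewrite (le_trans (cos1 _))// lerDr.
have intG : leb.-integrable setT (EFin \o G).
  apply: (integrable_normal_pdfM s_gt0) => [|x]; last by rewrite normr_id lerDl.
  by apply: measurableT_comp => //; exact: measurable_funB.
have G0 x : 0 <= G x by rewrite mulr_ge0 ?normal_pdf_ge0.
have tI : `]t - 1, t + 1[%classic t by rewrite /= in_itv /=; apply/andP; split; lra.
have Gub a x : `]t - 1, t + 1[%classic a -> setT x -> `|partial1of2 f a x| <= G x.
  move=> _ _; rewrite partial1of2E (@derive_val _ _ _ _ _ _ _ (d1 a x)).
  rewrite normrN !normrM (ger0_norm (normal_pdf_ge0 _ _ _)).
  by rewrite ler_wpM2r ?normal_pdf_ge0// ler_piMr.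
have E : 'D_1 (psi c) t = \int[leb]_x partial1of2 f t x.
  rewrite -derive1E.
  by apply: (@differentiation_under_integral _ _ _ leb f _ measurableT t _ _ tI
      _ _ G G0 intG Gub) => [a _|a x _ _]; [exact: intf|exact: ex_derive].
have D : derivable (psi c) t 1.
  by apply: (@derivable_under_integral _ _ _ leb f _ measurableT t _ _ tI
      _ _ G G0 intG Gub) => [a _|a x _ _]; [exact: intf|exact: ex_derive].
apply: DeriveDef => //; rewrite E.
have -> : \int[leb]_x partial1of2 f t x =
    \int[leb]_x ((-1) * ((x - m) * sin (t * (x - m) + c) * phi x)).
  by apply: eq_Rintegral => x _; rewrite partial1of2E (@derive_val _ _ _ _ _ _ _ (d1 t x)) mulN1r.
rewrite RintegralZl//; last first.
  apply: (integrable_normal_pdfM s_gt0) => [|x].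
    by apply: measurable_funM; [exact: measurable_funB|have [] := bdmeas_sin (mlin t)].
  by rewrite normrM (@le_trans _ _ `|x - m|)// ?lerDl// ler_piMr.
by rewrite normal_pdf_by_parts// mulrA mulN1r.
Qed.

(** By the equation for [psi], the product psi(t) exp(t² s²/2) has derivative zero, so it keeps its
    value cos c at t = 0. *)
Lemma normal_pdf_cf c t :
  \int[leb]_x (cos (t * (x - m) + c) * phi x) = cos c * expR (- (t ^+ 2 * s ^+ 2 / 2)).
Proof.
pose h (t : R) := psi c t * expR (t ^+ 2 * s ^+ 2 / 2).
have dh (a : R) : is_derive a (1 : R) h 0.
  rewrite /h; have := is_derive_psi c a => d1.
  apply: is_derive_eq; rewrite /GRing.scale /=.
  by set e := expR _; set p := psi _ _; field.
have := is_derive_0_is_cst t 0 dh; rewrite /h expr0n /= !mul0r expR0 mulr1.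
have -> : psi c 0 = cos c.
  rewrite /psi; under eq_Rintegral do rewrite mul0r add0r.
  rewrite RintegralZl//; last exact: integrable_normal_pdf.
  by rewrite /Rintegral integral_normal_pdf mulr1.
by move=> <-; rewrite expRN mulfK// gt_eqF// expR_gt0.
Qed.

End normal_characteristic_function.

(** * Gaussian laws and their characteristic functions *)

Section gaussian_laws.
Context {R : realType} d (T : measurableType d) (P : probability T R).
Implicit Types (X : T -> R) (m v t : R).

Lemma Rintegral_law X (mX : measurable_fun setT X) (Q : probability (measurableTypeR R) R)
    (f : R -> R) :
  (forall A, measurable A -> P (X @^-1` A) = Q A) -> bdmeas f ->
  \int[P]_w f (X w) = \int[Q]_x f x.
Proof.
move=> XQ bf; congr fine; have [mf [M fM]] := bf.
have intf : P.-integrable setT (EFin \o (fun w => f (X w))).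
  by apply: bdmeas_integrable; split; [exact: measurableT_comp|exists M].
have mf' : measurable_fun setT (EFin \o f) by exact/measurable_EFinP.
pose X' : {RV P >-> measurableTypeR R} := 
  @mfun_Sub _ _ T (measurableTypeR R) X (mem_set mX).
transitivity (\int[distribution P X']_y (f y)%:E)%E.
  by rewrite integral_distribution.
by apply: (@eq_measure_integral _ _ _ _ Q) => A mA _; exact: XQ.
Qed.

Lemma gaussian_law_cf X m v (mX : measurable_fun setT X) : 0 <= v ->
  has_gaussian_law P X m v ->
  forall t, \int[P]_w cos (t * X w) = cos (t * m) * expR (- (t ^+ 2 * v / 2)) /\
            \int[P]_w sin (t * X w) = sin (t * m) * expR (- (t ^+ 2 * v / 2)).
Proof.
move=> v0 XN t.
have mt : measurable_fun setT (fun x : R => t * x) by exact: measurable_funM.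
have [v00|vneq0] := eqVneq v 0.
  pose D : probability (measurableTypeR R) R := @dirac _ (measurableTypeR R) m R.
  have XQ A : measurable A -> P (X @^-1` A) = D A.
    by move=> mA; rewrite XN// /gaussian_law v00 eqxx.
  rewrite (Rintegral_law mX XQ (bdmeas_cos mt)) (Rintegral_law mX XQ (bdmeas_sin mt)).
  rewrite v00 mulr0 mul0r oppr0 expR0 !mulr1 /Rintegral !integral_dirac ?diracT ?mul1e//.
  - by apply/measurable_EFinP; have [] := bdmeas_sin mt.
  - by apply/measurable_EFinP; have [] := bdmeas_cos mt.
pose N : probability _ R := normal_prob m (Num.sqrt v).
have XQ A : measurable A -> P (X @^-1` A) = N A.
  by move=> mA; rewrite XN// /gaussian_law (negbTE vneq0).
have s0 : 0 < Num.sqrt v by rewrite sqrtr_gt0 lt_neqAle eq_sym vneq0.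
rewrite (Rintegral_law mX XQ (bdmeas_cos mt)) (Rintegral_law mX XQ (bdmeas_sin mt)).
rewrite (Rintegral_normal_prob m (Num.sqrt v) (bdmeas_cos mt)).
rewrite (Rintegral_normal_prob m (Num.sqrt v) (bdmeas_sin mt)).
split.
- have := normal_pdf_cf m s0 (t * m) t; rewrite sqr_sqrtr// => <-.
  by apply: eq_Rintegral => x _; congr (cos _ * _); ring.
- have := normal_pdf_cf m s0 (t * m - pi / 2) t; rewrite sqr_sqrtr//.
  have cs (z : R) : cos (z - pi / 2) = sin z.
    by rewrite cosB cos_pihalf sin_pihalf mulr0 add0r mulr1.
  rewrite cs => <-.
  apply: eq_Rintegral => x _; rewrite -cs; congr (cos _ * _); ring.
Qed.

End gaussian_laws.

Section same_law.
Context {R : realType} d1 (T1 : measurableType d1) (P1 : probability T1 R)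
  d2 (T2 : measurableType d2) (P2 : probability T2 R).

(** The preceding theory applied to the line spanned by the single pair [X], [Y]. *)
Lemma cf_law (X : T1 -> R) (Y : T2 -> R) :
  measurable_fun setT X -> measurable_fun setT Y ->
  (forall t, \int[P1]_w cos (t * X w) = \int[P2]_w cos (t * Y w)) ->
  (forall t, \int[P1]_w sin (t * X w) = \int[P2]_w sin (t * Y w)) ->
  forall A, measurable A -> P1 (X @^-1` A) = P2 (Y @^-1` A).
Proof.
move=> mX mY Ec Es A mA.
pose L (x : T1 -> R) (y : T2 -> R) := exists t, x = (fun w => t * X w) /\ y = (fun w => t * Y w).
have L0 : L (fun=> 0) (fun=> 0).
  by exists 0; split; apply/funext => w; rewrite mul0r.
have LXY : L X Y by exists 1; split; apply/funext => w; rewrite mul1r.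
apply: (@cf_event_prob _ _ _ P1 _ _ P2 L L0); first by move=> _ _ [t [-> ->]]; split.
apply: cf_event_preimage => //.
- by move=> _ _ [t [-> ->]]; split; exact: measurable_funM.
- move=> a _ _ _ _ [t [-> ->]] [t' [-> ->]]; exists (a * t + t').
  by split; apply/funext => w; rewrite mulrDl mulrA.
Qed.

End same_law.

Section gaussian_moments.
Context {R : realType} d (T : measurableType d) (P : probability T R).
Implicit Types (X : T -> R) (m v t : R).

Lemma cf_gaussian_law X m v : 0 <= v -> measurable_fun setT X ->
  (forall t, \int[P]_w cos (t * X w) = cos (t * m) * expR (- (t ^+ 2 * v / 2))) ->
  (forall t, \int[P]_w sin (t * X w) = sin (t * m) * expR (- (t ^+ 2 * v / 2))) ->
  has_gaussian_law P X m v.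
Proof.
move=> v0 mX Ec Es A mA.
have mid : @measurable_fun _ _ (measurableTypeR R) R setT idfun by exact: measurable_id.
rewrite /gaussian_law; have [v00|vneq0] := eqVneq v 0.
  pose D : probability (measurableTypeR R) R := @dirac _ (measurableTypeR R) m R.
  have DN : has_gaussian_law D idfun m v by move=> B mB; rewrite /gaussian_law v00 eqxx.
  apply: (cf_law mX (P2 := D) mid _ _ mA) => t; [rewrite Ec|rewrite Es];
    by have [] := gaussian_law_cf mid v0 DN t.
pose N : probability (measurableTypeR R) R := normal_prob m (Num.sqrt v).
have NN : has_gaussian_law N idfun m v by move=> B mB; rewrite /gaussian_law (negbTE vneq0).
apply: (cf_law mX (P2 := N) mid _ _ mA) => t; [rewrite Ec|rewrite Es];
    by have [] := gaussian_law_cf mid v0 NN t.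
Qed.

End gaussian_moments.

(** * Moments of Gaussian variables *)

Section fatou.
Context {R : realType} d (T : measurableType d) (mu : {measure set T -> \bar R}).

Lemma fatou_le (F : nat -> T -> R) (f : T -> R) (c : \bar R) :
  (forall n, measurable_fun setT (F n)) -> (forall n x, 0 <= F n x) ->
  measurable_fun setT f ->
  {ae mu, forall x, F n x @[n --> \oo] --> f x} ->
  (forall n, \int[mu]_x (F n x)%:E <= c)%E -> (\int[mu]_x (f x)%:E <= c)%E.
Proof.
move=> mF F0 mf Ff Fc.
have mF' n : measurable_fun setT (fun x => (F n x)%:E) by exact/measurable_EFinP.
have -> : (\int[mu]_x (f x)%:E = \int[mu]_x limn_einf (fun n => (F n x)%:E))%E.
  apply: ae_eq_integral => //.
  - exact/measurable_EFinP.
  - apply: measurableT_comp => //; apply: measurable_fun_limn_esup => n.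
    by apply: measurableT_comp => //; exact: mF'.
  - apply: filterS Ff => x Fx _.
    have Fx' : (F n x)%:E @[n --> \oo] --> (f x)%:E.
      by apply: cvg_EFin; [exact: nearW|exact: Fx].
    rewrite is_cvg_limn_einfE; last by apply/cvg_ex; exists (f x)%:E.
    by rewrite (cvg_lim _ Fx').
have F0' n x : setT x -> (0 <= (F n x)%:E)%E by rewrite lee_fin.
apply: (le_trans (fatou mu measurableT mF' F0')); rewrite limn_einf_lim.
apply: lime_le; first exact: is_cvg_einfs.
apply: nearW => n; apply: le_trans (Fc n); apply: ereal_inf_lbound.
by exists n => /=.
Qed.

End fatou.

Section sine.
Context {R : realType}.

Lemma normr_sin_le (x : R) : `|sin x| <= `|x|.
Proof.
wlog x0 : x / 0 <= x.
  move=> W; have [x0|x0] := leP 0 x; first exact: W.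
  by rewrite -(opprK x) sinN [leLHS]normrN [leRHS]normrN; apply: W; rewrite oppr_ge0 ltW.
have [c _] := @MVT_segment R sin cos 0 x x0 (fun y _ => is_derive_sin y)
  (continuous_subspaceT (@continuous_sin R)).
rewrite sin0 !subr0 => ->; rewrite normrM ler_piMl//.
by rewrite ler_norml cos_geN1 cos_le1.
Qed.

Lemma one_sub_cos (x : R) : 2 * (1 - cos x) = (2 * sin (x / 2)) ^+ 2.
Proof.
have := @cosD R (x / 2) (x / 2); rewrite -splitr => ->.
by rewrite -!expr2 cos2sin2; ring.
Qed.

Lemma cvg_mul_sin (x : R) : n.+1%:R * sin (x / n.+1%:R) @[n --> \oo] --> x.
Proof.
have [->|x0] := eqVneq x 0.
  by under eq_fun do rewrite mul0r sin0 mulr0; exact: cvg_cst.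
have := @is_derive_sin R 0; rewrite cos0 => -[/cvg_ex[/= l Hl] Dl].
have {Dl} l1 : l = 1 by rewrite -Dl; apply/esym/cvg_lim.
rewrite {}l1 in Hl.
pose h (n : nat) := x / n.+1%:R.
have h0 : h n @[n --> \oo] --> (0 : R).
  by rewrite -[X in _ --> X](mulr0 x); apply: cvgMr; exact: cvg_harmonic.
move/cvgr_dnbhsP : Hl => /(_ h) H.
have {}H : (h n)^-1 *: (sin (h n *: 1 + 0) - sin 0) @[n --> \oo] --> (1 : R).
  by apply: H; split => // n; rewrite /h mulf_neq0// invr_neq0.
have -> : (fun n => n.+1%:R * sin (x / n.+1%:R)) =
    (fun n => x * ((h n)^-1 *: (sin (h n *: 1 + 0) - sin 0))).
  apply/funext => n; rewrite /h sin0 subr0 addr0 /GRing.scale /= mulr1 invf_div.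
  by rewrite mulrA mulrCA divff// mulr1.
by rewrite -[X in _ --> X](mulr1 x); exact: cvgMr.
Qed.

End sine.

Section gaussian_moments.
Context {R : realType} d (T : measurableType d) (P : probability T R).
Implicit Types (X : T -> R) (m v t : R).

(** Squeezed by u/(1 + u) <= 1 - exp(-u) <= u with u = v/(2 (n+1)²). *)
Lemma cvg_one_sub_expR v : 0 <= v ->
  2 * n.+1%:R ^+ 2 * (1 - expR (- (n.+1%:R^-1 ^+ 2 * v / 2))) @[n --> \oo] --> v.
Proof.
move=> v0; pose u (n : nat) : R := n.+1%:R^-1 ^+ 2 * v / 2.
have u0 n : 0 <= u n by rewrite /u !mulr_ge0// exprn_ge0.
have E n : v = 2 * n.+1%:R ^+ 2 * u n.
  rewrite /u; have : n.+1%:R != 0 :> R by rewrite pnatr_eq0.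
  by move: n.+1%:R => N N0; field.
have cu : u n @[n --> \oo] --> (0 : R).
  rewrite -[X in _ --> X](mul0r (v / 2)); rewrite /u; under eq_fun do rewrite -mulrA.
  apply: cvgMl; rewrite -[X in _ --> X](mulr0 0).
  under eq_fun do rewrite expr2.
  by apply: cvgM; exact: cvg_harmonic.
apply: (@squeeze_cvgr _ _ _ _ (fun n => v / (1 + u n)) (fun=> v)).
- apply: nearW => n; apply/andP; split.
    rewrite [in leLHS](E n) -mulrA ler_wpM2l ?mulr_ge0 ?exprn_ge0//.
    rewrite ler_pdivrMr ?ltr_pwDl// mulrBl mul1r -/(u n).
    have : expR (- u n) * (1 + u n) <= 1.
      rewrite expRN mulrC -ler_pdivlMr ?invr_gt0 ?expR_gt0// invrK mul1r.
      exact: expR_ge1Dx.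
    lra.
  rewrite [leRHS](E n) ler_wpM2l ?mulr_ge0 ?exprn_ge0// -/(u n).
  by have := expR_ge1Dx (- u n); lra.
- rewrite -[X in _ --> X]divr1; apply: cvgM; first exact: cvg_cst.
  apply: cvgV; first exact: oner_neq0.
  by rewrite -[X in _ --> X]addr0; apply: cvgD; [exact: cvg_cst|exact: cu].
- exact: cvg_cst.
Qed.

(** Moments are read off the characteristic function. With N = n + 1, the function 2N²(1 - cos(X/N))
    = (2N sin(X/(2N)))² tends to X² from below and has expectation 2N²(1 - exp(-v/(2N²))) <= v.
    Fatou gives integrability of X² and dominated convergence the value v. The mean is the limit of
    the expectations of N sin(X/N), all zero. *)
Lemma centred_gaussian_moments X v : 0 <= v -> measurable_fun setT X ->
  has_gaussian_law P X 0 v ->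
  [/\ P.-integrable setT (EFin \o (fun w => X w ^+ 2)),
     \int[P]_w X w ^+ 2 = v & \int[P]_w X w = 0].
Proof.
move=> v0 mX XN.
pose F (n : nat) (w : T) := 2 * n.+1%:R ^+ 2 * (1 - cos (n.+1%:R^-1 * X w)).
have FE n w : F n w = (2 * n.+1%:R * sin (X w / (2 * n.+1%:R))) ^+ 2.
  rewrite /F -mulrA mulrCA one_sub_cos -exprMn mulrCA mulrA.
  congr ((_ * sin _) ^+ 2).
  have : n.+1%:R != 0 :> R by rewrite pnatr_eq0.
  by move: n.+1%:R => N N0; field.
have F0 n w : 0 <= F n w by rewrite FE sqr_ge0.
have F_le n w : F n w <= X w ^+ 2.
  rewrite FE -(real_normK (num_real (X w))) -real_normK ?num_real// ler_sqr ?nnegrE//.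
  rewrite normrM (_ : `|X w| = `|2 * n.+1%:R| * `|X w / (2 * n.+1%:R)|).
    by rewrite ler_wpM2l// normr_sin_le.
  by rewrite -normrM mulrC divfK// mulf_neq0.
have FX w : F n w @[n --> \oo] --> X w ^+ 2.
  (* [F n] is the square of [h] at index 2n + 1, because 2(n + 1) = (2n + 1) + 1. *)
  pose h (n : nat) := n.+1%:R * sin (X w / n.+1%:R).
  have : h (2 * n + 1)%N @[n --> \oo] --> X w.
    apply: (@cvg_comp _ _ _ (fun n => 2 * n + 1)%N h _ \oo); last exact: cvg_mul_sin.
    apply/cvgnyPge => k; near=> n; rewrite (@leq_trans n)//; last by rewrite mul2n -addnn -addnA leq_addr.
    by near: n; exists k.
  move=> c; have -> : (fun n => F n w) = (fun n => h (2 * n + 1)%N * h (2 * n + 1)%N).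
    apply/funext => n; rewrite FE /h expr2 /=.
    by rewrite -natrM (_ : (2 * n + 1).+1 = (2 * n.+1))%N// mulnS addnC.
  by rewrite expr2; exact: (cvgM c c).
have mlin n : measurable_fun setT (fun w => n.+1%:R^-1 * X w) by exact: measurable_funM.
have mF n : measurable_fun setT (F n).
  apply: measurable_funM => //; apply: measurable_funB => //.
  by have [] := bdmeas_cos (mlin n).
have bcos n : bdmeas (fun w => cos (n.+1%:R^-1 * X w)).
  exact: (bdmeas_cos (mlin n)).
have EF n : \int[P]_w F n w = 2 * n.+1%:R ^+ 2 * (1 - expR (- (n.+1%:R^-1 ^+ 2 * v / 2))).
  rewrite /F RintegralZl//; last first.
    apply: bdmeas_integrable; have := bdmeasM (bdmeas_cst T (-1 : R)) (bcos n).
    move=> /(bdmeasD (bdmeas_cst T (1 : R))); by under eq_fun do rewrite mulN1r.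
  rewrite RintegralB//; [|exact: (bdmeas_integrable P (bdmeas_cst T (1 : R)))|exact: bdmeas_integrable].
  have [-> _] := gaussian_law_cf mX v0 XN (n.+1%:R^-1).
  rewrite mulr0 cos0 mul1r Rintegral_cst//.
  by have -> : fine (P setT) = 1; [rewrite [P setT]probability_setT|rewrite mulr1].
have iF n : P.-integrable setT (EFin \o F n).
  apply: bdmeas_integrable; apply: bdmeasM; first exact: bdmeas_cst.
  have := bdmeasM (bdmeas_cst T (-1 : R)) (bcos n).
  move=> /(bdmeasD (bdmeas_cst T (1 : R))); by under eq_fun do rewrite mulN1r.
have iX2 : P.-integrable setT (EFin \o (fun w => X w ^+ 2)).
  apply/integrableP; split; first by apply/measurable_EFinP; exact: measurable_funX.
  apply: (@le_lt_trans _ _ v%:E); last exact: ltry.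
  under eq_integral do rewrite /= ger0_norm ?sqr_ge0//.
  apply: (fatou_le mF F0 (measurable_funX 2 mX) (aeW _ FX)) => n.
  have <- : (fine (\int[P]_w (F n w)%:E))%:E = (\int[P]_w (F n w)%:E)%E.
    by rewrite fineK//; exact: integrable_fin_num (iF n).
  rewrite lee_fin -/(Rintegral P setT (F n)) EF.
  have N0 : n.+1%:R != 0 :> R by rewrite pnatr_eq0.
  have E : v = 2 * n.+1%:R ^+ 2 * (n.+1%:R^-1 ^+ 2 * v / 2).
    by move: n.+1%:R N0 => N N0; field.
  rewrite [leRHS]E ler_wpM2l ?mulr_ge0 ?exprn_ge0//.
  by have := expR_ge1Dx (- (n.+1%:R^-1 ^+ 2 * v / 2)); move: (n.+1%:R^-1 ^+ 2 * v / 2) => u; lra.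
split => //.
  have [|_ c] := cvg_Rintegral mF FX iX2; first by move=> n w; rewrite ger0_norm.
  rewrite -(cvg_lim _ c)//; apply/cvg_lim => //.
  by rewrite (funext EF); exact: cvg_one_sub_expR.
pose G (n : nat) (w : T) := n.+1%:R * sin (X w / n.+1%:R).
have iX : P.-integrable setT (EFin \o (fun w => `|X w|)).
  have i1 := bdmeas_integrable P (bdmeas_cst T (1 : R)).
  apply: (le_integrable measurableT _ _ (integrableD measurableT i1 iX2)).
    by apply/measurable_EFinP; exact: measurableT_comp.
  move=> w _ /=; rewrite lee_fin normr_id [leRHS]ger0_norm ?addr_ge0 ?sqr_ge0//.
  rewrite -(real_normK (num_real (X w))).
  by have := sqr_ge0 (`|X w| - 1); have := sqr_ge0 `|X w|; lra.
have [||_ c] := @cvg_Rintegral _ _ _ P G X (fun w => `|X w|) _ (fun w => @cvg_mul_sin R (X w)) iX.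
- move=> n; apply: measurable_funM => //.
  by have [+ _] := bdmeas_sin (mlin n); under eq_fun do rewrite mulrC.
- move=> n w; rewrite /G normrM.
  apply: (@le_trans _ _ (`|n.+1%:R| * `|X w / n.+1%:R|)).
    by rewrite ler_wpM2l// normr_sin_le.
  by rewrite -normrM mulrC divfK.
rewrite -(cvg_lim _ c)//; apply/cvg_lim => //; apply: cvg_near_cst; apply: nearW => n.
rewrite /G RintegralZl//; last first.
  by apply: bdmeas_integrable; have := bdmeas_sin (mlin n); under eq_fun do rewrite mulrC.
under eq_Rintegral do rewrite mulrC.
have [_ ->] := gaussian_law_cf mX v0 XN (n.+1%:R^-1).
by rewrite mulr0 sin0 mul0r mulr0.
Unshelve. all: by end_near. Qed.

End gaussian_moments.

(** * Expectations of products of independent variables *)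

Section product_expectation.
Context {R : realType} d1 (T1 : measurableType d1) (P1 : probability T1 R)
  d2 (T2 : measurableType d2) (P2 : probability T2 R).

Lemma Rintegral_productM (f : T1 -> R) (g : T2 -> R) :
  P1.-integrable setT (EFin \o f) -> P2.-integrable setT (EFin \o g) ->
  (P1 \x P2)%E.-integrable setT (fun z => (f z.1 * g z.2)%:E) /\
  \int[(P1 \x P2)%E]_z (f z.1 * g z.2) = (\int[P1]_x f x) * (\int[P2]_y g y).
Proof.
move=> intf intg.
have mf : measurable_fun setT f by exact/measurable_EFinP/(measurable_int _ intf).
have mg : measurable_fun setT g by exact/measurable_EFinP/(measurable_int _ intg).
have mfg : measurable_fun setT (fun z : T1 * T2 => (f z.1 * g z.2)%:E).
  apply/measurable_EFinP; apply: measurable_funM.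
    by apply: measurableT_comp => //; exact: measurable_fst.
  by apply: measurableT_comp => //; exact: measurable_snd.
have Eg (h : T1 -> R) (k : T2 -> R) x : P2.-integrable setT (EFin \o k) ->
    (\int[P2]_y (h x * k y)%:E = (h x * \int[P2]_y k y)%:E)%E.
  move=> ik; rewrite -RintegralZl// /Rintegral fineK//.
  have i := integrableZl measurableT (h x) ik.
  exact: integrable_fin_num i.
have i12 : (P1 \x P2)%E.-integrable setT (fun z => (f z.1 * g z.2)%:E).
  apply/integrable12ltyP => //.
  have ig : P2.-integrable setT (EFin \o (fun y => `|g y|)) by exact: (integrable_abse intg).
  have if_ : P1.-integrable setT (EFin \o (fun y => `|f y|)) by exact: (integrable_abse intf).
  under eq_integral => x _.
    under eq_integral do rewrite abse_EFin normrM.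
    rewrite (Eg (fun x => `|f x|))//; over.
  rewrite /=.
  have := integrableZr measurableT (\int[P2]_y `|g y|) if_.
  move=> /integrableP[_]; apply: le_lt_trans; apply: ge0_le_integral => //.
  - by move=> x _; rewrite lee_fin mulr_ge0// Rintegral_ge0.
  - apply/measurable_EFinP; apply: measurable_funM; last exact: measurable_cst.
    by apply: (measurableT_comp _ mf).
  - apply: measurableT_comp => //; apply: emeasurable_funM => //.
    by apply/measurable_EFinP; exact: (measurableT_comp _ mf).
  - by move=> x _ /=; rewrite lee_fin ler_norm.
split => //.
rewrite {1}/Rintegral -(integral12_prod_meas1 i12) /fubini_F.
under eq_integral do rewrite Eg//.
by rewrite -/(Rintegral P1 setT (fun x => f x * \int[P2]_y g y)) RintegralZr.
Qed.

End product_expectation.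

Section independence.
Context {R : realType} d (T : measurableType d) (P : probability T R).

(** Independence identifies the joint law with the product of the two marginal laws; the rest is
    Fubini. *)
Lemma indep_RintegralM (X Y : T -> R) :
  (forall A B, measurable A -> measurable B ->
     P (X @^-1` A `&` Y @^-1` B) = (P (X @^-1` A) * P (Y @^-1` B))%E) ->
  P.-integrable setT (EFin \o X) -> P.-integrable setT (EFin \o Y) ->
  P.-integrable setT (EFin \o (fun w => X w * Y w)) /\
  \int[P]_w (X w * Y w) = (\int[P]_w X w) * (\int[P]_w Y w).
Proof.
move=> XY iX iY.
have mX : measurable_fun setT X by exact/measurable_EFinP/(measurable_int _ iX).
have mY : measurable_fun setT Y by exact/measurable_EFinP/(measurable_int _ iY).
have mXY : measurable_fun setT (fun w => (X w, Y w)) by exact: measurable_fun_pair.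
pose X' : {RV P >-> R} := mfun_Sub (mem_set mX).
pose Y' : {RV P >-> R} := mfun_Sub (mem_set mY).
pose XY' : {RV P >-> (R * R)%type} := mfun_Sub (mem_set mXY).
pose PX : probability R R := distribution P X'.
pose PY : probability R R := distribution P Y'.
pose PXY : probability _ R := distribution P XY'.
have E A : measurable A -> (PX \x PY)%E A = PXY A.
  apply: product_measure_unique => B C mB mC.
  by rewrite -[LHS]/(P (X @^-1` B `&` Y @^-1` C)) XY.
have iabs (Z : T -> R) (Z' : {RV P >-> R}) : Z' = Z :> (T -> R) ->
    P.-integrable setT (EFin \o Z) ->
    (distribution P Z' : probability R R).-integrable setT (EFin \o idfun) /\
    \int[distribution P Z']_x x = \int[P]_w Z w.
  move=> ZE iZ; split; last first.
    by rewrite /Rintegral integral_distribution//= ZE.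
  apply/integrableP; split; first by apply/measurable_EFinP; exact: measurable_id.
  rewrite ge0_integral_distribution//=; last exact: measurableT_comp.
  by rewrite ZE; have /integrableP[] := iZ.
have [iPX EX] := iabs X X' erefl iX.
have [iPY EY] := iabs Y Y' erefl iY.
have [ip Ep] := Rintegral_productM iPX iPY.
have mm : measurable_fun setT (fun z : R * R => (z.1 * z.2)%:E).
  by have := measurable_int _ ip.
have iPXY : P.-integrable setT (EFin \o (fun w => X w * Y w)).
  apply/integrableP; split; first by apply/measurable_EFinP; exact: measurable_funM.
  have /integrableP[_] := ip.
  rewrite (@eq_measure_integral _ _ _ _ PXY); last by move=> A mA _; exact: E.
  by rewrite ge0_integral_distribution//=; apply/measurable_EFinP; apply: measurableT_comp => //; apply/measurable_EFinP.
split => //; rewrite -EX -EY; rewrite -[in RHS]Ep /Rintegral; congr fine.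
rewrite [RHS](@eq_measure_integral _ _ _ _ PXY); last by move=> A mA _; exact: E.
by rewrite integral_distribution.
Qed.

End independence.

(** * Square-integrable variables and mean square convergence *)

Section square_integrable.
Context {R : realType} d (T : measurableType d) (P : probability T R).
Implicit Types X Y Z : T -> R.

Definition sqint X :=
  measurable_fun setT X /\ P.-integrable setT (EFin \o (fun w => X w ^+ 2)).

Definition msq X : R := \int[P]_w X w ^+ 2.

Lemma msq_ge0 X : 0 <= msq X.
Proof. by apply: Rintegral_ge0 => w _; exact: sqr_ge0. Qed.

Lemma sqintP X : measurable_fun setT X ->
  sqint X <-> (\int[P]_w (X w ^+ 2)%:E < +oo)%E.
Proof.
move=> mX; have E : (\int[P]_w `|(X w ^+ 2)%:E| = \int[P]_w (X w ^+ 2)%:E)%E.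
  by apply: eq_integral => w _; rewrite gee0_abs// lee_fin sqr_ge0.
split=> [[_ /integrableP[_]]|fin]; first by rewrite /= E.
split => //; apply/integrableP; split; last by rewrite /= E.
by apply/measurable_EFinP; exact: measurable_funX.
Qed.

Lemma EFin_msq X : sqint X -> (msq X)%:E = (\int[P]_w (X w ^+ 2)%:E)%E.
Proof. by move=> [_ iX]; rewrite fineK//; exact: integrable_fin_num iX. Qed.

Lemma sqint_le X Y : measurable_fun setT X -> sqint Y ->
  (forall w, X w ^+ 2 <= Y w ^+ 2) -> sqint X.
Proof.
move=> mX [mY iY] XY; split => //; apply: le_integrable iY => //.
  by apply/measurable_EFinP; exact: measurable_funX.
by move=> w _ /=; rewrite lee_fin !ger0_norm ?sqr_ge0.
Qed.

Lemma sqint_cst c : sqint (fun=> c).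
Proof.
split; first exact: measurable_cst.
by apply: (bdmeas_integrable P (f := fun=> c ^+ 2)); exact: bdmeas_cst.
Qed.

Lemma sqintZ c X : sqint X -> sqint (fun w => c * X w).
Proof.
move=> [mX iX]; split; first exact: measurable_funM.
have := integrableZl measurableT (c ^+ 2) iX.
by apply: eq_integrable => // w _; rewrite /= exprMn EFinM.
Qed.

Lemma sqr_addr_le (x y : R) : (x + y) ^+ 2 <= 2 * x ^+ 2 + 2 * y ^+ 2.
Proof. by have := sqr_ge0 (x - y); lra. Qed.

Lemma integrable_two_sqrD X Y : sqint X -> sqint Y ->
  P.-integrable setT (EFin \o (fun w => 2 * X w ^+ 2 + 2 * Y w ^+ 2)).
Proof.
move=> [mX iX] [mY iY].
have i1 := integrableZl measurableT 2 iX; have i2 := integrableZl measurableT 2 iY.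
have := integrableD measurableT i1 i2.
by apply: eq_integrable.
Qed.

Lemma sqintD X Y : sqint X -> sqint Y -> sqint (fun w => X w + Y w).
Proof.
move=> sX sY; have [mX iX] := sX; have [mY iY] := sY.
split; first exact: measurable_funD.
apply: (le_integrable measurableT _ _ (integrable_two_sqrD sX sY)).
  by apply/measurable_EFinP; apply: measurable_funX; exact: measurable_funD.
move=> w _ /=; rewrite lee_fin ger0_norm ?sqr_ge0//.
by rewrite (le_trans (sqr_addr_le _ _))// ler_norm.
Qed.

Lemma sqintB X Y : sqint X -> sqint Y -> sqint (fun w => X w - Y w).
Proof.
move=> sX sY; have := sqintD sX (sqintZ (-1) sY).
by under eq_fun do rewrite mulN1r.
Qed.

Lemma sqint_sum n (X : nat -> T -> R) (p : pred nat) :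
  (forall k, p k -> sqint (X k)) -> sqint (fun w => \sum_(k < n | p k) X k w).
Proof.
move=> sX; elim: n => [|n IH].
  by under eq_fun do rewrite big_ord0; exact: sqint_cst.
have -> : (fun w => \sum_(k < n.+1 | p k) X k w) =
    (fun w => \sum_(k < n | p k) X k w + (if p n then X n w else 0)).
  by apply/funext => w; rewrite big_mkcond big_ord_recr -big_mkcond.
apply: sqintD => //; case pn : (p n); [exact: sX|exact: sqint_cst].
Qed.

Lemma sqint_mul X Y : sqint X -> sqint Y ->
  P.-integrable setT (EFin \o (fun w => X w * Y w)).
Proof.
move=> sX sY; have [mX _] := sX; have [mY _] := sY.
apply: (le_integrable measurableT _ _ (integrable_two_sqrD sX sY)).
  by apply/measurable_EFinP; exact: measurable_funM.
move=> w _ /=; rewrite lee_fin; apply: le_trans (ler_norm _).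
rewrite ler_norml; have := sqr_ge0 (X w - Y w); have := sqr_ge0 (X w + Y w).
have := sqr_ge0 (X w); have := sqr_ge0 (Y w).
by move=> *; apply/andP; split; lra.
Qed.

Lemma sqint_integrable X : sqint X -> P.-integrable setT (EFin \o X).
Proof.
by move=> sX; have := sqint_mul (sqint_cst 1) sX; under eq_fun do rewrite mul1r.
Qed.

Lemma msqD_le X Y : sqint X -> sqint Y ->
  msq (fun w => X w + Y w) <= 2 * msq X + 2 * msq Y.
Proof.
move=> sX sY; have [mX iX] := sX; have [mY iY] := sY.
rewrite -!RintegralZl// -RintegralD//; last 2 first.
  exact: (integrableZl measurableT 2 iX).
  exact: (integrableZl measurableT 2 iY).
apply: le_Rintegral => //; last by move=> w _; exact: sqr_addr_le.
  by have [] := sqintD sX sY.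
exact: integrable_two_sqrD.
Qed.

Lemma msqZ c X : sqint X -> msq (fun w => c * X w) = c ^+ 2 * msq X.
Proof.
move=> [mX iX]; rewrite -RintegralZl//.
by apply: eq_Rintegral => w _; rewrite exprMn.
Qed.

Lemma msqN X : msq (fun w => - X w) = msq X.
Proof. by apply: eq_Rintegral => w _; rewrite sqrrN. Qed.

Lemma msqBC X Y : msq (fun w => X w - Y w) = msq (fun w => Y w - X w).
Proof. by apply: eq_Rintegral => w _; rewrite -opprB sqrrN. Qed.

Lemma msqB_le X Y Z : sqint X -> sqint Y -> sqint Z ->
  msq (fun w => X w - Z w) <=
    2 * msq (fun w => X w - Y w) + 2 * msq (fun w => Y w - Z w).
Proof.
move=> sX sY sZ; have := msqD_le (sqintB sX sY) (sqintB sY sZ).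
by congr (_ <= _); apply: eq_Rintegral => w _; rewrite addrA subrK.
Qed.

Lemma msq_eq0 X : sqint X -> msq X = 0 -> {ae P, forall w, X w = 0}.
Proof.
move=> sX X0; have [mX iX] := sX.
have : ae_eq P setT (fun w => (X w ^+ 2)%:E) (cst 0%E).
  apply/ae_eq_integral_abs => //.
    by apply/measurable_EFinP; exact: measurable_funX.
  under eq_integral do rewrite gee0_abs ?lee_fin ?sqr_ge0//.
  by rewrite -EFin_msq// X0.
by apply: filterS => w /(_ I) /eqP; rewrite eqe sqrf_eq0 => /eqP.
Qed.

Lemma eq_msq X Y : measurable_fun setT X -> measurable_fun setT Y ->
  {ae P, forall w, X w = Y w} -> msq X = msq Y.
Proof.
move=> mX mY XY; congr fine; apply: ae_eq_integral => //.
- by apply/measurable_EFinP; exact: measurable_funX.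
- by apply/measurable_EFinP; exact: measurable_funX.
- by apply: filterS XY => w /= -> _.
Qed.

Definition msq_cvg (X : nat -> T -> R) Y :=
  msq (fun w => X n w - Y w) @[n --> \oo] --> (0 : R).

Lemma msq_cvg_ae (X : nat -> T -> R) Y Y' : (forall n, sqint (X n)) -> sqint Y -> sqint Y' ->
  msq_cvg X Y -> msq_cvg X Y' -> {ae P, forall w, Y w = Y' w}.
Proof.
move=> sX sY sY' XY XY'.
suff E : msq (fun w => Y w - Y' w) = 0.
  have := msq_eq0 (sqintB sY sY') E.
  by apply: filterS => w /eqP; rewrite subr_eq0 => /eqP.
apply/eqP; rewrite eq_le msq_ge0 andbT.
have c : 2 * msq (fun w => X n w - Y w) + 2 * msq (fun w => X n w - Y' w)
    @[n --> \oo] --> (0 : R).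
  rewrite -[X in _ --> X](addr0 0) -{1}(mulr0 2) -[in X in _ + X](mulr0 2).
  by apply: cvgD; exact: cvgMr.
rewrite -(cvg_lim _ c)//; apply: limr_ge; first by apply/cvg_ex; exists 0.
apply: nearW => n; rewrite [X in 2 * X + _]msqBC.
exact: msqB_le.
Qed.

(** Convergence to 0 of extended-real second moments makes some X n - Y square integrable, hence [Y]
    too; from then on real-valued moments can be used. *)
Lemma cvg_L2P (X : nat -> T -> R) Y : (forall n, sqint (X n)) -> measurable_fun setT Y ->
  cvg_L2 P X Y <-> sqint Y /\ msq_cvg X Y.
Proof.
move=> sX mY; rewrite /cvg_L2.
have E n : ('E_P[fun w => ((X n w - Y w) ^+ 2)%R] = \int[P]_w ((X n w - Y w) ^+ 2)%:E)%E.
  by rewrite unlock.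
rewrite (funext E) {E}; split=> [H|[sY H]]; last first.
  have -> : (fun n => \int[P]_w ((X n w - Y w) ^+ 2)%:E)%E =
      (fun n => (msq (fun w => X n w - Y w))%:E).
    by apply/funext => n; rewrite EFin_msq//; exact: sqintB.
  by apply: cvg_EFin; [exact: nearW|exact: H].
have sY : sqint Y.
  move/fine_cvgP : (H) => [[N _ /(_ N (leqnn _)) /= HN] _].
  have mXN : measurable_fun setT (X N) by have [] := sX N.
  have : sqint (fun w => X N w - Y w).
    by apply/sqintP; [exact: measurable_funB|rewrite ltey_eq HN].
  move=> /(sqintB (sX N)); congr sqint; apply/funext => w.
  by rewrite opprB addrC subrK.
by split => //; exact: (fine_cvg H).
Qed.

(** The Riesz-Fischer theorem. Along a subsequence whose differences D_k have second moments at most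
    4^(-k), the sum of the 2^k D_k² is integrable, and |D_k| <= 2^(-k) + 2^k D_k² gives almost sure
    convergence. Fatou's lemma bounds the distance from the original sequence to the limit. *)
Lemma msq_complete (X : nat -> T -> R) : (forall n, sqint (X n)) ->
  (forall e, 0 < e -> exists N, forall n m, (N <= n)%N -> (N <= m)%N ->
     msq (fun w => X n w - X m w) <= e) ->
  exists2 Y, sqint Y & msq_cvg X Y.
Proof.
move=> sX cX; have mX n : measurable_fun setT (X n) by have [] := sX n.
have q0 k : 0 < (4^-1 : R) ^+ k by rewrite exprn_gt0.
have [N HN] : {N : nat -> nat & forall k n m, (N k <= n)%N -> (N k <= m)%N ->
    msq (fun w => X n w - X m w) <= 4^-1 ^+ k}.
  by apply: (@choice _ _ (fun k Nk => forall n m, (Nk <= n)%N -> (Nk <= m)%N ->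
    msq (fun w => X n w - X m w) <= 4^-1 ^+ k)) => k; exact: cX.
(* Summing the thresholds makes the index at step j at least N k for every k <= j. *)
pose n_ k := (\sum_(j < k.+1) N j)%N.
have Nn k j : (k <= j)%N -> (N k <= n_ j)%N.
  move=> kj; have kj' : (k < j.+1)%N by [].
  by rewrite /n_ (bigD1 (Ordinal kj'))//= leq_addr.
pose Z k := X (n_ k).
have sZ k : sqint (Z k) by exact: sX.
pose D k w := Z k.+1 w - Z k w.
have sD k : sqint (D k) by exact: sqintB.
have eD k : msq (D k) <= 4^-1 ^+ k.
  by apply: HN; apply: Nn.
pose f w : \bar R := (\sum_(k <oo) (2 ^+ k * D k w ^+ 2)%:E)%E.
have iD k : P.-integrable setT (fun w => (2 ^+ k * D k w ^+ 2)%:E).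
  by have [_ i] := sD k; exact: (integrableZl measurableT (2 ^+ k) i).
have mDk k : measurable_fun setT (fun w => (2 ^+ k * D k w ^+ 2)%:E).
  exact: (measurable_int _ (iD k)).
have D0 k w : (0 <= (2 ^+ k * D k w ^+ 2)%:E)%E.
  by rewrite lee_fin mulr_ge0 ?sqr_ge0 ?exprn_ge0.
have mf : measurable_fun setT f.
  by apply: ge0_emeasurable_sum => //= k w _ _; exact: D0.
have intf : P.-integrable setT f.
  apply/integrableP; split => //.
  under eq_integral do rewrite gee0_abs ?nneseries_ge0//.
  rewrite integral_nneseries//.
  apply: (@le_lt_trans _ _ 2%:E); last exact: ltry.
  apply: le_trans (epsilon_trick0 xpredT (ler0n R 2)).
  apply: lee_nneseries => [k _ _|k _]; first by apply: integral_ge0 => w _; exact: D0.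
  have [_ i] := sD k.
  rewrite -[leLHS]fineK; last exact: integrable_fin_num (iD k).
  rewrite lee_fin -/(Rintegral P setT (fun w => 2 ^+ k * D k w ^+ 2)) RintegralZl//.
  apply: le_trans (ler_wpM2l (exprn_ge0 k (ler0n R 2)) (eD k)) _.
  rewrite natrX exprSr invfM mulrCA divff// mulr1 -exprMn -exprVn.
  by have -> : 2 * 4^-1 = 2^-1 :> R by field.
have [A [mA A0 HA]] : {ae P, forall w, cvgn (Z ^~ w)}.
  have := integrable_ae measurableT intf.
  apply: filterS => w /(_ I) fw.
  have c1 : cvgn (series (fun k => 2 ^+ k * D k w ^+ 2)).
    apply: nnseries_is_cvg; last by rewrite ltey_eq fw.
    by move=> k; rewrite mulr_ge0 ?sqr_ge0 ?exprn_ge0.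
  have c2 : cvgn (series (geometric 1 (2^-1 : R))).
    by apply: is_cvg_geometric_series; rewrite ger0_norm ?invr_ge0//; lra.
  have c3 : cvgn (series (fun k => `|D k w|)).
    apply: (series_le_cvg _ _ _ (is_cvg_seriesD c2 c1)) => // k.
      by apply: addr_ge0; rewrite /geometric /= mulr_ge0 ?sqr_ge0 ?exprn_ge0 ?invr_ge0.
    rewrite -[leRHS]/(1 * 2^-1 ^+ k + 2 ^+ k * D k w ^+ 2) mul1r.
    have a0 : 0 < (2 : R) ^+ k by rewrite exprn_gt0.
    rewrite exprVn -(real_normK (num_real (D k w))).
    move: (2 ^+ k) a0 `|D k w| (normr_ge0 (D k w)) => a a0 x x0.
    have : 0 <= a^-1 * (1 - a * x) ^+ 2 by rewrite mulr_ge0 ?sqr_ge0 ?invr_ge0 ?ltW.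
    have -> : a^-1 * (1 - a * x) ^+ 2 = a^-1 - 2 * x + a * x ^+ 2.
      by field; rewrite gt_eqF.
    lra.
  have := normed_cvg c3; rewrite (_ : series _ = [sequence Z n w - Z 0%N w]_n); last first.
    exact: (telescopeK (Z ^~ w)).
  move=> c4; have -> : Z ^~ w = (fun n => (Z n w - Z 0%N w) + Z 0%N w).
    by apply/funext => n; rewrite subrK.
  by apply: is_cvgD; [exact: c4|exact: is_cvg_cst].
(* Vanishing on the exceptional null set, the modified sequence converges everywhere, so its limit
   is measurable. *)
pose Z' k w := Z k w * \1_(~` A) w.
have cZ' w : cvgn (Z' ^~ w).
  rewrite /Z' indicE; have [Aw|nAw] := pselect (A w).
    rewrite memNset; last by move=> /(_ Aw).
    by under eq_fun do rewrite mulr0; exact: is_cvg_cst.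
  rewrite mem_set//; under eq_fun do rewrite mulr1.
  by apply: contrapT => H; apply: nAw; exact: HA.
pose Y w := lim (Z' n w @[n --> \oo]).
have mZ' k : measurable_fun setT (Z' k).
  by apply: measurable_funM; [case: (sZ k)|apply: measurable_indic; exact: measurableC].
have mY : measurable_fun setT Y by apply: (measurable_fun_cvg mZ') => w _; exact: cZ'.
have ZY : {ae P, forall w, Z n w @[n --> \oo] --> Y w}.
  exists A; split => // w /= H; apply: contrapT => nAw; apply: H.
  have := cZ' w; rewrite -/(Y w) /Y /Z' indicE mem_set//.
  by under eq_fun do rewrite mulr1.
have bnd k n : (N k <= n)%N -> (\int[P]_w ((X n w - Y w) ^+ 2)%:E <= (4^-1 ^+ k)%:E)%E.
  move=> kn.
  apply: (@fatou_le _ _ _ P (fun j w => (X n w - Z (j + k)%N w) ^+ 2)) => [j|j w|||j].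
  - by apply: measurable_funX; apply: measurable_funB => //; exact: mX.
  - exact: sqr_ge0.
  - by apply: measurable_funX; exact: measurable_funB.
  - apply: filterS ZY => w /= cw.
    have cw' : Z (j + k)%N w @[j --> \oo] --> Y w by rewrite (cvg_shiftn k (Z ^~ w)).
    have c5 : X n w - Z (j + k)%N w @[j --> \oo] --> X n w - Y w.
      by apply: cvgB => //; exact: cvg_cst.
    by rewrite expr2; under eq_fun do rewrite expr2; exact: (cvgM c5 c5).
  - rewrite -EFin_msq; last exact: sqintB.
    by rewrite lee_fin; apply: HN => //; apply: Nn; rewrite leq_addl.
have sXY n : (N 0%N <= n)%N -> sqint (fun w => X n w - Y w).
  move=> n0; apply/sqintP; first exact: measurable_funB.
  exact: (le_lt_trans (bnd _ _ n0) (ltry _)).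
have sY : sqint Y.
  have := sqintB (sX (N 0%N)) (sXY _ (leqnn _)); congr sqint; apply/funext => w.
  by rewrite opprB addrC subrK.
exists Y => //; apply/cvgrPdist_le => /= e e0.
have [k ke] : exists k, (4^-1 : R) ^+ k <= e.
  have : ((4^-1 : R) ^+ k) @[k --> \oo] --> (0 : R).
    by apply: cvg_expr; rewrite ger0_norm ?invr_ge0//; lra.
  move=> /cvgrPdist_le /(_ e e0) [k _ /(_ k (leqnn _)) /=].
  by rewrite sub0r normrN ger0_norm ?exprn_ge0//; exists k.
exists (N k) => // n /= kn; rewrite sub0r normrN ger0_norm ?msq_ge0//.
apply: le_trans ke; rewrite -lee_fin EFin_msq; first exact: bnd.
exact: sqintB.
Qed.

End square_integrable.

(** * Limits and independent sums of Gaussian variables *)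

Section gaussian_operations.
Context {R : realType} d (T : measurableType d) (P : probability T R).
Implicit Types X Y : T -> R.

Lemma centred_cf X v : 0 <= v -> measurable_fun setT X ->
  has_gaussian_law P X 0 v ->
  (forall t, \int[P]_w cos (t * X w) = expR (- (t ^+ 2 * v / 2))) /\
  (forall t, \int[P]_w sin (t * X w) = 0).
Proof.
move=> v0 mX XN; split=> t; have [Ec Es] := gaussian_law_cf mX v0 XN t.
- by rewrite Ec mulr0 cos0 mul1r.
- by rewrite Es mulr0 sin0 mul0r.
Qed.

Lemma cf_centred X v : 0 <= v -> measurable_fun setT X ->
  (forall t, \int[P]_w cos (t * X w) = expR (- (t ^+ 2 * v / 2))) ->
  (forall t, \int[P]_w sin (t * X w) = 0) -> has_gaussian_law P X 0 v.
Proof.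
move=> v0 mX Ec Es; apply: cf_gaussian_law => // t.
- by rewrite Ec mulr0 cos0 mul1r.
- by rewrite Es mulr0 sin0 mul0r.
Qed.

Lemma eq_Rintegral_ae (f g : T -> R) : measurable_fun setT f ->
  measurable_fun setT g -> {ae P, forall w, f w = g w} ->
  \int[P]_w f w = \int[P]_w g w.
Proof.
move=> mf mg fg; congr fine; apply: ae_eq_integral => //; try exact/measurable_EFinP.
by apply: filterS fg => w /= -> _.
Qed.

Lemma eq_has_gaussian_law X Y m v : measurable_fun setT X ->
  measurable_fun setT Y -> {ae P, forall w, X w = Y w} ->
  has_gaussian_law P X m v -> has_gaussian_law P Y m v.
Proof.
move=> mX mY XY XN A mA; rewrite -(XN A mA).
have mXA : measurable (X @^-1` A) by rewrite -[X in measurable X]setTI; exact: mX.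
have mYA : measurable (Y @^-1` A) by rewrite -[X in measurable X]setTI; exact: mY.
have E : \int[P]_w \1_(Y @^-1` A) w = \int[P]_w \1_(X @^-1` A) w.
  apply: eq_Rintegral_ae; [exact: measurable_indic|exact: measurable_indic|].
  by apply: filterS XY => w /= XYw; rewrite !indicE; congr (nat_of_bool _)%:R;
    apply/idP/idP; rewrite !inE /= XYw.
move: E; rewrite /Rintegral !integral_indic// !setIT => E.
by rewrite -[LHS]fineK ?fin_num_measure// E fineK ?fin_num_measure.
Qed.

Lemma gaussian_sqint X v : 0 <= v -> measurable_fun setT X ->
  has_gaussian_law P X 0 v -> sqint P X /\ msq P X = v.
Proof. by move=> v0 mX XN; have [i E _] := centred_gaussian_moments v0 mX XN. Qed.

Lemma Rintegral_abs_le X (e : R) : 0 < e -> sqint P X ->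
  \int[P]_w `|X w| <= e + msq P X / e.
Proof.
move=> e0 [mX iX].
have i1 : P.-integrable setT (EFin \o (fun=> e : R)).
  by apply: bdmeas_integrable; exact: bdmeas_cst.
have i2 := integrableZr measurableT e^-1 iX.
have E : e + msq P X / e = \int[P]_w (e + X w ^+ 2 / e).
  rewrite RintegralD// RintegralZr// Rintegral_cst//; congr (_ + _).
  by have -> : fine (P setT) = 1; [rewrite [P setT]probability_setT|rewrite mulr1].
rewrite E; apply: le_Rintegral => //.
- exact: (integrable_abse (sqint_integrable (conj mX iX))).
- exact: (integrableD measurableT i1 i2).
move=> w _; rewrite -(real_normK (num_real (X w))); move: `|X w| (normr_ge0 (X w)) => x x0.
have -> : e + x ^+ 2 / e = x + ((x / e) * (x / 2) + (e - x / 2) ^+ 2 / e + x ^+ 2 / e / 4).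
  by field; rewrite gt_eqF.
have ie : 0 <= e by exact: ltW.
have h1 : 0 <= (x / e) * (x / 2) by apply: mulr_ge0; exact: divr_ge0.
have h2 : 0 <= (e - x / 2) ^+ 2 / e by apply: divr_ge0 => //; exact: sqr_ge0.
have h3 : 0 <= x ^+ 2 / e / 4.
  by apply: divr_ge0 => //; apply: divr_ge0 => //; exact: sqr_ge0.
by rewrite lerDl !addr_ge0.
Qed.

Lemma lipschitz_cvg (f : R -> R) (X : nat -> T -> R) Y t :
  (forall Z : T -> R, measurable_fun setT Z -> bdmeas (fun w => f (Z w))) ->
  (forall x y, `|f x - f y| <= `|x - y|) ->
  (forall n, sqint P (X n)) -> sqint P Y -> msq_cvg P X Y ->
  \int[P]_w f (t * X n w) @[n --> \oo] --> \int[P]_w f (t * Y w).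
Proof.
move=> bf lf sX sY XY; have [mY iY] := sY.
have mX n : measurable_fun setT (X n) by have [] := sX n.
have bX n : bdmeas (fun w => f (t * X n w)) by apply: bf; exact: measurable_funM.
have bY : bdmeas (fun w => f (t * Y w)) by apply: bf; exact: measurable_funM.
apply/cvgrPdist_le => /= e e0.
pose a := `|t| + 1; have a0 : 0 < a by rewrite ltr_wpDl.
have e2a : 0 < e / (2 * a) by rewrite divr_gt0// mulr_gt0.
have d0 : 0 < (e / (2 * a)) ^+ 2 by rewrite exprn_gt0.
have /cvgrPdist_le /(_ _ d0) [N _ HN] := XY.
exists N => // n /= Nn; have := HN n Nn.
rewrite sub0r normrN ger0_norm ?msq_ge0// => {HN}HN.
have sXY := sqintB (sX n) sY.
rewrite distrC -RintegralB//; [|exact: bdmeas_integrable..].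
have ib : P.-integrable setT (EFin \o (fun w => f (t * X n w) - f (t * Y w))).
  by apply: bdmeas_integrable; have := bdmeasD (bX n) (bdmeasM (bdmeas_cst T (-1 : R)) bY);
    under eq_fun do rewrite mulN1r.
apply: (le_trans (le_normr_Rintegral measurableT ib)).
have ia : P.-integrable setT (EFin \o (fun w => `|X n w - Y w|)).
  exact: (integrable_abse (sqint_integrable sXY)).
apply: (@le_trans _ _ (\int[P]_w (a * `|X n w - Y w|))).
  apply: le_Rintegral => //; first exact: (integrable_abse ib).
    exact: (integrableZl measurableT a ia).
  move=> w _; apply: (le_trans (lf _ _)).
  by rewrite -mulrBr normrM ler_wpM2r// lerDl.
rewrite RintegralZl//; apply: (le_trans (ler_wpM2l (ltW a0) (Rintegral_abs_le e2a sXY))).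
have H2 : msq P (fun w => X n w - Y w) / (e / (2 * a)) <= e / (2 * a).
  by rewrite ler_pdivrMr// -expr2.
apply: le_trans (_ : a * (e / (2 * a) + e / (2 * a)) <= _).
  by rewrite ler_wpM2l ?(ltW a0)// lerD2l.
by rewrite le_eqVlt; apply/orP; left; apply/eqP; field; rewrite gt_eqF.
Qed.

Lemma lipschitz_cos (x y : R) : `|cos x - cos y| <= `|x - y|.
Proof.
have -> : cos x - cos y = - (2 * (sin ((x + y) / 2) * sin ((x - y) / 2))).
  have -> : cos x = cos ((x + y) / 2 + (x - y) / 2) by congr cos; field.
  have -> : cos y = cos ((x + y) / 2 - (x - y) / 2) by congr cos; field.
  by rewrite cosD cosB; ring.
rewrite normrN !normrM (@ger0_norm _ 2)//.
have := sin_max ((x + y) / 2); have := normr_sin_le ((x - y) / 2).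
rewrite normrM (@ger0_norm _ 2^-1)//; have := normr_ge0 (sin ((x - y) / 2)).
move: `|sin ((x - y) / 2)| `|sin ((x + y) / 2)| `|x - y| => a b c a0 ac b1.
have : b * a <= 1 * a by rewrite ler_wpM2r.
lra.
Qed.

Lemma lipschitz_sin (x y : R) : `|sin x - sin y| <= `|x - y|.
Proof.
have cs (z : R) : cos (z - pi / 2) = sin z.
  by rewrite cosB cos_pihalf sin_pihalf mulr0 add0r mulr1.
rewrite -!cs; apply: (le_trans (lipschitz_cos _ _)).
by rewrite opprB addrA subrK.
Qed.

(** Sine and cosine are 1-Lipschitz, so mean square convergence carries over to the characteristic
    functions, which determine the law. *)
Lemma gaussian_msq_limit (X : nat -> T -> R) Y (v : nat -> R) (v' : R) :
  (forall n, sqint P (X n)) -> sqint P Y -> msq_cvg P X Y ->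
  (forall n, 0 <= v n) -> (forall n, has_gaussian_law P (X n) 0 (v n)) ->
  v n @[n --> \oo] --> v' -> has_gaussian_law P Y 0 v'.
Proof.
move=> sX sY XY v0 XN vv'; have [mY _] := sY.
have v'0 : 0 <= v'.
  rewrite -(cvg_lim _ vv')//; apply: limr_ge; last exact: nearW.
  by apply/cvg_ex; exists v'.
have mX n : measurable_fun setT (X n) by have [] := sX n.
apply: cf_centred => // t.
- have := lipschitz_cvg (t := t) (fun Z => @bdmeas_cos _ _ _ Z) lipschitz_cos sX sY XY.
  have -> : (fun n => \int[P]_w cos (t * X n w)) = (fun n => expR (- (t ^+ 2 * v n / 2))).
    by apply/funext => n; have [-> _] := centred_cf (v0 n) (mX n) (XN n).
  move=> /cvg_lim <-//; apply/cvg_lim => //.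
  apply: continuous_cvg; first exact: continuous_expR.
  by apply: cvgN; apply: cvgMl; exact: cvgMr.
- have := lipschitz_cvg (t := t) (fun Z => @bdmeas_sin _ _ _ Z) lipschitz_sin sX sY XY.
  have -> : (fun n => \int[P]_w sin (t * X n w)) = (fun n => 0).
    by apply/funext => n; have [_ ->] := centred_cf (v0 n) (mX n) (XN n).
  by move=> /cvg_lim <-//; apply/cvg_lim => //; exact: cvg_cst.
Qed.

Lemma gaussian_indepD X Y v v' : 0 <= v -> 0 <= v' ->
  measurable_fun setT X -> measurable_fun setT Y ->
  (forall A B, measurable A -> measurable B ->
     P (X @^-1` A `&` Y @^-1` B) = (P (X @^-1` A) * P (Y @^-1` B))%E) ->
  has_gaussian_law P X 0 v -> has_gaussian_law P Y 0 v' ->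
  has_gaussian_law P (fun w => X w + Y w) 0 (v + v').
Proof.
move=> v0 v'0 mX mY XY XN YN.
have [Xc Xs] := centred_cf v0 mX XN; have [Yc Ys] := centred_cf v'0 mY YN.
have I t (f g : R -> R) : (forall Z, measurable_fun setT Z -> bdmeas (fun w : T => f (Z w))) ->
    (forall Z, measurable_fun setT Z -> bdmeas (fun w : T => g (Z w))) ->
    measurable_fun setT f -> measurable_fun setT g ->
    P.-integrable setT (EFin \o (fun w => f (t * X w) * g (t * Y w))) /\
    \int[P]_w (f (t * X w) * g (t * Y w)) = \int[P]_w f (t * X w) * \int[P]_w g (t * Y w).
  move=> bf bg mf mg.
  apply: (@indep_RintegralM _ _ _ P (fun w => f (t * X w)) (fun w => g (t * Y w))).
  - move=> A B mA mB.
    have mt : measurable_fun setT (fun x : R => t * x) by exact: measurable_funM.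
    apply: (XY ((fun x => f (t * x)) @^-1` A) ((fun x => g (t * x)) @^-1` B)).
      by rewrite -[X in measurable X]setTI; apply: (measurableT_comp mf mt).
    by rewrite -[X in measurable X]setTI; apply: (measurableT_comp mg mt).
  - by apply: bdmeas_integrable; apply: bf; exact: measurable_funM.
  - by apply: bdmeas_integrable; apply: bg; exact: measurable_funM.
have bc (Z : T -> R) : measurable_fun setT Z -> bdmeas (fun w => cos (Z w)) by exact: bdmeas_cos.
have bs (Z : T -> R) : measurable_fun setT Z -> bdmeas (fun w => sin (Z w)) by exact: bdmeas_sin.
have mcos : measurable_fun setT (@cos R) by apply: continuous_measurable_fun; exact: continuous_cos.
have msin : measurable_fun setT (@sin R) by apply: continuous_measurable_fun; exact: continuous_sin.
apply: cf_centred; [exact: addr_ge0|exact: measurable_funD|move=> t|move=> t].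
- have [i1 E1] := I t cos cos bc bc mcos mcos.
  have [i2 E2] := I t sin sin bs bs msin msin.
  under eq_Rintegral do rewrite mulrDr cosD.
  rewrite RintegralB// E1 E2 Xs Ys mul0r subr0 Xc Yc -expRD; congr expR; lra.
- have [i1 E1] := I t sin cos bs bc msin mcos.
  have [i2 E2] := I t cos sin bc bs mcos msin.
  under eq_Rintegral do rewrite mulrDr sinD.
  by rewrite RintegralD// E1 E2 Xs Ys mul0r mulr0 addr0.
Qed.

Lemma gaussian_law_moments X m v : 0 <= v -> measurable_fun setT X ->
  has_gaussian_law P X m v ->
  [/\ sqint P X, \int[P]_w X w = m & msq P X = v + m ^+ 2].
Proof.
move=> v0 mX XN; pose Y w := X w - m.
have mY : measurable_fun setT Y by exact: measurable_funB.
have cfX := gaussian_law_cf mX v0 XN.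
have bc t : bdmeas (fun w => cos (t * X w)) by apply: bdmeas_cos; exact: measurable_funM.
have bs t : bdmeas (fun w => sin (t * X w)) by apply: bdmeas_sin; exact: measurable_funM.
have ic t a : P.-integrable setT (EFin \o (fun w => cos (t * X w) * a)).
  by apply: bdmeas_integrable; apply: bdmeasM => //; exact: bdmeas_cst.
have is_ t a : P.-integrable setT (EFin \o (fun w => sin (t * X w) * a)).
  by apply: bdmeas_integrable; apply: bdmeasM => //; exact: bdmeas_cst.
have YN : has_gaussian_law P Y 0 v.
  apply: cf_centred => // t; have [Ec Es] := cfX t.
    under eq_Rintegral do rewrite mulrBr cosB.
    rewrite RintegralD// !RintegralZr//; [|exact: bdmeas_integrable..].
    rewrite Ec Es mulrAC -expr2 [X in _ + X]mulrAC -[X in _ + X * _]expr2 -mulrDl.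
    by rewrite cos2Dsin2 mul1r.
  under eq_Rintegral do rewrite mulrBr sinB.
  rewrite RintegralB// !RintegralZr//; [|exact: bdmeas_integrable..].
  by rewrite Ec Es; ring.
have [iY EY Y0] := centred_gaussian_moments v0 mY YN.
have sY : sqint P Y by split.
have XE : X = (fun w => Y w + m) by apply/funext => w; rewrite /Y subrK.
have sm : sqint P (fun=> m) by exact: sqint_cst.
have P1 : fine (P setT) = 1 by rewrite [P setT]probability_setT.
rewrite XE; split; first exact: sqintD.
  by rewrite RintegralD//; [rewrite Y0 add0r Rintegral_cst// P1 mulr1|exact: sqint_integrable..].
rewrite /msq; have E w : (Y w + m) ^+ 2 = (Y w ^+ 2 + Y w * (2 * m)) + m ^+ 2 by ring.
under eq_Rintegral do rewrite E.
have i1 : P.-integrable setT (EFin \o (fun w => Y w * (2 * m))).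
  by apply: sqint_mul => //; exact: sqint_cst.
have i2 : P.-integrable setT (EFin \o (fun=> m ^+ 2)).
  by apply: sqint_integrable; exact: sqint_cst.
rewrite RintegralD//; last exact: (integrableD measurableT iY i1).
rewrite RintegralD// RintegralZr//; last exact: sqint_integrable.
by rewrite EY Y0 mul0r addr0 Rintegral_cst// P1 mulr1.
Qed.

End gaussian_operations.

(** * Elementary stochastic integrals and the isometry *)

Section measurable_wrt_theory.
Context {R : realType} {d : measure_display} {Omega : measurableType d}.
Variable G : set (set Omega).
Hypothesis sG : sigma_algebra setT G.

Let E : <<s G >> = G.
Proof. by apply: sigma_algebra_id. Qed.

Lemma measurable_wrtP (X : Omega -> R) :
  measurable_wrt G X <-> @measurable_fun _ _ (g_sigma_algebraType G) R setT X.
Proof.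
split=> [GX _ A mA|GX A mA].
  by rewrite setTI; rewrite /measurable /= E; exact: GX.
by have := GX measurableT _ mA; rewrite setTI; rewrite /measurable /= E.
Qed.

Lemma measurable_wrt_cst (c : R) : measurable_wrt G (fun=> c).
Proof. by apply/measurable_wrtP; exact: measurable_cst. Qed.

Lemma measurable_wrtD (X Y : Omega -> R) : measurable_wrt G X -> measurable_wrt G Y ->
  measurable_wrt G (fun w => X w + Y w).
Proof. by move=> /measurable_wrtP ? /measurable_wrtP ?; apply/measurable_wrtP; exact: measurable_funD. Qed.

Lemma measurable_wrtB (X Y : Omega -> R) : measurable_wrt G X -> measurable_wrt G Y ->
  measurable_wrt G (fun w => X w - Y w).
Proof. by move=> /measurable_wrtP ? /measurable_wrtP ?; apply/measurable_wrtP; exact: measurable_funB. Qed.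

Lemma measurable_wrtM (X Y : Omega -> R) : measurable_wrt G X -> measurable_wrt G Y ->
  measurable_wrt G (fun w => X w * Y w).
Proof. by move=> /measurable_wrtP ? /measurable_wrtP ?; apply/measurable_wrtP; exact: measurable_funM. Qed.

End measurable_wrt_theory.

Section elementary_integral.
Context {R : realType} {d : measure_display} {Omega : measurableType d}.
Variables (P : probability Omega R) (F : R -> set (set Omega)).
Hypothesis hF : filtration F.

(* A scalar Wiener process with variance q per unit of time. *)
Definition scalar_wiener (B : R -> Omega -> R) (q : R) :=
  [/\ 0 <= q, forall t, 0 <= t -> measurable_wrt (F t) (B t),
    forall s t A D, 0 <= s -> s <= t -> F s A -> measurable D ->
      P (A `&` (fun w => (B t w - B s w)%R) @^-1` D) =
      (P A * P ((fun w => (B t w - B s w)%R) @^-1` D))%E &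
    forall s t, 0 <= s -> s <= t ->
      has_gaussian_law P (fun w => B t w - B s w) 0 ((t - s) * q)].

Let sF t : 0 <= t -> sigma_algebra setT (F t).
Proof. by move=> t0; have [/(_ t t0)[]] := hF. Qed.

Lemma measurable_wrt_fun t (X : Omega -> R) : 0 <= t ->
  measurable_wrt (F t) X -> measurable_fun setT X.
Proof.
move=> t0 FX _ A mA; rewrite setTI.
by have [/(_ t t0)[_ H] _] := hF; apply: H; exact: FX.
Qed.

Lemma measurable_wrtS s t (X : Omega -> R) : 0 <= s -> s <= t ->
  measurable_wrt (F s) X -> measurable_wrt (F t) X.
Proof. by move=> s0 st FX A mA; have [_ /(_ s t s0 st)] := hF; apply; exact: FX. Qed.

Variables (B : R -> Omega -> R) (q : R).
Hypothesis hB : scalar_wiener B q.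

Let q0 : 0 <= q. Proof. by have [] := hB. Qed.
Let FB t : 0 <= t -> measurable_wrt (F t) (B t). Proof. by have [_ + _ _] := hB; apply. Qed.

Lemma wiener_increment_wrt s t r : 0 <= s -> s <= t -> t <= r ->
  measurable_wrt (F r) (fun w => B t w - B s w).
Proof.
move=> s0 st tr; have t0 := le_trans s0 st; have r0 := le_trans t0 tr.
apply: measurable_wrtB; first exact: sF.
  by apply: measurable_wrtS tr _ => //; exact: FB.
by apply: measurable_wrtS (le_trans st tr) _ => //; exact: FB.
Qed.

Lemma wiener_increment_sqint s t : 0 <= s -> s <= t ->
  sqint P (fun w => B t w - B s w) /\ msq P (fun w => B t w - B s w) = (t - s) * q.
Proof.
move=> s0 st; have [_ _ _ /(_ s t s0 st) g] := hB.
apply: (gaussian_sqint _ _ g); first by rewrite mulr_ge0// subr_ge0.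
exact: measurable_wrt_fun (le_trans s0 st) (wiener_increment_wrt s0 st (lexx t)).
Qed.

Lemma wiener_increment_mean s t : 0 <= s -> s <= t ->
  \int[P]_w (B t w - B s w) = 0.
Proof.
move=> s0 st; have [_ _ _ /(_ s t s0 st) g] := hB.
have [||_ _ //] := centred_gaussian_moments _ _ g.
  by rewrite mulr_ge0// subr_ge0.
exact: measurable_wrt_fun (le_trans s0 st) (wiener_increment_wrt s0 st (lexx t)).
Qed.

Let indep_past s t (Y : Omega -> R) (g : R -> R) : 0 <= s -> s <= t ->
  measurable_wrt (F s) Y -> measurable_fun setT g ->
  P.-integrable setT (EFin \o Y) ->
  P.-integrable setT (EFin \o (fun w => g (B t w - B s w))) ->
  \int[P]_w (Y w * g (B t w - B s w)) = \int[P]_w Y w * \int[P]_w g (B t w - B s w).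
Proof.
move=> s0 st FY mg iY ig; have [_ _ hi _] := hB.
have [//|_ //] := @indep_RintegralM _ _ _ P Y (fun w => g (B t w - B s w)) _ iY ig.
move=> A D mA mD; apply: (hi s t (Y @^-1` A) (g @^-1` D)) => //; first exact: FY.
by rewrite -[X in measurable X]setTI; exact: mg.
Qed.

Lemma wiener_past_increment s t (Y : Omega -> R) : 0 <= s -> s <= t ->
  measurable_wrt (F s) Y -> sqint P Y ->
  \int[P]_w (Y w * (B t w - B s w)) = 0.
Proof.
move=> s0 st FY sY; have [sD _] := wiener_increment_sqint s0 st.
have mid : measurable_fun setT (idfun : R -> R) by exact: measurable_id.
rewrite (indep_past s0 st FY mid (sqint_integrable sY) (sqint_integrable sD)).
by rewrite wiener_increment_mean// mulr0.
Qed.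

Lemma wiener_past_increment_sqr s t (Y : Omega -> R) : 0 <= s -> s <= t ->
  measurable_wrt (F s) Y -> sqint P Y ->
  \int[P]_w (Y w * (B t w - B s w) ^+ 2) = \int[P]_w Y w * ((t - s) * q).
Proof.
move=> s0 st FY sY; have [sD e] := wiener_increment_sqint s0 st.
have msqr : measurable_fun setT (fun x : R => x ^+ 2) by exact: measurable_funX.
have [_ iD] := sD.
rewrite (indep_past s0 st FY msqr (sqint_integrable sY) iD).
by rewrite -[X in _ * X = _]/(msq P _) e.
Qed.

(** The length of the intersection of the intervals ]a, b] and ]c, e]. *)
Definition overlap (a b c e : R) := Num.max 0 (Num.min b e - Num.max a c).

(** A triple [(xi, s, t)] stands for the integrand equal to [xi] on ]s, t] and to 0 elsewhere. *)
Definition elementary (p : (Omega -> R) * R * R) :=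
  [/\ 0 <= p.1.2, p.1.2 <= p.2, measurable_wrt (F p.1.2) p.1.1 &
      exists M, forall w, `|p.1.1 w| <= M].

Let xi (p : (Omega -> R) * R * R) := p.1.1.
Let inc (p : (Omega -> R) * R * R) w := B p.2 w - B p.1.2 w.

Lemma sqint_bdM (X Y : Omega -> R) : measurable_fun setT X ->
  (exists M, forall w, `|X w| <= M) -> sqint P Y -> sqint P (fun w => X w * Y w).
Proof.
move=> mX [M XM] sY; have [mY _] := sY.
apply: (sqint_le _ (sqintZ M sY)); first exact: measurable_funM.
move=> w; rewrite !exprMn ler_wpM2r ?sqr_ge0// -real_normK ?num_real//.
by rewrite ler_sqr ?nnegrE ?(le_trans _ (XM w)).
Qed.

(** Cut time at all endpoints. A product of increments over disjoint intervals has mean zero, the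
    later one being independent of everything known at its left end; over the common interval the
    squared increment is independent of the coefficients and has mean q times the length. *)
Lemma wiener_product_expectation p p' : elementary p -> elementary p' ->
  \int[P]_w (p.1.1 w * (B p.2 w - B p.1.2 w) * (p'.1.1 w * (B p'.2 w - B p'.1.2 w))) =
  \int[P]_w (p.1.1 w * p'.1.1 w) * (overlap p.1.2 p.2 p'.1.2 p'.2 * q).
Proof.
wlog ss' : p p' / p.1.2 <= p'.1.2.
  move=> W ep ep'; have [/W|/ltW] := leP p.1.2 p'.1.2; first exact.
  move=> /W /(_ ep' ep) E; rewrite (_ : overlap _ _ _ _ = overlap p'.1.2 p'.2 p.1.2 p.2).
    have -> : \int[P]_w (p.1.1 w * p'.1.1 w) = \int[P]_w (p'.1.1 w * p.1.1 w).
      by apply: eq_Rintegral => w _; rewrite mulrC.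
    by rewrite -E; apply: eq_Rintegral => w _; rewrite mulrC.
  by rewrite /overlap minC maxC [Num.max p.1.2 _]maxC maxC.
case: p p' ss' => [[x s] t] [[x' s'] t'] /= ss' [/= s0 st Fx bx] [/= s'0 st' Fx' bx'].
have t0 := le_trans s0 st; have t'0 := le_trans s'0 st'.
have mx := measurable_wrt_fun s0 Fx; have mx' := measurable_wrt_fun s'0 Fx'.
have Fxx r : s' <= r -> measurable_wrt (F r) (fun w => x w * x' w).
  move=> sr; have r0 := le_trans s'0 sr.
  apply: measurable_wrtM; first exact: sF.
    exact: measurable_wrtS (le_trans ss' sr) Fx.
  exact: measurable_wrtS sr Fx'.
have bxx : exists M, forall w, `|x w * x' w| <= M.
  have [M xM] := bx; have [M' xM'] := bx'; exists (M * M') => w.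
  by rewrite normrM ler_pM.
have mxx : measurable_fun setT (fun w => x w * x' w) by exact: measurable_funM.
have sxx : sqint P (fun w => x w * x' w).
  have := sqint_bdM mxx bxx (sqint_cst P 1).
  by under eq_fun do rewrite mulr1.
(* Y = x x' (B_b - B_a) is known at time c, so it is orthogonal to later increments *)
have cross a b c e : 0 <= a -> a <= b -> b <= c -> s' <= c -> c <= e ->
    P.-integrable setT (EFin \o (fun w => x w * x' w * (B b w - B a w) * (B e w - B c w))) /\
    \int[P]_w (x w * x' w * (B b w - B a w) * (B e w - B c w)) = 0.
  move=> a0 ab bc sc ce; have c0 := le_trans a0 (le_trans ab bc).
  have [sab _] := wiener_increment_sqint a0 ab.
  have sY : sqint P (fun w => x w * x' w * (B b w - B a w)) by exact: sqint_bdM.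
  have [sce _] := wiener_increment_sqint c0 ce.
  split; first exact: sqint_mul.
  apply: wiener_past_increment => //.
  apply: measurable_wrtM; [exact: sF|exact: Fxx|exact: wiener_increment_wrt].
have square a b : s' <= a -> a <= b ->
    P.-integrable setT (EFin \o (fun w => x w * x' w * (B b w - B a w) * (B b w - B a w))) /\
    \int[P]_w (x w * x' w * (B b w - B a w) * (B b w - B a w)) =
    \int[P]_w (x w * x' w) * ((b - a) * q).
  move=> sa ab; have a0 := le_trans s'0 sa.
  have [sab _] := wiener_increment_sqint a0 ab.
  have sY : sqint P (fun w => x w * x' w * (B b w - B a w)) by exact: sqint_bdM.
  split; first exact: sqint_mul.
  rewrite -wiener_past_increment_sqr//; last exact: Fxx.
  by apply: eq_Rintegral => w _; rewrite expr2 mulrA.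
have maxE : Num.max s s' = s' by apply/max_idPr.
have [ts'|s't] := leP t s'.
  rewrite /overlap maxE (_ : Num.max 0 _ = 0); last first.
    by apply/max_idPl; rewrite subr_le0 ge_min ts'.
  have [_ E] := cross s t s' t' s0 st ts' (lexx _) st'.
  rewrite mul0r mulr0 -E; apply: eq_Rintegral => w _; ring.
have [i1 E1] := cross s s' s' t s0 ss' (lexx _) (lexx _) (ltW s't).
have [i1' E1'] := cross s s' s' t' s0 ss' (lexx _) (lexx _) st'.
have [tt'|t't] := leP t t'.
- have [i2 E2] := square s' t (lexx _) (ltW s't).
  have [i3 E3] := cross s' t t t' s'0 (ltW s't) (lexx _) (ltW s't) tt'.
  have iA := integrableD measurableT i1' i2; have iB := integrableD measurableT iA i3.
  transitivity (\int[P]_w (x w * x' w * (B s' w - B s w) * (B t' w - B s' w)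
      + x w * x' w * (B t w - B s' w) * (B t w - B s' w)
      + x w * x' w * (B t w - B s' w) * (B t' w - B t w))).
    by apply: eq_Rintegral => w _; ring.
  rewrite RintegralD// RintegralD// E1' E2 E3 add0r addr0; congr (_ * (_ * _)).
  rewrite /overlap maxE; have /min_idPl -> := tt'.
  by apply/esym/max_idPr; rewrite subr_ge0 ltW.
- have [i2 E2] := square s' t' (lexx _) st'.
  have [i3 E3] := cross s' t' t' t s'0 st' (lexx _) st' (ltW t't).
  have iA := integrableD measurableT i1' i2; have iB := integrableD measurableT iA i3.
  transitivity (\int[P]_w (x w * x' w * (B s' w - B s w) * (B t' w - B s' w)
      + x w * x' w * (B t' w - B s' w) * (B t' w - B s' w)
      + x w * x' w * (B t' w - B s' w) * (B t w - B t' w))).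
    by apply: eq_Rintegral => w _; ring.
  rewrite RintegralD// RintegralD// E1' E2 E3 add0r addr0; congr (_ * (_ * _)).
  rewrite /overlap maxE; have /ltW/min_idPr -> := t't.
  by apply/esym/max_idPr; rewrite subr_ge0.
Qed.

End elementary_integral.

Section integral_of_sums.
Context {R : realType} d (T : measurableType d) (mu : {measure set T -> \bar R}).

Lemma Rintegral_sum (D : set T) (I : Type) (s : seq I) (F : I -> T -> R) :
  measurable D ->
  List.Forall (fun i => mu.-integrable D (EFin \o F i)) s ->
  mu.-integrable D (EFin \o (fun x => \sum_(i <- s) F i x)) /\
  \int[mu]_(x in D) (\sum_(i <- s) F i x) = \sum_(i <- s) \int[mu]_(x in D) F i x.
Proof.
move=> mD; elim => [|i {}s iF _ [IHi IHe]].
  have E : (fun x : T => \sum_(i <- [::]) F i x) = fun=> 0.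
    by apply/funext => x; rewrite big_nil.
  rewrite E big_nil; split; last by rewrite /Rintegral integral0_eq.
  exact: integrable0.
have E : (fun x : T => \sum_(j <- i :: s) F j x) = fun x => F i x + \sum_(j <- s) F j x.
  by apply/funext => x; rewrite big_cons.
rewrite E big_cons RintegralD// IHe; split => //.
exact: (integrableD mD iF IHi).
Qed.

End integral_of_sums.

Section interval_overlap.
Context {R : realType}.
Notation leb := (@lebesgue_measure R).

Lemma integrable_overlap (T a b c e k : R) : 0 <= a -> b <= T -> 0 <= c -> e <= T ->
  leb.-integrable `[0, T] (EFin \o (fun r => k * (\1_(`]a, b]) r * \1_(`]c, e]) r))) /\
  \int[leb]_(r in `[0, T]) (k * (\1_(`]a, b]) r * \1_(`]c, e]) r)) = k * overlap a b c e.
Proof.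
move=> a0 bT c0 eT; pose I : set R := `]Num.max a c, Num.min b e]%classic.
have E r : \1_(`]a, b]) r * \1_(`]c, e]) r = \1_I r :> R.
  have -> : I = `]a, b]%classic `&` `]c, e]%classic.
    apply/seteqP; split => x; rewrite /I /= !in_itv /= gt_max le_min.
      by move=> /andP[/andP[-> ->] /andP[-> ->]].
    by move=> [/andP[-> ->] /andP[-> ->]].
  by rewrite indicI.
have mI : measurable I by exact: measurable_itv.
have ltI : (leb I < +oo)%E.
  rewrite /I lebesgue_measure_itv/=.
  by case: ifPn => _; rewrite ?ltry// -EFinB ltry.
have II : leb.-integrable `[0, T] (EFin \o (\1_I : R -> R)).
  apply: (integrableS measurableT) => //; apply/integrableP; split.
    by apply/measurable_EFinP; exact: measurable_indic.
  under eq_integral do rewrite /= ger0_norm//.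
  by rewrite integral_indic// setIT; exact: ltI.
have EI : (fun r => \1_(`]a, b]) r * \1_(`]c, e]) r) = \1_I :> (R -> R) by exact/funext.
split.
  have mD : @measurable _ (measurableTypeR R) `[0, T] by exact: measurable_itv.
  have := integrableZl mD k II.
  by apply: eq_integrable => // r _; rewrite /= E EFinM.
under eq_Rintegral do rewrite E.
rewrite RintegralZl//; congr (_ * _).
rewrite /Rintegral integral_indic// (_ : I `&` _ = I); last first.
  apply/setIidPl => r; rewrite /I /= !in_itv /= gt_max le_min.
  move=> /andP[/andP[ar _] /andP[rb _]].
  by rewrite (le_trans a0 (ltW ar)) (le_trans rb bT).
rewrite -[X in fine X]/(leb I) /I lebesgue_measure_itv/= /overlap lte_fin.
have [h|h] := ltP (Num.max a c) (Num.min b e).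
  by rewrite -EFinB /=; apply/esym/max_idPr; rewrite subr_ge0 ltW.
by rewrite /=; apply/esym/max_idPl; rewrite subr_le0.
Qed.

End interval_overlap.

Section list_integral.
Context {R : realType} {d : measure_display} {Omega : measurableType d}.
Variables (P : probability Omega R) (F : R -> set (set Omega)).
Hypothesis hF : filtration F.
Notation leb := (@lebesgue_measure R).
Notation triple := ((Omega -> R) * R * R)%type.
Variable T : R.

(** Lists of triples, unlike simple processes, are closed under concatenation, so processes on
    different time grids can be combined without a common refinement. *)
Definition elementaries (L : seq triple) :=
  List.Forall (fun p => elementary F p /\ p.2 <= T) L.

Definition el_int (B : R -> Omega -> R) (L : seq triple) (w : Omega) : R :=
  \sum_(p <- L) p.1.1 w * (B p.2 w - B p.1.2 w).

Definition el_fun (L : seq triple) (r : R) (w : Omega) : R :=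
  \sum_(p <- L) p.1.1 w * \1_(`]p.1.2, p.2]) r.

Definition el_scale (a : R) (L : seq triple) : seq triple :=
  [seq (fun w => a * p.1.1 w, p.1.2, p.2) | p <- L].

Lemma el_int_cat B L L' w : el_int B (L ++ L') w = el_int B L w + el_int B L' w.
Proof. exact: big_cat. Qed.

Lemma el_fun_cat L L' r w : el_fun (L ++ L') r w = el_fun L r w + el_fun L' r w.
Proof. exact: big_cat. Qed.

Lemma el_int_scale a B L w : el_int B (el_scale a L) w = a * el_int B L w.
Proof.
by rewrite /el_int big_map mulr_sumr; apply: eq_bigr => p _; rewrite /= mulrA.
Qed.

Lemma el_fun_scale a L r w : el_fun (el_scale a L) r w = a * el_fun L r w.
Proof.
by rewrite /el_fun big_map mulr_sumr; apply: eq_bigr => p _; rewrite /= mulrA.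
Qed.

Lemma elementaries_cat L L' : elementaries L -> elementaries L' ->
  elementaries (L ++ L').
Proof. by elim=> //= p {}L pT _ IH /IH ?; constructor. Qed.

Lemma elementaries_scale a L : elementaries L -> elementaries (el_scale a L).
Proof.
elim=> [|p {}L [[s0 st Fx [M xM]] pT] _ IH] /=; first by constructor.
constructor => //; split => //; split => //=.
  apply: measurable_wrtM => //; first by have [/(_ _ s0)[]] := hF.
  by apply: measurable_wrt_cst; have [/(_ _ s0)[]] := hF.
by exists (`|a| * M) => w; rewrite normrM ler_wpM2l.
Qed.

Lemma elementary_bdmeas p : elementary F p -> bdmeas p.1.1.
Proof. by move=> [s0 _ Fx bx]; split => //; exact: (measurable_wrt_fun hF s0 Fx). Qed.

Lemma el_fun_bdmeas L r : elementaries L -> bdmeas (el_fun L r).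
Proof.
elim=> [|p {}L [ep _] _ IH].
  rewrite (_ : el_fun [::] r = fun=> 0); first exact: bdmeas_cst.
  by apply/funext => w; rewrite /el_fun big_nil.
rewrite (_ : el_fun (p :: L) r = fun w => p.1.1 w * \1_(`]p.1.2, p.2]) r + el_fun L r w).
  by apply: bdmeasD => //; apply: bdmeasM; [exact: elementary_bdmeas|exact: bdmeas_cst].
by apply/funext => w; rewrite /el_fun big_cons.
Qed.

Lemma measurable_el_fun L : elementaries L ->
  measurable_fun setT (fun z : R * Omega => el_fun L z.1 z.2).
Proof.
elim=> [|p {}L [ep _] _ IH].
  rewrite (_ : (fun z => _) = fun=> 0); first exact: measurable_cst.
  by apply/funext => w; rewrite /el_fun big_nil.
rewrite (_ : (fun z => _) = fun z : R * Omega => p.1.1 z.2 * \1_(`]p.1.2, p.2]) z.1 + el_fun L z.1 z.2).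
  apply: measurable_funD => //; apply: measurable_funM.
    by apply: measurableT_comp => //; have [] := elementary_bdmeas ep.
  by apply: measurableT_comp => //; apply: measurable_indic; exact: measurable_itv.
by apply/funext => z; rewrite /el_fun big_cons.
Qed.

Section isometry.
Variables (B : R -> Omega -> R) (q : R).
Hypothesis hB : scalar_wiener P F B q.

Lemma el_int_sqint L : elementaries L -> sqint P (el_int B L).
Proof.
elim=> [|p {}L [ep _] _ IH].
  rewrite (_ : el_int B [::] = fun=> 0); first exact: sqint_cst.
  by apply/funext => w; rewrite /el_int big_nil.
rewrite (_ : el_int B (p :: L) = fun w => p.1.1 w * (B p.2 w - B p.1.2 w) + el_int B L w).
  apply: sqintD => //; have [mx bx] := elementary_bdmeas ep.
  have [s0 st _ _] := ep.
  by apply: sqint_bdM => //; have [] := wiener_increment_sqint hF hB s0 st.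
by apply/funext => w; rewrite /el_int big_cons.
Qed.

Lemma Forall_pairs (Q : triple * triple -> Prop) (L : seq triple) :
  elementaries L ->
  (forall p p', elementary F p -> elementary F p' -> p.2 <= T -> p'.2 <= T -> Q (p, p')) ->
  List.Forall Q [seq (p, p') | p <- L, p' <- L].
Proof.
move=> eL H; suff A L' : elementaries L' -> List.Forall Q [seq (p, p') | p <- L', p' <- L].
  exact: A.
elim=> [|p {}L' [ep pT] _ IH] /=; first by constructor.
apply/List.Forall_app; split; last exact: IH.
elim: {IH} eL => [|p' L'' [ep' p'T] _ IH] /=; first by constructor.
by constructor => //; exact: H.
Qed.

Lemma sqr_sum_pairs (f : triple -> R) L :
  (\sum_(p <- L) f p) ^+ 2 = \sum_(pp <- [seq (p, p') | p <- L, p' <- L]) f pp.1 * f pp.2.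
Proof.
rewrite big_allpairs expr2 mulr_suml; apply: eq_bigr => p _.
by rewrite mulr_sumr.
Qed.

(** Both sides expand into the same double sum over pairs of triples: the overlap of two intervals
    arises on the left from the Wiener increments, on the right as the Lebesgue integral of a
    product of indicators. *)
Lemma el_isometry L : elementaries L ->
  (msq P (el_int B L))%:E =
  (q%:E * \int[leb]_(r in `[0%R, T]) 'E_P[fun w => (el_fun L r w ^+ 2)%R])%E.
Proof.
move=> eL; pose s := [seq (p, p') | p <- L, p' <- L].
pose c (pp : triple * triple) := \int[P]_w (pp.1.1.1 w * pp.2.1.1 w).
have E1 : msq P (el_int B L) =
    \sum_(pp <- s) c pp * (overlap pp.1.1.2 pp.1.2 pp.2.1.2 pp.2.2 * q).
  rewrite /msq; under eq_Rintegral do rewrite /el_int sqr_sum_pairs.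
  have [||_ ->] := @Rintegral_sum _ _ _ P setT _ s (fun pp w =>
     pp.1.1.1 w * (B pp.1.2 w - B pp.1.1.2 w) * (pp.2.1.1 w * (B pp.2.2 w - B pp.2.1.2 w))).
  - exact: measurableT.
  - apply: (Forall_pairs eL) => p p' ep ep' pT p'T /=.
    apply: sqint_mul.
      have := el_int_sqint (L := [:: p]); rewrite /el_int.
      under eq_fun do rewrite big_seq1; apply.
      by constructor => //; constructor.
    have := el_int_sqint (L := [:: p']); rewrite /el_int.
    under eq_fun do rewrite big_seq1; apply.
    by constructor => //; constructor.
  have : List.Forall (fun pp : triple * triple => elementary F pp.1 /\ elementary F pp.2) s.
    by apply: (Forall_pairs eL).
  elim => [|[p p'] s' [ep ep'] _ IH]; first by rewrite !big_nil.
  by rewrite !big_cons IH (wiener_product_expectation hF hB ep ep').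
have E2 r : ('E_P[fun w => (el_fun L r w ^+ 2)%R] =
    (\sum_(pp <- s) c pp * (\1_(`]pp.1.1.2, pp.1.2]) r * \1_(`]pp.2.1.2, pp.2.2]) r))%:E)%E.
  rewrite unlock.
  have := EFin_msq (X := el_fun L r) (P := P); rewrite /msq => <-; last first.
    have [mf bf] := el_fun_bdmeas r eL.
    have := sqint_bdM mf bf (sqint_cst P 1).
    by under eq_fun do rewrite mulr1.
  congr EFin; under eq_Rintegral do rewrite /el_fun sqr_sum_pairs.
  have [||_ ->] := @Rintegral_sum _ _ _ P setT _ s (fun pp w =>
     pp.1.1.1 w * \1_(`]pp.1.1.2, pp.1.2]) r * (pp.2.1.1 w * \1_(`]pp.2.1.2, pp.2.2]) r)).
  - exact: measurableT.
  - apply: (Forall_pairs eL) => p p' ep ep' pT p'T /=.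
    by apply: bdmeas_integrable; apply: bdmeasM; apply: bdmeasM;
      by [exact: elementary_bdmeas|exact: bdmeas_cst].
  have : List.Forall (fun pp : triple * triple => elementary F pp.1 /\ elementary F pp.2) s.
    by apply: (Forall_pairs eL).
  elim => [|[p p'] s' [ep ep'] _ IH]; first by rewrite !big_nil.
  rewrite !big_cons IH; congr (_ + _); rewrite /c /= -RintegralZr//; last first.
    by apply: bdmeas_integrable; apply: bdmeasM; exact: elementary_bdmeas.
  by apply: eq_Rintegral => w _; rewrite mulrACA.
under eq_integral do rewrite E2.
have [||I3 E3] := @Rintegral_sum _ _ _ leb `[0, T] _ s (fun pp r =>
    c pp * (\1_(`]pp.1.1.2, pp.1.2]) r * \1_(`]pp.2.1.2, pp.2.2]) r)).
- exact: measurable_itv.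
- apply: (Forall_pairs eL) => p p' [s0 st _ _] [s'0 st' _ _] pT p'T /=.
  by have [] := integrable_overlap (c (p, p')) s0 pT s'0 p'T.
rewrite -[X in (_ * X)%E]fineK; last exact: integrable_fin_num I3.
rewrite -EFinM; congr EFin; rewrite -/(Rintegral leb `[0, T] _) E3 E1 mulr_sumr.
have : List.Forall (fun pp : triple * triple => [/\ elementary F pp.1, elementary F pp.2,
    pp.1.2 <= T & pp.2.2 <= T]) s by apply: (Forall_pairs eL).
elim => [|[p p'] s' [[s0 st _ _] [s'0 st' _ _] pT p'T] _ IH]; first by rewrite !big_nil.
rewrite !big_cons IH; congr (_ + _).
have [_ ->] := integrable_overlap (c (p, p')) s0 pT s'0 p'T.
by rewrite /=; ring.
Qed.

End isometry.

End list_integral.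

(** * Linearity, uniqueness and existence of the Itô integral *)

Section msq_cvg_linear.
Context {R : realType} d (T : measurableType d) (P : probability T R).

Lemma msq_cvg_lin (a : R) (X X' : nat -> T -> R) Y Y' :
  (forall n, sqint P (X n)) -> (forall n, sqint P (X' n)) -> sqint P Y -> sqint P Y' ->
  msq_cvg P X Y -> msq_cvg P X' Y' ->
  msq_cvg P (fun n w => a * X n w + X' n w) (fun w => a * Y w + Y' w).
Proof.
move=> sX sX' sY sY' c c'.
apply: (@squeeze_cvgr _ _ _ _ (fun=> 0) (fun n => 2 * (a ^+ 2 * msq P (fun w => X n w - Y w))
   + 2 * msq P (fun w => X' n w - Y' w))).
- apply: nearW => n; rewrite msq_ge0/=.
  rewrite -msqZ; last exact: sqintB.
  apply: le_trans (msqD_le _ _); [|exact: sqintZ (sqintB _ _)|exact: sqintB].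
  by rewrite le_eqVlt; apply/orP; left; apply/eqP; apply: eq_Rintegral => w _; congr (_ ^+ 2); ring.
- exact: cvg_cst.
- rewrite -[X in _ --> X](addr0 0); apply: cvgD.
    by rewrite -[X in _ --> X](mulr0 2); apply: cvgMr; rewrite -(mulr0 (a ^+ 2)); exact: cvgMr.
  by rewrite -[X in _ --> X](mulr0 2); exact: cvgMr.
Qed.

End msq_cvg_linear.

Lemma cvge_scale0 (R : realType) (k : R) (u : nat -> \bar R) :
  u n @[n --> \oo] --> 0%E -> (k%:E * u n)%E @[n --> \oo] --> 0%E.
Proof. by move=> u0; have := @cvgeZl _ _ _ _ _ k%:E isT u0; rewrite mule0. Qed.

Lemma cvge_add0 (R : realType) (u v : nat -> \bar R) :
  u n @[n --> \oo] --> 0%E -> v n @[n --> \oo] --> 0%E ->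
  (u n + v n)%E @[n --> \oo] --> 0%E.
Proof.
move=> u0 v0; have H : ((0 : \bar R) +? 0)%E by [].
by have := cvgeD H u0 v0; rewrite adde0; exact.
Qed.

Section ito_integral_theory.
Context {R : realType} {d : measure_display} {Omega : measurableType d}.
Variables (P : probability Omega R) (F : R -> set (set Omega)).
Hypothesis hF : filtration F.
Notation leb := (@lebesgue_measure R).
Notation triple := ((Omega -> R) * R * R)%type.
Variable T : R.

Definition el_err (L : seq triple) (f : R -> R) : \bar R :=
  (\int[leb]_(r in `[0%R, T]) 'E_P[fun w => ((el_fun L r w - f r) ^+ 2)%R])%E.

Definition sp_list (S : simple_process F T) : seq triple :=
  [seq (sp_value S i, sp_time S i, sp_time S i.+1) | i <- iota 0 (sp_size S)].

Lemma sp_list_elementaries S : elementaries F T (sp_list S).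
Proof.
rewrite /sp_list; elim: (iota _ _) => [|i s IH] /=; first by constructor.
constructor => //=; have /andP[t0 _] := sp_time_itv S i.
have /andP[_ tT] := sp_time_itv S i.+1.
split => //; split => //=; [exact: sp_time_le|exact: sp_adapted|].
by have [M sM] := sp_bounded S; exists M => w; exact: sM.
Qed.

Lemma sp_list_int S B : el_int B (sp_list S) = sp_integral S B.
Proof.
apply/funext => w; rewrite /el_int /sp_list big_map /sp_integral.
by rewrite -(big_mkord xpredT (fun i => sp_value S i w *
  (B (sp_time S i.+1) w - B (sp_time S i) w))) /index_iota subn0.
Qed.

Lemma sp_list_fun S : el_fun (sp_list S) = sp_fun S.
Proof.
apply/funext => r; apply/funext => w; rewrite /el_fun /sp_list big_map /sp_fun.
by rewrite -(big_mkord xpredT (fun i => sp_value S i w *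
  \1_(`]sp_time S i, sp_time S i.+1]) r)) /index_iota subn0.
Qed.

Lemma measurable_el_err L (f : R -> R) : elementaries F T L -> measurable_fun `[0, T] f ->
  measurable_fun (`[0, T] : set R) (fun r => 'E_P[fun w => ((el_fun L r w - f r) ^+ 2)%R])%E.
Proof.
move=> eL mf; pose g := f \_ `[0, T].
have mI : measurable (`[0, T]%classic : set R) by exact: measurable_itv.
have mg : measurable_fun setT g by apply/(measurable_restrictT _ mI).
have mh : measurable_fun setT (fun z : R * Omega => ((el_fun L z.1 z.2 - g z.1) ^+ 2)%:E).
  apply/measurable_EFinP; apply: measurable_funX; apply: measurable_funB.
    exact: (measurable_el_fun hF eL).
  by apply: measurableT_comp.
have h0 z : (0 <= ((el_fun L z.1 z.2 - g z.1) ^+ 2)%:E)%E by rewrite lee_fin sqr_ge0.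
have := @measurable_fun_fubini_tonelli_F _ _ _ _ _ P _ mh h0.
move=> /(measurable_funS measurableT (@subsetT _ `[0, T]%classic)).
apply: eq_measurable_fun => r rI; rewrite unlock /fubini_F; apply: eq_integral => w _.
by rewrite /g patchE rI.
Qed.

Lemma el_err_ge0 L (f : R -> R) : (0 <= el_err L f)%E.
Proof.
apply: integral_ge0 => r _; rewrite unlock; apply: integral_ge0 => w _.
by rewrite lee_fin sqr_ge0.
Qed.

Lemma el_diff_sqint L (f : R -> R) r : elementaries F T L -> sqint P (fun w => el_fun L r w - f r).
Proof.
move=> eL; have [mL bL] := el_fun_bdmeas hF r eL.
apply: sqintB; last exact: sqint_cst.
by have := sqint_bdM mL bL (sqint_cst P 1); under eq_fun do rewrite mulr1.
Qed.

(** The concatenated list approximates h - a f - g = 0, so its norm is controlled by the three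
    approximation errors. The factor 4 comes from using (x + y)² <= 2x² + 2y² twice. *)
Lemma el_err_lin a L L' L'' (f g h : R -> R) :
  elementaries F T L -> elementaries F T L' -> elementaries F T L'' ->
  measurable_fun `[0, T] f -> measurable_fun `[0, T] g -> measurable_fun `[0, T] h ->
  (forall r, `[0, T]%classic r -> h r = a * f r + g r) ->
  (el_err (L'' ++ el_scale (- a)%R L ++ el_scale (- 1)%R L') (fun=> 0%R) <=
   4%:E * el_err L'' h + ((4 * a ^+ 2)%:E * el_err L f + 4%:E * el_err L' g))%E.
Proof.
move=> eL eL' eL'' mf mg mh hfg.
set M := L'' ++ _; have eM : elementaries F T M.
  by apply: elementaries_cat => //; apply: elementaries_cat; exact: elementaries_scale.
have mI : measurable (`[0, T]%classic : set R) by exact: measurable_itv.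
have m00 : measurable_fun `[0, T] (fun=> 0 : R) by exact: measurable_cst.
have m0 := measurable_el_err eM m00.
have m1 := measurable_el_err eL mf; have m2 := measurable_el_err eL' mg.
have m3 := measurable_el_err eL'' mh.
have E0 L0 f0 r : (0 <= 'E_P[fun w => ((el_fun L0 r w - f0 r) ^+ 2)%R])%E.
  by rewrite unlock; apply: integral_ge0 => w _; rewrite lee_fin sqr_ge0.
have p k L0 f0 r : 0 <= k ->
    (0 <= k%:E * 'E_P[fun w => ((el_fun L0 r w - f0 r) ^+ 2)%R])%E.
  by move=> k0; rewrite mule_ge0.
have k1 : 0 <= 4 * a ^+ 2 by rewrite mulr_ge0 ?sqr_ge0.
rewrite /el_err -!ge0_integralZl//; try exact: measurable_funeM;
  try by rewrite lee_fin ?mulr_ge0 ?sqr_ge0.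
rewrite -!ge0_integralD//; try exact: measurable_funeM;
  try by move=> r _; do ?[by apply: p|apply: adde_ge0].
  apply: ge0_le_integral => //.
  - by move=> r _; exact: (E0 M (fun=> 0)).
  - by apply: emeasurable_funD; [exact: measurable_funeM|apply: emeasurable_funD; exact: measurable_funeM].
  move=> r rI; have E1 L0 f0 : elementaries F T L0 ->
      ('E_P[fun w => ((el_fun L0 r w - f0 r) ^+ 2)%R] = (msq P (fun w => el_fun L0 r w - f0 r))%:E)%E.
    by move=> eL0; rewrite unlock EFin_msq//; exact: el_diff_sqint.
  rewrite !E1// -!EFinM -!EFinD lee_fin.
  have s1 := el_diff_sqint f r eL; have s2 := el_diff_sqint g r eL'.
  have s3 := el_diff_sqint h r eL''.
  have s1' := sqintZ (- a) s1; have s2' := sqintZ (- 1) s2.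
  have -> : msq P (fun w => el_fun M r w - 0) = msq P (fun w => (el_fun L'' r w - h r) +
      (- a * (el_fun L r w - f r) + - 1 * (el_fun L' r w - g r))).
    apply: eq_Rintegral => w _; congr (_ ^+ 2).
    by rewrite /M !el_fun_cat !el_fun_scale hfg//; ring.
  apply: (le_trans (msqD_le s3 (sqintD s1' s2'))).
  have := msqD_le s1' s2'; rewrite !msqZ// sqrrN.
  have := msq_ge0 P (fun w => el_fun L'' r w - h r); lra.
by apply: emeasurable_funD; exact: measurable_funeM.
Qed.

Section with_wiener.
Variables (B : R -> Omega -> R) (q : R).
Hypothesis hB : scalar_wiener P F B q.

Lemma sp_integral_sqint S : sqint P (sp_integral (S : simple_process F T) B).
Proof. by rewrite -sp_list_int; apply: (el_int_sqint hF hB); exact: sp_list_elementaries. Qed.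

Lemma msq_el_int L : elementaries F T L ->
  ((msq P (el_int B L))%:E = q%:E * el_err L (fun=> 0%R))%E.
Proof.
move=> eL; rewrite (el_isometry hF hB eL); congr (_ * _)%E.
apply: eq_integral => r _; congr ('E_P[_])%E; apply/funext => w.
by rewrite subr0.
Qed.

(** The combination of the three approximating sums has an integrand that tends to 0, so by the
    isometry it tends to 0 in mean square, whatever approximations were chosen. The case a = 0, f =
    g = h is almost sure uniqueness of the integral. *)
Lemma is_ito_integral_lin a (f g h : R -> R) Z Z' Z'' :
  measurable_fun `[0, T] f -> measurable_fun `[0, T] g -> measurable_fun `[0, T] h ->
  (forall r, `[0, T]%classic r -> h r = a * f r + g r) ->
  is_ito_integral P F T (fun r _ => f r) B Z ->
  is_ito_integral P F T (fun r _ => g r) B Z' ->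
  is_ito_integral P F T (fun r _ => h r) B Z'' ->
  [/\ sqint P Z, sqint P Z', sqint P Z'' &
    {ae P, forall w, Z'' w = a * Z w + Z' w}].
Proof.
move=> mf mg mh hfg [mZ [S [S0 SZ]]] [mZ' [S' [S'0 S'Z]]] [mZ'' [S'' [S''0 S''Z]]].
have sI (X : nat -> simple_process F T) n := sp_integral_sqint (X n).
have [sZ cZ] := (cvg_L2P (sI S) mZ).1 SZ.
have [sZ' cZ'] := (cvg_L2P (sI S') mZ').1 S'Z.
have [sZ'' cZ''] := (cvg_L2P (sI S'') mZ'').1 S''Z.
split => //.
have eq_err X k n : (\int[leb]_(s in `[0%R, T])
        'E_P[fun w => ((sp_fun ((X : nat -> simple_process F T) n) s w - k s) ^+ 2)%R] = el_err (sp_list (X n)) k)%E.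
  by rewrite /el_err sp_list_fun.
have [m1 m2] : (0 < 1 :> R) /\ (0 < 1 :> R) by [].
pose M n := sp_list (S'' n) ++ el_scale (- a) (sp_list (S n)) ++ el_scale (- 1) (sp_list (S' n)).
have eM n : elementaries F T (M n).
  apply: elementaries_cat; first exact: sp_list_elementaries.
  by apply: elementaries_cat; apply: elementaries_scale => //; exact: sp_list_elementaries.
have IM n w : el_int B (M n) w = - a * sp_integral (S n) B w +
    (- 1 * sp_integral (S' n) B w + sp_integral (S'' n) B w).
  rewrite /M !el_int_cat !el_int_scale !sp_list_int; ring.
have c1 : msq_cvg P (fun n w => el_int B (M n) w)
   (fun w => - a * Z w + (- 1 * Z' w + Z'' w)).
  have := msq_cvg_lin (- a) (sI S) (fun n => sqintD (sqintZ (- 1) (sI S' n)) (sI S'' n)) sZ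
    (sqintD (sqintZ (- 1) sZ') sZ'') cZ (msq_cvg_lin (- 1) (sI S') (sI S'') sZ' sZ'' cZ' cZ'').
  by congr msq_cvg; apply/funext => n; apply/funext => w; rewrite IM.
have c2 : msq_cvg P (fun n w => el_int B (M n) w) (fun=> 0).
  have e0 : (4%:E * el_err (sp_list (S'' n)) h + ((4 * a ^+ 2)%:E * el_err (sp_list (S n)) f
      + 4%:E * el_err (sp_list (S' n)) g))%E @[n --> \oo] --> 0%E.
    rewrite (funext (eq_err S f)) in S0; rewrite (funext (eq_err S' g)) in S'0.
    rewrite (funext (eq_err S'' h)) in S''0.
    by apply: cvge_add0; [|apply: cvge_add0]; exact: cvge_scale0.
  have e1 : (q%:E * el_err (M n) (fun=> 0%R))%E @[n --> \oo] --> 0%E.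
    apply: cvge_scale0; apply: (@squeeze_cvge _ _ _ _ (fun=> 0%E) _ _ _ _ _ e0); last exact: cvg_cst.
    apply: nearW => n; rewrite el_err_ge0/=.
    by apply: el_err_lin => //; exact: sp_list_elementaries.
  have e2 : (msq P (el_int B (M n)))%:E @[n --> \oo] --> 0%E.
    by under eq_fun do rewrite msq_el_int//.
  rewrite /msq_cvg.
  have <- : (fun n => msq P (el_int B (M n))) = (fun n => msq P (fun w => el_int B (M n) w - 0)).
    by apply/funext => n; apply: eq_Rintegral => w _; rewrite subr0.
  exact: (fine_cvg e2).
have sM n : sqint P (el_int B (M n)) by exact: (el_int_sqint hF hB).
have := msq_cvg_ae sM (sqintD (sqintZ (- a) sZ) (sqintD (sqintZ (- 1) sZ') sZ''))
  (sqint_cst P 0) c1 c2.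
by apply: filterS => w; lra.
Qed.

(** By the isometry the approximating sums are Cauchy in mean square; [msq_complete] provides the
    limit. *)
Lemma is_ito_integral_exists (f : R -> R) (S : nat -> simple_process F T) :
  measurable_fun `[0, T] f ->
  el_err (sp_list (S n)) f @[n --> \oo] --> 0%E ->
  exists Z, [/\ is_ito_integral P F T (fun r _ => f r) B Z, sqint P Z &
    msq_cvg P (fun n => sp_integral (S n) B) Z].
Proof.
move=> mf S0.
have m0 : measurable_fun `[0, T] (fun=> 0 : R) by exact: measurable_cst.
have e00 : el_err [::] (fun=> 0 : R) = 0%E.
  rewrite /el_err integral0_eq// => r _; rewrite unlock integral0_eq// => w _.
  by rewrite /el_fun big_nil subr0 expr0n.
have sI n := sp_integral_sqint (S n).
have e1 n : (\int[leb]_(s in `[0%R, T])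
        'E_P[fun w => ((sp_fun (S n) s w - f s) ^+ 2)%R] = el_err (sp_list (S n)) f)%E.
  by rewrite /el_err sp_list_fun.
have D n m : ((msq P (fun w => sp_integral (S n) B w - sp_integral (S m) B w))%:E <=
    q%:E * (4%:E * el_err (sp_list (S n)) f + 4%:E * el_err (sp_list (S m)) f))%E.
  (* The difference of two sums, put in the three-block shape of [el_err_lin]; the empty list
     approximates 0 exactly. *)
  pose M := sp_list (S n) ++ el_scale (- 1) (sp_list (S m)) ++ el_scale (- 1) [::].
  have eM : elementaries F T M.
    apply: elementaries_cat; first exact: sp_list_elementaries.
    apply: elementaries_cat; first by apply: elementaries_scale => //; exact: sp_list_elementaries.
    by constructor.
  have <- : msq P (el_int B M) = msq P (fun w => sp_integral (S n) B w - sp_integral (S m) B w).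
    apply: eq_Rintegral => w _; congr (_ ^+ 2).
    rewrite /M !el_int_cat !el_int_scale !sp_list_int {1}/el_int big_nil; ring.
  rewrite msq_el_int//; apply: lee_wpmul2l; first by rewrite lee_fin; have [] := hB.
  have := @el_err_lin 1 (sp_list (S m)) [::] (sp_list (S n)) f (fun=> 0) f
    (sp_list_elementaries _) (List.Forall_nil _) (sp_list_elementaries _) mf m0 mf.
  by rewrite e00 mule0 adde0 expr1n mulr1; apply => r _; rewrite mul1r addr0.
have [Z sZ cZ] : exists2 Z, sqint P Z & msq_cvg P (fun n => sp_integral (S n) B) Z.
  apply: msq_complete => // e e0.
  have c : (q%:E * (4%:E * el_err (sp_list (S n)) f))%E @[n --> \oo] --> 0%E.
    exact: (cvge_scale0 _ (cvge_scale0 _ S0)).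
  have e2 : 0 < e / 2 by rewrite divr_gt0.
  have [N _ HN] : \forall n \near \oo, (q%:E * (4%:E * el_err (sp_list (S n)) f) <= (e / 2)%:E)%E.
    have [fin _] := (fine_cvgP _ _).1 c.
    have c' : fine (q%:E * (4%:E * el_err (sp_list (S n)) f))%E @[n --> \oo] --> (0 : R).
      exact: (fine_cvg c).
    have c'' := (cvgrPdist_le _ _).1 c' _ e2; near=> n.
    have fn : (q%:E * (4%:E * el_err (sp_list (S n)) f))%E \is a fin_num by near: n; exact: fin.
    rewrite -(fineK fn) lee_fin; apply: le_trans (ler_norm _) _.
    by rewrite -normrN -[- fine _]sub0r; near: n; exact: c''.
  exists N => n m /HN Hn /HN Hm; rewrite -lee_fin (le_trans (D n m))//.
  rewrite ge0_muleDr ?mule_ge0 ?el_err_ge0//.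
  by apply: le_trans (leeD Hn Hm) _; rewrite -EFinD lee_fin -splitr.
exists Z; split => //; split; first by case: sZ.
exists S; split; first by under [X in X @ _ --> _]eq_fun do rewrite e1.
by apply/cvg_L2P => //; case: sZ.
Unshelve. all: by end_near. Qed.

End with_wiener.
End ito_integral_theory.

(** * Continuity of the second moment; density of dyadic step functions *)

Section msq_continuity.
Context {R : realType} d (T : measurableType d) (P : probability T R).

(** From |x² - y²| <= (1 + 1/a)(x - y)² + a y²: first [a] is taken so small that the second term
    contributes at most e/2, then [b] is the mean square distance for which the first contributes
    e/2. *)
Lemma msq_cvg_msq (X : nat -> T -> R) Y : (forall n, sqint P (X n)) -> sqint P Y ->
  msq_cvg P X Y -> msq P (X n) @[n --> \oo] --> msq P Y.
Proof.
move=> sX sY c; apply/cvgrPdist_le => /= e e0.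
have mY0 := msq_ge0 P Y.
pose a := e / (2 * (msq P Y + 1)).
have a0 : 0 < a by rewrite divr_gt0// mulr_gt0// ltr_wpDl.
pose b := e / (2 * (1 + a^-1)).
have a10 : 0 < 1 + a^-1 by rewrite ltr_wpDr ?invr_ge0 ?ltW.
have b0 : 0 < b by rewrite divr_gt0// mulr_gt0.
have [N _ HN] := (cvgrPdist_le _ _).1 c _ b0.
exists N => // n /= Nn; have := HN n Nn; rewrite sub0r normrN ger0_norm ?msq_ge0// => {HN}HN.
have sD := sqintB (sX n) sY; have [mXn iXn] := sX n; have [mYY iY] := sY; have [mD iD] := sD.
have key w : `|X n w ^+ 2 - Y w ^+ 2| <= (1 + a^-1) * (X n w - Y w) ^+ 2 + a * Y w ^+ 2.
  move: (X n w) (Y w) => x y; set z := x - y.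
  have -> : x ^+ 2 - y ^+ 2 = z ^+ 2 + 2 * y * z by rewrite /z; ring.
  have h1 : 0 <= a * (y - z / a) ^+ 2 by rewrite mulr_ge0 ?sqr_ge0 ?ltW.
  have h2 : 0 <= a * (y + z / a) ^+ 2 by rewrite mulr_ge0 ?sqr_ge0 ?ltW.
  have e1 : a * (y - z / a) ^+ 2 = a * y ^+ 2 - 2 * y * z + a^-1 * z ^+ 2 by field; rewrite gt_eqF.
  have e2 : a * (y + z / a) ^+ 2 = a * y ^+ 2 + 2 * y * z + a^-1 * z ^+ 2 by field; rewrite gt_eqF.
  have := sqr_ge0 z; rewrite ler_norml => h3; apply/andP; split; lra.
rewrite distrC /msq -RintegralB//.
have i1 := integrableZl measurableT (1 + a^-1) iD; have i2 := integrableZl measurableT a iY.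
have iB := integrableB measurableT iXn iY.
apply: (le_trans (le_normr_Rintegral measurableT iB)).
apply: (@le_trans _ _ (\int[P]_w ((1 + a^-1) * (X n w - Y w) ^+ 2 + a * Y w ^+ 2))).
  apply: le_Rintegral => //; first exact: (integrable_abse iB).
  exact: (integrableD measurableT i1 i2).
rewrite RintegralD// !RintegralZl//.
rewrite -/(msq P (fun w => X n w - Y w)) -/(msq P Y).
have : (1 + a^-1) * msq P (fun w => X n w - Y w) <= (1 + a^-1) * b.
  by rewrite ler_wpM2l// ltW.
have -> : (1 + a^-1) * b = e / 2 by rewrite /b; field; rewrite !gt_eqF// ltr_wpDr// ltW.
have : a * msq P Y <= e / 2.
  rewrite /a mulrAC ler_pdivrMr ?mulr_gt0 ?ltr_wpDl//; have := ltW e0; nra.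
lra.
Qed.

End msq_continuity.

Section dyadic_steps.
Context {R : realType}.
Variable T : R.
Hypothesis T_gt0 : 0 < T.
Notation leb := (@lebesgue_measure R).

Definition dyadic (m i : nat) : R := T * i%:R / 2 ^+ m.

Definition dyadic_step (m : nat) (c : nat -> R) (r : R) : R :=
  \sum_(i < 2 ^ m) c i * \1_(`]dyadic m i, dyadic m i.+1]) r.

Lemma dyadicS m i : dyadic m i.+1 = dyadic m i + T / 2 ^+ m.
Proof. by rewrite /dyadic -natr1 mulrDr mulr1 mulrDl. Qed.

Lemma dyadic_le m i j : (i <= j)%N -> dyadic m i <= dyadic m j.
Proof.
move=> ij; rewrite /dyadic ler_wpM2r ?invr_ge0 ?exprn_ge0//.
by rewrite ler_wpM2l ?(ltW T_gt0)// ler_nat.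
Qed.

Lemma dyadic0 m : dyadic m 0 = 0.
Proof. by rewrite /dyadic mulr0 mul0r. Qed.

Lemma dyadic_max m : dyadic m (2 ^ m) = T.
Proof. by rewrite /dyadic natrX mulfK// gt_eqF// exprn_gt0. Qed.

Lemma dyadic_stepP m (r : R) : 0 < r <= T -> exists i,
  [/\ (i < 2 ^ m)%N, dyadic m i < r, r <= dyadic m i.+1 &
      forall c, dyadic_step m c r = c i].
Proof.
move=> /andP[r0 rT].
have ex : exists i, r <= dyadic m i.+1.
  by exists (2 ^ m).-1; rewrite prednK ?expn_gt0// dyadic_max.
have [i ri imin] := ex_minnP ex.
have ir : dyadic m i < r.
  case: i ri imin => [|i] ri imin; first by rewrite dyadic0.
  by rewrite ltNge; apply/negP => /imin; rewrite ltnn.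
have i2 : (i < 2 ^ m)%N.
  rewrite ltnNge; apply/negP => /(dyadic_le m); rewrite dyadic_max => h.
  by have := le_lt_trans h ir; rewrite ltNge rT.
exists i; split => // c; rewrite /dyadic_step (bigD1 (Ordinal i2))//= big1 ?addr0.
  by rewrite indicE mem_set ?mulr1//= in_itv/= ir ri.
move=> j /eqP ji; rewrite indicE memNset ?mulr0//= in_itv/= => /andP[jr rj].
apply: ji; apply/val_inj => /=; apply/eqP; rewrite eqn_leq; apply/andP; split.
  rewrite leqNgt; apply/negP => /(dyadic_le m) h.
  by have := lt_le_trans jr (le_trans ri h); rewrite ltxx.
rewrite leqNgt; apply/negP => /(dyadic_le m) h.
by have := lt_le_trans ir (le_trans rj h); rewrite ltxx.
Qed.

Lemma dyadic_step_bound m c M (r : R) : (forall i, `|c i| <= M) ->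
  `|dyadic_step m c r| <= M.
Proof.
move=> cM; have M0 : 0 <= M by exact: le_trans (cM 0%N).
have [/(dyadic_stepP m)[i [_ _ _ ->]]//|rT] := boolP (0 < r <= T).
rewrite /dyadic_step big1 ?normr0// => i _.
rewrite indicE memNset ?mulr0//= in_itv/= => /andP[ir ri]; move/negP : rT; apply.
have := dyadic_le m (leq0n i); rewrite dyadic0 => i0; rewrite (le_lt_trans i0 ir)/=.
by apply: (le_trans ri); rewrite -[leRHS](dyadic_max m); exact: dyadic_le.
Qed.

Lemma measurable_dyadic_step m c : measurable_fun setT (dyadic_step m c).
Proof.
by apply: measurable_sum => i; apply: measurable_funM.
Qed.

(** Normalised Lebesgue measure on [0, T] is a probability, so [sqint], [msq] and their theory apply
    to functions of time. *)
Let U : probability (measurableTypeR R) R := uniform_prob T_gt0.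

Lemma uniform_integral (h : R -> R) : measurable_fun setT h -> (forall r, 0 <= h r) ->
  (\int[leb]_(r in `[0%R, T]) (h r)%:E = T%:E * \int[U]_r (h r)%:E)%E.
Proof.
move=> mh h0; rewrite /U integral_uniform; last 2 first.
- exact/measurable_EFinP.
- by move=> x; rewrite lee_fin.
by rewrite subr0 muleA -EFinM mulfV ?gt_eqF// mul1e.
Qed.

Lemma uniform_ae : {ae U, forall r, 0 < r <= T}.
Proof.
have mI : measurable (~` `]0, T]%classic : set (measurableTypeR R)).
  by apply: measurableC; exact: measurable_itv.
exists (~` `]0, T]%classic); split => //.
have m1 : measurable_fun setT (\1_(~` `]0, T]%classic) : R -> R) by exact: measurable_indic.
have := uniform_integral m1 (fun r => ler0n R _); rewrite !integral_indic//.
rewrite setIT (_ : _ `&` _ = [set 0]); last first.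
  apply/seteqP; split => r /=; rewrite !in_itv/=.
    move=> [H /andP[r0 rT]]; apply/eqP; rewrite eq_le r0 andbT leNgt.
    by apply/negP => r0'; apply: H; rewrite r0' rT.
  by move=> ->; split; rewrite ?ltxx// lexx ltW.
rewrite -[X in X = _ -> _]/(leb [set 0]) lebesgue_measure_set1 => /esym/eqP.
by rewrite mule_eq0 eqe gt_eqF//= => /eqP.
Qed.

Lemma uniform_msq (h : R -> R) : measurable_fun setT h ->
  (\int[leb]_(r in `[0%R, T]) (h r ^+ 2)%:E < +oo)%E ->
  sqint U h /\ (\int[leb]_(r in `[0%R, T]) (h r ^+ 2)%:E = (T * msq U h)%:E)%E.
Proof.
move=> mh fin; have mh2 : measurable_fun setT (fun r => h r ^+ 2) by exact: measurable_funX.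
have E := uniform_integral mh2 (fun r => sqr_ge0 (h r)).
have sh : sqint U h.
  apply/sqintP => //; rewrite ltNge leye_eq; apply/negP => /eqP H; move: fin.
  by rewrite E H gt0_muley ?lte_fin// ltxx.
by split => //; rewrite E -EFin_msq// EFinM.
Qed.

Lemma bounded_sqint (h : R -> R) (M : R) : measurable_fun setT h -> (forall r, `|h r| <= M) ->
  sqint U h.
Proof.
move=> mh hM; have := @sqint_bdM _ _ (measurableTypeR R) U h (fun=> 1) mh (ex_intro _ M hM) (sqint_cst U 1).
by under eq_fun do rewrite mulr1.
Qed.

(** Approximation is asked at every level beyond [M], not at one level, so that several functions
    can later be approximated on a common grid. *)
Definition dyadic_dense (f : R -> R) := forall e, 0 < e -> exists M, forall m, (M <= m)%N ->
  exists c, msq U (fun r => dyadic_step m c r - f r) <= e.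

Lemma step_sqint m c : sqint U (dyadic_step m c).
Proof.
have cM i : (i < 2 ^ m)%N -> `|c i| <= \sum_(j < 2 ^ m) `|c j|.
  by move=> i2; rewrite (bigD1 (Ordinal i2))//= lerDl sumr_ge0.
pose c' i := if (i < 2 ^ m)%N then c i else 0.
have E : dyadic_step m c = dyadic_step m c'.
  by apply/funext => r; apply: eq_bigr => i _; rewrite /c' ltn_ord.
rewrite E; apply: (bounded_sqint (measurable_dyadic_step m c') (M := \sum_(j < 2 ^ m) `|c j|)).
move=> r; apply: dyadic_step_bound => i; rewrite /c'.
by case: ifPn => [/cM//|_]; rewrite normr0 sumr_ge0.
Qed.

Lemma dyadic_dense_lim (f : R -> R) : sqint U f ->
  (forall e, 0 < e -> exists g, [/\ sqint U g, dyadic_dense g &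
    msq U (fun r => g r - f r) <= e]) -> dyadic_dense f.
Proof.
move=> sf H e e0; have e4 : 0 < e / 4 by rewrite divr_gt0.
have [g [sg dg gf]] := H _ e4; have [M HM] := dg _ e4.
exists M => m /HM[c cg]; exists c.
apply: (le_trans (msqB_le (step_sqint m c) sg sf)); lra.
Qed.

(** The step function taking on each cell the value of [g] at the right end converges pointwise on
    ]0, T] by continuity, and boundedly, so dominated convergence applies. *)
Lemma dyadic_dense_continuous (g : R -> R) M : continuous g -> (forall r, `|g r| <= M) ->
  dyadic_dense g.
Proof.
move=> cg gM e e0; pose c m i := g (dyadic m i.+1).
have mg : measurable_fun setT g by exact: continuous_measurable_fun.
have cM m i : `|c m i| <= M by exact: gM.
pose I : set R := `]0, T]%classic.
pose D m r := (dyadic_step m (c m) r - g r) ^+ 2 * \1_I r.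
have mI : measurable (I : set (measurableTypeR R)) by exact: measurable_itv.
have D0 r : D m r @[m --> \oo] --> (0 : R).
  rewrite /D; have [rI|rI] := boolP (0 < r <= T); last first.
    rewrite indicE memNset; last by rewrite /I/= in_itv/=; exact/negP.
    by under eq_fun do rewrite mulr0; exact: cvg_cst.
  rewrite indicE mem_set; last by rewrite /I/= in_itv/=.
  under eq_fun do rewrite mulr1.
  have cr : dyadic_step m (c m) r @[m --> \oo] --> g r.
    apply/cvgrPdist_le => /= d d0.
    have [k /= k0 Hk] := (cvgrPdist_le _ _).1 (cg r) d d0.
    have T2 : T / 2 ^+ m @[m --> \oo] --> (0 : R).
      rewrite -[X in _ --> X](mulr0 T); apply: cvgMr.
      under eq_fun do rewrite -exprVn.
      by apply: cvg_expr; rewrite ger0_norm ?invr_ge0//; lra.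
    have [N _ HN] := (cvgrPdist_lt _ _).1 T2 k k0.
    exists N => // m /= /HN; rewrite sub0r normrN ger0_norm ?divr_ge0 ?exprn_ge0 ?(ltW T_gt0)// => h.
    have [i [i2 ir ri ->]] := dyadic_stepP m rI.
    apply: Hk; rewrite /ball_ /= distrC ger0_norm ?subr_ge0//.
    by apply: le_lt_trans h; move: ri; rewrite dyadicS; lra.
  have cr' : dyadic_step m (c m) r - g r @[m --> \oo] --> (0 : R).
    by rewrite -(subrr (g r)); apply: cvgB => //; exact: cvg_cst.
  under eq_fun do rewrite expr2; rewrite -(mulr0 0); exact: (cvgM cr' cr').
have mS m : measurable_fun setT (fun r => dyadic_step m (c m) r - g r).
  by apply: measurable_funB => //; exact: measurable_dyadic_step.
have mD m : measurable_fun setT (D m).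
  by apply: measurable_funM; [exact: measurable_funX|exact: measurable_indic].
have iM : U.-integrable setT (EFin \o (fun=> (2 * M) ^+ 2)).
  by apply: bdmeas_integrable; exact: bdmeas_cst.
have DM m r : `|D m r| <= (2 * M) ^+ 2.
  have i0 : 0 <= \1_I r :> R by rewrite indicE.
  rewrite /D ger0_norm; last by rewrite mulr_ge0 ?sqr_ge0.
  have i1 : \1_I r <= 1 :> R by rewrite indicE; case: (_ \in _).
  have M0 : 0 <= M by exact: le_trans (gM 0).
  apply: (@le_trans _ _ ((dyadic_step m (c m) r - g r) ^+ 2)).
    by rewrite ler_piMr ?sqr_ge0.
  rewrite -real_normK ?num_real// ler_sqr ?nnegrE ?mulr_ge0//.
  apply: (le_trans (ler_normB _ _)); have := gM r; have := dyadic_step_bound m r (cM m).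
  lra.
have [_ cD] := @cvg_Rintegral _ _ _ U D (fun=> 0) _ mD D0 iM DM.
have {}cD : \int[U]_r D m r @[m --> \oo] --> (0 : R).
  by move: cD; rewrite [X in _ --> X](_ : _ = 0)// /Rintegral integral0_eq.
have [N _ HN] := (cvgrPdist_le _ _).1 cD e e0.
exists N => m /HN; rewrite sub0r normrN => h; exists (c m).
apply: le_trans (le_trans (ler_norm _) h).
rewrite le_eqVlt; apply/orP; left; apply/eqP; apply: eq_Rintegral_ae.
- exact: (measurable_funX 2 (mS m)).
- exact: mD.
- have [A [mA A0 HA]] := uniform_ae; exists A; split => // r /= H; apply: HA => /= rI.
  by apply: H; rewrite /D indicE mem_set ?mulr1// /I/= in_itv.
Qed.

Let clamp (M x : R) := Num.max (- M) (Num.min M x).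

Let clamp_abs M x : 0 <= M -> `|clamp M x| <= M.
Proof. by move=> M0; rewrite /clamp ler_norml le_max lexx/= ge_max ge_min lexx/= andbT; lra. Qed.

Let clamp_dist M x y : `|y| <= M -> `|clamp M x - y| <= `|x - y|.
Proof.
rewrite ler_norml => /andP[y1 y2]; rewrite /clamp.
have [xM|xM] := leP M x.
  have -> : Num.max (- M) M = M by apply/max_idPr; lra.
  by rewrite !ger0_norm ?subr_ge0//; lra.
have [xM'|xM'] := leP (- M) x; first exact: lexx.
by rewrite !ler0_norm ?subr_le0//; lra.
Qed.

(** Continuous functions approximate [f] in L¹. Clamping them to [-M, M] does not increase the
    distance to [f], and then the squared distance is at most 2M + 1 times the L¹ integrand, whence
    the tolerance [k]. The added 1 keeps the factor positive when M = 0. *)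
Lemma dyadic_dense_bounded (f : R -> R) M : measurable_fun setT f ->
  (forall r, `|f r| <= M) -> dyadic_dense f.
Proof.
move=> mf fM; have M0 : 0 <= M by exact: le_trans (fM 0).
have sf := bounded_sqint mf fM.
apply: dyadic_dense_lim => // e e0.
pose I : set (measurableTypeR R) := `[0, T]%classic.
have mI : measurable I by exact: measurable_itv.
have ltI : (leb I < +oo)%E.
  by rewrite /I lebesgue_measure_itv/=; case: ifPn => _; rewrite ?ltry// -EFinB ltry.
have iF : leb.-integrable I (EFin \o f).
  apply: measurable_bounded_integrable => //; first exact: measurable_funTS.
  by exists M; split; [exact: num_real|move=> x Mx y _ /=; rewrite (le_trans (fM y))// ltW].
have [g [cg _ g0]] := approximation_continuous_integrable mI ltI iF.
have M1 : 0 < 2 * M + 1 by rewrite ltr_wpDl// mulr_ge0.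
pose k := e * T / (2 * M + 1).
have k0 : 0 < k by rewrite divr_gt0// mulr_gt0.
have [fin cfin] := (fine_cvgP _ _).1 g0.
have [n [nfin nle]] : exists n, (\int[leb]_(z in I) `|(f z - g n z)%:E| \is a fin_num)%E /\
    fine (\int[leb]_(z in I) `|(f z - g n z)%:E|)%E <= k.
  have [N1 _ H1] := fin; have [N2 _ H2] := (cvgrPdist_le _ _).1 cfin k k0.
  exists (maxn N1 N2); split; first by apply: H1; exact: leq_maxl.
  have := H2 _ (leq_maxr N1 N2); rewrite sub0r normrN => h.
  exact: le_trans (ler_norm _) h.
have mg : measurable_fun setT (g n) by exact: continuous_measurable_fun.
pose h r := clamp M (g n r).
have mh : measurable_fun setT h.
  by apply: measurable_maxr => //; exact: measurable_minr.
have hM r : `|h r| <= M by exact: clamp_abs.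
have sh := bounded_sqint mh hM.
have ch : continuous h.
  move=> r.
  have c : {for r, continuous ((fun=> - M) \max ((fun=> M) \min (g n)))}.
    apply: continuous_max; first exact: cvg_cst.
    by apply: continuous_min; [exact: cvg_cst|exact: cg].
  exact: c.
exists h; split => //; first exact: dyadic_dense_continuous ch hM.
have sB := sqintB sh sf.
have mB : measurable_fun setT (fun r => (h r - f r) ^+ 2).
  by apply: measurable_funX; exact: measurable_funB.
suff : (T%:E * (msq U (fun r => h r - f r))%:E <= (T * e)%:E)%E.
  by rewrite -EFinM lee_fin ler_pM2l.
rewrite EFin_msq// -uniform_integral//; last by move=> r; exact: sqr_ge0.
apply: (@le_trans _ _ (\int[leb]_(r in I) ((2 * M + 1)%:E * `|(f r - g n r)%:E|))%E).
  apply: ge0_le_integral => //.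
  - by move=> r _; rewrite lee_fin sqr_ge0.
  - by apply/measurable_EFinP; exact: measurable_funTS.
  - apply: measurable_funeM; apply: measurableT_comp => //; apply/measurable_EFinP.
    by apply: measurable_funTS; exact: measurable_funB.
  move=> r _; rewrite abse_EFin -EFinM lee_fin distrC.
  have d1 : `|h r - f r| <= `|g n r - f r| by exact: clamp_dist.
  have d2 : `|h r - f r| <= 2 * M + 1.
    by apply: (le_trans (ler_normB _ _)); have := hM r; have := fM r; lra.
  by rewrite -(real_normK (num_real (h r - f r))) expr2 ler_pM.
rewrite ge0_integralZl//; last 2 first.
- apply: measurableT_comp => //; apply/measurable_EFinP.
  by apply: measurable_funTS; exact: measurable_funB.
- by rewrite lee_fin ltW.
rewrite -(fineK nfin) -EFinM lee_fin.
apply: (le_trans (ler_wpM2l (ltW M1) nle)).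
by rewrite le_eqVlt /k; apply/orP; left; apply/eqP; field; rewrite gt_eqF.
Qed.

(** Truncation at level n is eventually exact at each point, and the squared error is dominated by
    f². *)
Lemma dyadic_dense_sqint (f : R -> R) : sqint U f -> dyadic_dense f.
Proof.
move=> sf; have [mf iF] := sf.
apply: dyadic_dense_lim => // e e0.
pose h n r := clamp n%:R (f r).
have mh n : measurable_fun setT (h n).
  by apply: measurable_maxr => //; exact: measurable_minr.
have hn n r : `|h n r| <= n%:R by exact: clamp_abs.
have hf n r : (h n r - f r) ^+ 2 <= f r ^+ 2.
  rewrite -(real_normK (num_real (h n r - f r))) -(real_normK (num_real (f r))).
  rewrite ler_sqr ?nnegrE// /h /clamp; have n0 := ler0n R n.
  have [xM|xM] := leP n%:R (f r).
    have -> : Num.max (- n%:R) n%:R = n%:R :> R by apply/max_idPr; lra.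
    by rewrite ler0_norm ?subr_le0// (ger0_norm (le_trans n0 xM)); lra.
  have [xM'|xM'] := leP (- n%:R) (f r); first by rewrite subrr normr0.
  have f0 : f r <= 0 by lra.
  by rewrite (ler0_norm f0) ger0_norm ?subr_ge0; lra.
have cf r : (h n r - f r) ^+ 2 @[n --> \oo] --> (0 : R).
  apply: cvg_near_cst; near=> n; rewrite /h /clamp.
  have : `|f r| <= n%:R.
    near: n; exists (Num.truncn `|f r|).+1 => // k /= xk.
    by rewrite (le_trans (ltW (truncnS_gt _)))// ler_nat.
  rewrite ler_norml => /andP[h1 h2].
  have /min_idPr -> := h2; have /max_idPr -> := h1.
  by rewrite subrr expr0n.
have mhf n : measurable_fun setT (fun r => (h n r - f r) ^+ 2).
  by apply: measurable_funX; apply: measurable_funB; [exact: mh|exact: mf].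
have [|_ c] := @cvg_Rintegral _ _ _ U (fun n r => (h n r - f r) ^+ 2) (fun=> 0) _ mhf cf iF.
  by move=> n r; rewrite ger0_norm ?sqr_ge0.
have {}c : \int[U]_r ((h n r - f r) ^+ 2) @[n --> \oo] --> (0 : R).
  by move: c; rewrite [X in _ --> X](_ : _ = 0)// /Rintegral integral0_eq.
have [N _ HN] := (cvgrPdist_le _ _).1 c e e0.
have := HN N (leqnn _); rewrite /= sub0r normrN => h1.
exists (h N); split; first exact: bounded_sqint (mh N) (hn N).
  exact: dyadic_dense_bounded (mh N) (hn N).
exact: le_trans (ler_norm _) h1.
Unshelve. all: by end_near. Qed.

End dyadic_steps.

(** * The reproducing kernel space: adjoint, covariance and Parseval *)

Section hilbert_space.
Context {R : realType} (H : completeNormedModType R) (ip : {dot H for idfun}).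
Hypothesis hn : hilbert_norm ip.
Implicit Types (x y z : H) (a : R).

Lemma ipC x y : ip x y = ip y x.
Proof. by rewrite hermC expr0 mul1r. Qed.

Lemma ipDl x y z : ip (x + y) z = ip x z + ip y z.
Proof. exact: linearDl. Qed.

Lemma ipZl a x z : ip (a *: x) z = a * ip x z.
Proof. exact: linearZl_LR. Qed.

Lemma ipDr x y z : ip z (x + y) = ip z x + ip z y.
Proof. by rewrite ipC ipDl !(ipC z). Qed.

Lemma ipZr a x z : ip z (a *: x) = a * ip z x.
Proof. by rewrite ipC ipZl (ipC z). Qed.

Lemma ipBl x y z : ip (x - y) z = ip x z - ip y z.
Proof. by rewrite -scaleN1r ipDl ipZl mulN1r. Qed.

Lemma ipBr x y z : ip z (x - y) = ip z x - ip z y.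
Proof. by rewrite ipC ipBl !(ipC z). Qed.

Lemma ip0l z : ip 0 z = 0.
Proof. by have := ipZl 0 0 z; rewrite scale0r mul0r. Qed.

Lemma ip_suml (I : Type) (s : seq I) (p : pred I) (F : I -> H) z :
  ip (\sum_(i <- s | p i) F i) z = \sum_(i <- s | p i) ip (F i) z.
Proof.
elim: s => [|i s IH]; first by rewrite !big_nil ip0l.
by rewrite !big_cons; case: (p i) => //; rewrite ipDl IH.
Qed.

Lemma polarization x y : ip x y = (`|x + y| ^+ 2 - `|x - y| ^+ 2) / 4.
Proof.
have E1 : ip (x + y) (x + y) = ip x x + ip x y + (ip x y + ip y y).
  by rewrite ipDl !ipDr (ipC y x).
have E2 : ip (x - y) (x - y) = ip x x - ip x y - (ip x y - ip y y).
  by rewrite ipBl !ipBr (ipC y x).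
by rewrite !hn E1 E2; field.
Qed.

Lemma continuous_ip x : continuous (ip x : H -> R^o).
Proof.
have -> : (ip x : H -> R^o) = (fun y => (`|x + y| ^+ 2 - `|x - y| ^+ 2) / 4).
  by apply/funext => y; exact: polarization.
have sq (f : H -> H) : continuous f -> continuous (fun y => `|f y| ^+ 2 : R).
  move=> cf y; have c : `|f z| @[z --> y] --> `|f y| by apply: cvg_norm; exact: cf.
  exact: (cvgM c c).
have c1 : continuous (fun y => x + y).
  by move=> z; apply: cvgD; [exact: cvg_cst|exact: cvg_id].
have c2 : continuous (fun y => x - y).
  by move=> z; apply: cvgB; [exact: cvg_cst|exact: cvg_id].
move=> y; apply: cvgMl; exact: cvgB (sq _ c1 y) (sq _ c2 y).
Qed.

Lemma dense_eq0 (D : set H) (f : H -> R^o) : dense D -> continuous f ->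
  (forall x, D x -> f x = 0) -> forall x, f x = 0.
Proof.
move=> dD cf D0 x; apply/eqP; apply: contrapT => /negP fx0.
have oO : open (f @^-1` [set y : R^o | y != 0]).
  by move/continuousP: cf; apply; exact: open_neq.
have [y [/= fy Dy]] := dD _ (ex_intro _ x fx0) oO.
by move: fy; rewrite D0// eqxx.
Qed.

Section adjoint.
Variables (U : normedModType R) (i : 'L(H, U)) (Q : dual_space U -> U).
Hypothesis hH : reproducing_kernel_space Q ip i.
Local Notation adj := (hilbert_adjoint ip i).

(** The representing vector is explicit, namely [j (Q x)]: the identity holds on the dense image of
    range Q under [j] and extends by continuity. So the value chosen by [hilbert_adjoint] is never
    the default. *)
Lemma adjointP (x : dual_space U) z : ip (adj x) z = x (i z).
Proof.
suff : [set h | forall z, ip h z = x (i z)] (adj x) by apply.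
apply: xgetPex; have [_ [j [jip dj ij]]] := hH.
exists (j (Q x)) => {}z; apply/eqP; rewrite -subr_eq0; apply/eqP; move: z.
apply: (dense_eq0 dj).
  move=> z; apply: cvgB; first exact: continuous_ip.
  exact: (@bop_comp_continuous _ _ _ _ x i z).
move=> _ [_ [y _ <-] <-]; rewrite jip ij; last by exists y.
by apply/eqP; rewrite subr_eq0 -jip ipC jip.
Qed.

Lemma adjoint_unique (x : dual_space U) h : (forall z, ip h z = x (i z)) -> adj x = h.
Proof.
move=> hx; apply/eqP; rewrite -subr_eq0 -normr_eq0 -sqrf_eq0 hn.
by rewrite ipBl adjointP hx subrr.
Qed.

Lemma adjoint_lincomb a (x y : dual_space U) :
  adj (bop_lincomb a x y) = a *: adj x + adj y.
Proof. by apply: adjoint_unique => z; rewrite ipDl ipZl !adjointP. Qed.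

Lemma covariance_adjoint (x y : dual_space U) : y (Q x) = ip (adj x) (adj y).
Proof.
have [_ [j [jip dj ij]]] := hH.
have E (w : dual_space U) : adj w = j (Q w).
  apply: adjoint_unique => z; apply/eqP; rewrite -subr_eq0; apply/eqP; move: z.
  apply: (dense_eq0 dj).
    move=> z; apply: cvgB; first exact: continuous_ip.
    exact: (@bop_comp_continuous _ _ _ _ w i z).
  move=> _ [_ [v _ <-] <-]; rewrite jip ij; last by exists v.
  by apply/eqP; rewrite subr_eq0 -jip ipC jip.
by rewrite !E jip.
Qed.

End adjoint.

Section parseval.
Variables (K : pred nat) (e : nat -> H).
Hypothesis he : orthonormal_basis ip K e.

Lemma orthonormal_sum_sqr (p : pred nat) n (c : nat -> R) : (forall k, p k -> K k) ->
  `|\sum_(k < n | p k) c k *: e k| ^+ 2 = \sum_(k < n | p k) c k ^+ 2.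
Proof.
move=> pK; rewrite hn ip_suml; apply: eq_bigr => k pk.
rewrite ipZl ipC ip_suml (bigD1 k)//= ipZl he.1 ?eqxx; [|exact: pK..].
rewrite big1 ?addr0 ?mulr1 ?expr2// => l /andP[pl lk].
by rewrite ipZl he.1; [|exact: pK..]; rewrite (negPf lk : (nat_of_ord l == k) = false) mulr0.
Qed.

Lemma bessel_sub h n (c : nat -> R) :
  `|h - \sum_(k < n | K k) c k *: e k| ^+ 2 =
  `|h| ^+ 2 - \sum_(k < n | K k) ip h (e k) ^+ 2 + \sum_(k < n | K k) (ip h (e k) - c k) ^+ 2.
Proof.
set s := \sum_(k < n | K k) c k *: e k.
have Es : `|s| ^+ 2 = \sum_(k < n | K k) c k ^+ 2 by exact: orthonormal_sum_sqr.
have E1 : ip h s = \sum_(k < n | K k) c k * ip h (e k).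
  by rewrite ipC ip_suml; apply: eq_bigr => k _; rewrite ipZl ipC.
have -> : \sum_(k < n | K k) (ip h (e k) - c k) ^+ 2 = \sum_(k < n | K k) ip h (e k) ^+ 2
    - \sum_(k < n | K k) c k * ip h (e k) - \sum_(k < n | K k) c k * ip h (e k)
    + \sum_(k < n | K k) c k ^+ 2.
  by rewrite -!sumrB -big_split /=; apply: eq_bigr => k _; ring.
by rewrite [LHS]hn ipBl !ipBr (ipC s h) -!hn Es E1; ring.
Qed.

(** By [bessel_sub] the Fourier coefficients give the best approximation in the span, so a finite
    combination close to h bounds the defect, and the partial sums increase. *)
Lemma parseval h : \sum_(k < n | K k) ip h (e k) ^+ 2 @[n --> \oo] --> `|h| ^+ 2.
Proof.
apply/cvgrPdist_le => /= eps eps0.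
pose d := Num.sqrt eps.
have d0 : 0 < d by rewrite sqrtr_gt0.
have oB : open (ball h d) by exact: ball_open.
have [x [xB [n [c xE]]]] := he.2 _ (ex_intro _ h (ballxx h d0)) oB.
have b := bessel_sub h n c.
have le_sum m : \sum_(k < m | K k) ip h (e k) ^+ 2 <= `|h| ^+ 2.
  have := bessel_sub h m (fun k => ip h (e k)).
  rewrite [X in _ = _ + X]big1 ?addr0; last by move=> k _; rewrite subrr expr0n.
  by have := sqr_ge0 `|h - \sum_(k < m | K k) ip h (e k) *: e k|; lra.
exists n => // m /= nm; rewrite ger0_norm ?subr_ge0 ?le_sum//.
have mono : \sum_(k < n | K k) ip h (e k) ^+ 2 <= \sum_(k < m | K k) ip h (e k) ^+ 2.
  rewrite -!(big_mkord K (fun k => ip h (e k) ^+ 2)) (big_cat_nat _ nm)//=.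
  by rewrite lerDl sumr_ge0// => k _; exact: sqr_ge0.
have hx : `|h - x| ^+ 2 <= eps.
  have {}xB : `|h - x| < d by move: (xB : ball h d x); rewrite -(@ball_normE R H).
  have <- : d ^+ 2 = eps by rewrite sqr_sqrtr// ltW.
  by rewrite ler_sqr ?nnegrE ?(ltW d0)// ltW.
rewrite xE b in hx.
have : 0 <= \sum_(k < n | K k) (ip h (e k) - c k) ^+ 2.
  by apply: sumr_ge0 => k _; exact: sqr_ge0.
lra.
Qed.

End parseval.

End hilbert_space.

(** * Operator norms and measurability of the dual integrand *)

Section operator_norm.
Context {R : realType}.
Implicit Types U V : normedModType R.

Lemma bop_bounded U V (f : 'L(U, V)) :
  exists2 M : R, 0 <= M & forall x, `|f x| <= M * `|x|.
Proof.
have cf : {for 0, continuous (bop f)} by exact: bop_continuous.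
have /linear_boundedP[M [Mr HM]] := continuous_linear_bounded 0 cf.
exists (`|M| + 1) => [|x]; first by rewrite addr_ge0.
by apply: HM; rewrite (le_lt_trans (ler_norm _))// ltrDl.
Qed.

Lemma opnorm_has_sup U V (f : 'L(U, V)) :
  has_sup [set `|f x| | x in [set x : U | `|x| <= 1]].
Proof.
have [M M0 HM] := bop_bounded f.
split; first by exists `|f 0|; exists 0 => //=; rewrite normr0.
exists M => _ [x /= x1 <-]; apply: (le_trans (HM x)).
by rewrite -[leRHS]mulr1 ler_wpM2l.
Qed.

Lemma opnorm_ge0 U V (f : 'L(U, V)) : 0 <= opnorm f.
Proof.
apply: (le_trans (normr_ge0 (f 0))).
by apply: (ub_le_sup (opnorm_has_sup f).2); exists 0 => //=; rewrite normr0.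
Qed.

Lemma le_opnorm U V (f : 'L(U, V)) x : `|f x| <= opnorm f * `|x|.
Proof.
have [->|x0] := eqVneq x 0; first by rewrite linear0 !normr0 mulr0.
have nx : 0 < `|x| by rewrite normr_gt0.
have : `|f (`|x|^-1 *: x)| <= opnorm f.
  apply: (ub_le_sup (opnorm_has_sup f).2); exists (`|x|^-1 *: x) => //=.
  by rewrite normrZ ger0_norm ?invr_ge0// mulVf// gt_eqF.
by rewrite linearZ normrZ ger0_norm ?invr_ge0// mulrC ler_pdivrMr.
Qed.

Lemma opnorm_le U V (f : 'L(U, V)) M :
  (forall x, `|x| <= 1 -> `|f x| <= M) -> opnorm f <= M.
Proof.
move=> HM; apply: ge_sup; first exact: (opnorm_has_sup f).1.
by move=> _ [x /= x1 <-]; exact: HM.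
Qed.

Lemma le_opnorm_sub U (f g : dual_space U) x :
  `|g x - f x| <= opnorm (g \- f : U -> R^o) * `|x|.
Proof.
have E : (bop_lincomb (-1) f g : U -> R^o) = g \- f.
  by apply/funext => z /=; rewrite scaleN1r addrC.
by have := le_opnorm (bop_lincomb (-1) f g) x; rewrite E.
Qed.

Lemma opnorm_dual_open U (c : R) :
  dual_open [set f : dual_space U | c < opnorm f].
Proof.
move=> f /= cf; exists (opnorm f - c); first by rewrite subr_gt0.
move=> g; rewrite ltrBrDr => gf; rewrite -(ltrD2l (opnorm (g \- f : U -> R^o))).
apply: (lt_le_trans gf); apply: opnorm_le => x x1.
have -> : f x = g x - (g x - f x) by rewrite opprB addrC subrK.
apply: (le_trans (ler_normB _ _)); rewrite addrC lerD//.
  apply: (le_trans (le_opnorm_sub f g x)); rewrite -[leRHS]mulr1 ler_wpM2l//.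
  have E : (bop_lincomb (-1) f g : U -> R^o) = g \- f.
    by apply/funext => z /=; rewrite scaleN1r addrC.
  by rewrite -E opnorm_ge0.
by apply: (le_trans (le_opnorm g x)); rewrite -[leRHS]mulr1 ler_wpM2l// opnorm_ge0.
Qed.

Lemma eval_dual_open U (x : U) (c : R) :
  dual_open [set f : dual_space U | c < f x :> R].
Proof.
move=> f /= cf; exists ((f x - c) / (`|x| + 1)).
  by rewrite divr_gt0 ?subr_gt0// ltr_wpDl.
move=> g; rewrite ltr_pdivlMr; last by rewrite ltr_wpDl.
have := le_opnorm_sub f g x.
have E : (bop_lincomb (-1) f g : U -> R^o) = g \- f.
  by apply/funext => z /=; rewrite scaleN1r addrC.
have := opnorm_ge0 (bop_lincomb (-1) f g); rewrite E mulrDr mulr1.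
set o := opnorm _; set y : R := g x; set z : R := f x => o0.
by rewrite ler_norml => /andP[h _] h2; lra.
Qed.

End operator_norm.

Section dual_measurable.
Context {R : realType} (U V : normedModType R) {d : measure_display}
  {Omega : measurableType d} (P : probability Omega R) (F : R -> set (set Omega)).
Variables (T : R) (Phi : R -> 'L(U, V)).
Hypothesis hPhi : M_space P F T (fun t _ => Phi t).

Lemma dual_fun_measurable (v : dual_space V) (h : dual_space U -> R) :
  (forall c : R, dual_open [set f | c < h f]) ->
  measurable_fun `[0, T] (fun s => h (dual_op (Phi s) v)).
Proof.
move=> oh; have [mE _ _] := hPhi v.
(* Measurability of Φ is given jointly in time and chance. A space of probability 1 is not empty, so
   a section at some [w] gives measurability in time. *)
have [w _] : (setT : set Omega) !=set0.
  apply/set0P/eqP => E0; have := @probability_setT _ _ _ P.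
  by rewrite E0 measure0 => /eqP; rewrite eq_sym onee_eq0.
move=> mT; apply: (measurability _ (RGenOInfty.measurableE R)) => //.
move=> _ [_ [c ->] <-].
have := mE _ (sub_gen_smallest (oh c)).
move=> /(@measurable_ysection _ _ _ _ _ w).
congr measurable; apply/seteqP; split => s.
  rewrite /ysection /= inE/= => -[[sT _] cs]; split => //=.
  by rewrite in_itv/= cs.
by move=> [/= sT]; rewrite in_itv/= andbT /ysection/= inE.
Qed.

Lemma measurable_dual_eval (v : dual_space V) (x : U) :
  measurable_fun `[0, T] (fun s => v (Phi s x) : R).
Proof. exact: (dual_fun_measurable v (fun c => @eval_dual_open _ U x c)). Qed.

Lemma measurable_dual_opnorm (v : dual_space V) :
  measurable_fun `[0, T] (fun s => opnorm (dual_op (Phi s) v)).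
Proof. exact: (dual_fun_measurable v (fun c => @opnorm_dual_open _ U c)). Qed.

Lemma dual_opnorm_sqr_fin (v : dual_space V) :
  (\int[lebesgue_measure]_(s in `[0%R, T])
     ((opnorm (dual_op (Phi s) v) ^+ 2)%R)%:E < +oo)%E.
Proof.
have [_ _] := hPhi v; congr (_ < _)%E; apply: eq_integral => s _.
exact: expectation_cst.
Qed.

End dual_measurable.

(** * Dyadic step functions as simple processes *)

Section dyadic_process.
Context {R : realType} {d : measure_display} {Omega : measurableType d}.
Variables (P : probability Omega R) (F : R -> set (set Omega)).
Hypothesis hF : filtration F.
Variable T : R.
Hypothesis T_gt0 : 0 < T.
Local Notation U := (uniform_prob T_gt0 : probability (measurableTypeR R) R).
Local Notation leb := (@lebesgue_measure R).

(** [dyadic_dense] gives coefficients that depend on the tolerance; coefficients within 1/(m + 1) of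
    optimal at each level m form a single sequence that works for all tolerances. *)
Lemma dense_steps (f : R -> R) : sqint U f ->
  exists c : nat -> nat -> R,
    msq U (fun r => dyadic_step T m (c m) r - f r) @[m --> \oo] --> (0 : R).
Proof.
move=> sf; pose E m := [set msq U (fun r => dyadic_step T m c r - f r) | c in @setT (nat -> R)].
have infE m : has_inf (E m).
  split; first by exists (msq U (fun r => dyadic_step T m (fun=> 0) r - f r)), (fun=> 0).
  by exists 0 => _ [c _ <-]; exact: msq_ge0.
have near_opt m : exists c, msq U (fun r => dyadic_step T m c r - f r) < inf (E m) + m.+1%:R^-1.
  have m0 : 0 < (m.+1%:R : R)^-1 by rewrite invr_gt0 ltr0n.
  by have [_ [c _ <-] ?] := inf_adherent m0 (infE m); exists c.
have /choice[c hc] := near_opt; exists c.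
apply/cvgrPdist_le => /= eps eps0; have e20 : 0 < eps / 2 by rewrite divr_gt0.
have [M HM] := dyadic_dense_sqint sf e20.
have [N _ HN] := (cvgrPdist_le _ _).1 (@cvg_harmonic R) _ e20.
exists (maxn M N) => // m /=; rewrite geq_max => /andP[Mm Nm].
rewrite sub0r normrN ger0_norm ?msq_ge0//.
have [c' hc'] := HM m Mm.
have := HN m Nm; rewrite /= sub0r normrN ger0_norm ?invr_ge0// => h1.
have h2 : inf (E m) <= eps / 2.
  by apply: le_trans hc'; apply: (ge_inf (infE m).2); exists c'.
rewrite (le_trans (ltW (hc m)))// [leRHS](splitr eps) lerD//.
Qed.

Section process.
Variables (m : nat) (c : nat -> R).

(** A simple process carries conditions at every index, so beyond the last cell the times stay at T
    and the values are 0. *)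
Let time i := dyadic T m (minn i (2 ^ m)).
Let value i (w : Omega) := c i *+ (i < 2 ^ m)%N.

Let time_itv i : 0 <= time i <= T.
Proof.
rewrite -[leLHS](@dyadic0 _ T m) -[X in _ <= X <= _]/(time i) /time.
by rewrite dyadic_le//= -[leRHS](@dyadic_max _ T m) dyadic_le// geq_minr.
Qed.

Let time_le i : time i <= time i.+1.
Proof. by apply: dyadic_le => //; rewrite leq_min !geq_min leqnSn leqnn/= orbT. Qed.

Let value_adapted i : measurable_wrt (F (time i)) (value i).
Proof. by apply: measurable_wrt_cst; have /andP[t0 _] := time_itv i; exact: (hF.1 _ t0).1. Qed.

Let value_bounded : exists M : R, forall i w, `|value i w| <= M.
Proof.
exists (\sum_(i < 2 ^ m) `|c i|) => i w; rewrite /value.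
case: ltnP => im; last by rewrite mulr0n normr0 sumr_ge0.
by rewrite mulr1n (bigD1 (Ordinal im))//= lerDl sumr_ge0.
Qed.

Definition dyadic_process : simple_process F T :=
  @SimpleProcess _ _ _ F T (2 ^ m) time value time_itv time_le value_adapted value_bounded.

Lemma dyadic_process_fun r w : sp_fun dyadic_process r w = dyadic_step T m c r.
Proof.
rewrite /sp_fun /dyadic_step; apply: eq_bigr => i _ /=.
by rewrite /time /value ltn_ord mulr1n (minn_idPl (ltnW (ltn_ord i))) (minn_idPl (ltn_ord i)).
Qed.

Lemma dyadic_process_int B w : sp_integral dyadic_process B w =
  \sum_(i < 2 ^ m) c i * (B (dyadic T m i.+1) w - B (dyadic T m i) w).
Proof.
rewrite /sp_integral; apply: eq_bigr => i _ /=.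
by rewrite /time /value ltn_ord mulr1n (minn_idPl (ltnW (ltn_ord i))) (minn_idPl (ltn_ord i)).
Qed.

Lemma dyadic_process_err (f : R -> R) : sqint U (f \_ `[0, T]) ->
  el_err P T (sp_list dyadic_process) f =
  (T * msq U (fun r => dyadic_step T m c r - (f \_ `[0, T]) r))%:E.
Proof.
move=> sf; set g := fun r => dyadic_step T m c r - (f \_ `[0, T]) r.
have sg : sqint U g by apply: sqintB => //; exact: step_sqint.
rewrite EFinM EFin_msq// -(uniform_integral T_gt0) /el_err; last 2 first.
- exact: (measurable_funX 2 sg.1).
- by move=> r; exact: sqr_ge0.
apply: eq_integral => r rT; rewrite sp_list_fun.
under eq_fun do rewrite dyadic_process_fun.
by rewrite /g patchE rT; exact: expectation_cst.
Qed.

End process.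

Lemma restrict_sqint (f : R -> R) : measurable_fun `[0, T] f ->
  (\int[leb]_(r in `[0%R, T]) (f r ^+ 2)%:E < +oo)%E ->
  sqint U (f \_ `[0, T]) /\
  (\int[leb]_(r in `[0%R, T]) (f r ^+ 2)%:E = (T * msq U (f \_ `[0, T]))%:E)%E.
Proof.
move=> mf fin.
have E : (\int[leb]_(r in `[0%R, T]) ((f \_ `[0, T]) r ^+ 2)%:E =
          \int[leb]_(r in `[0%R, T]) (f r ^+ 2)%:E)%E.
  by apply: eq_integral => r rT; rewrite patchE rT.
rewrite -E; apply: uniform_msq; last by rewrite E.
exact: (measurable_restrictT f (measurable_itv `[0, T])).1.
Qed.

End dyadic_process.

(** * The cylindrical Wiener process on a dyadic grid *)

Section cylindrical_wiener.
Context {R : realType} {d : measure_display} {Omega : measurableType d}.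
Variables (P : probability Omega R) (F : R -> set (set Omega)).
Hypothesis hF : filtration F.
Variables (U : normedModType R) (W : R -> dual_space U -> Omega -> R) (Q : dual_space U -> U).
Hypothesis hW : strongly_cylindrical_wiener P F W Q.
Implicit Types x y : dual_space U.

Lemma cylindrical_wiener_wrt t x : 0 <= t -> measurable_wrt (F t) (W t x).
Proof. by move=> t0; have [_ + _ _] := hW; apply. Qed.

Lemma cylindrical_wiener_measurable t x : 0 <= t -> measurable_fun setT (W t x).
Proof. by move=> t0; apply: (measurable_wrt_fun hF t0); exact: cylindrical_wiener_wrt. Qed.

(** The unknown variance of the one-dimensional Wiener process is that of W(1)x - W(0)x; as W(0)x
    vanishes almost surely, strong Gaussianity of W(1) identifies it. *)
Lemma cylindrical_wiener_scalar x : scalar_wiener P F (fun t => W t x) (x (Q x)).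
Proof.
have [_ _ /(_ 1%N (fun=> x))[_ /(_ ord0) W0 ind [C [_ C0 law]]] [EW _ covW]] := hW.
have aE (A : 'M[R]_1) : ((1 : 'rV[R]_1) *m A *m (1 : 'rV[R]_1)^T) 0 0 = A ord0 ord0.
  by rewrite mul1mx trmx1 mulmx1.
have c0 : 0 <= C ord0 ord0 by have := C0 1; rewrite aE.
have lawC s t : 0 <= s -> s <= t ->
    has_gaussian_law P (fun w => W t x w - W s x w) 0 ((t - s) * C ord0 ord0).
  move=> s0 st; have := law s t s0 st 1; rewrite aE mxE.
  congr has_gaussian_law; apply/funext => w.
  by rewrite big_ord1 mxE eqxx mul1r.
have m1 : measurable_fun setT (W 1 x) by exact: cylindrical_wiener_measurable.
have m0 : measurable_fun setT (W 0 x) by exact: cylindrical_wiener_measurable.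
have law1 : has_gaussian_law P (W 1 x) 0 (C ord0 ord0).
  have := lawC 0 1 (lexx 0) ler01; rewrite subr0 mul1r.
  apply: eq_has_gaussian_law => //; first exact: measurable_funB.
  by case: W0 => N [mN N0 HN]; exists N; split => // w /= h; apply: HN => /= h0; apply: h; rewrite h0 subr0.
have [s1 v1] := gaussian_sqint c0 m1 law1.
have CE : C ord0 ord0 = x (Q x).
  have : covariance P (W 1 x) (W 1 x) = (msq P (W 1 x))%:E.
    rewrite (EFin_msq s1) covariance.unlock EW unlock; apply: eq_integral => w _ /=.
    by rewrite -[LHS]/(((W 1 x w - 0) * (W 1 x w - 0))%:E) subr0 -expr2.
  by rewrite covW v1 => -[].
rewrite -CE; split => //; first by move=> t t0; exact: cylindrical_wiener_wrt.
move=> s t A D s0 st FA mD; apply: (ind s t s0 st) => //.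
by apply: sub_gen_smallest; exists ord0, D.
Qed.

Lemma cylindrical_wiener_lincomb t a x y : 0 <= t ->
  {ae P, forall w, W t (bop_lincomb a x y) w = a * W t x w + W t y w}.
Proof. by move=> t0; have [/(_ t t0)[_ +] _ _ _] := hW; apply. Qed.

(** The functional may change from one time step to the next. Each increment is independent of the
    past at its left end, where the preceding partial sum is already measurable; this is why
    measurability is carried through the induction. *)
Lemma gaussian_step_sum (x : nat -> dual_space U) (t : nat -> R) N :
  0 <= t 0%N -> (forall i, t i <= t i.+1) ->
  let Y w := \sum_(i < N) (W (t i.+1) (x i) w - W (t i) (x i) w) in
  measurable_wrt (F (t N)) Y /\
  has_gaussian_law P Y 0 (\sum_(i < N) (t i.+1 - t i) * x i (Q (x i))).
Proof.
move=> t0 tS; have tp i : 0 <= t i by elim: i => // i IH; apply: le_trans IH (tS i).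
elim: N => [|N [IHm IHg]] /=.
  split.
    under eq_fun do rewrite big_ord0.
    by apply: measurable_wrt_cst; exact: (hF.1 _ (tp 0%N)).1.
  (* The empty sum is the point mass at 0, the case of zero variance in [gaussian_law]. *)
  move=> A mA; rewrite big_ord0 /gaussian_law eqxx.
  rewrite (_ : _ @^-1` A = if 0 \in A then setT else set0).
    by rewrite diracE; case: ifP => ?; rewrite ?measure0//; exact: probability_setT.
  apply/seteqP; split => w /=; rewrite big_ord0.
    by move=> A0; rewrite mem_set.
  by case: ifPn => // /set_mem.
have [q0 _ ind g] := cylindrical_wiener_scalar (x N).
have mI : measurable_wrt (F (t N.+1)) (fun w => W (t N.+1) (x N) w - W (t N) (x N) w).
  apply: measurable_wrtB; first exact: (hF.1 _ (tp _)).1.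
    exact: cylindrical_wiener_wrt.
  by apply: (measurable_wrtS hF (tp N) (tS N)); exact: cylindrical_wiener_wrt.
split.
  under eq_fun do rewrite big_ord_recr /=.
  apply: measurable_wrtD => //; first exact: (hF.1 _ (tp _)).1.
  exact: (measurable_wrtS hF (tp N) (tS N)).
pose S w := \sum_(i < N) (W (t i.+1) (x i) w - W (t i) (x i) w).
pose I w := W (t N.+1) (x N) w - W (t N) (x N) w.
have -> : (fun w => \sum_(i < N.+1) (W (t i.+1) (x i) w - W (t i) (x i) w)) =
    (fun w => S w + I w).
  by apply/funext => w; rewrite big_ord_recr.
rewrite big_ord_recr /=; apply: (@gaussian_indepD _ _ _ P S I).
- by apply: sumr_ge0 => i _; rewrite mulr_ge0 ?subr_ge0//; have [] := cylindrical_wiener_scalar (x i).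
- by rewrite mulr_ge0 ?subr_ge0.
- exact: (measurable_wrt_fun hF (tp N) IHm).
- exact: (measurable_wrt_fun hF (tp N.+1) mI).
- by move=> A D mA mD; apply: ind => //; exact: IHm.
- exact: IHg.
- exact: g.
Qed.

Section combination.
Variables (H : completeNormedModType R) (ip : {dot H for idfun}) (iQ : 'L(H, U)).
Hypothesis hH : reproducing_kernel_space Q ip iQ.
Variables (K : pred nat) (e : nat -> H).
Hypothesis he : orthonormal_basis ip K e.
Variable u : nat -> dual_space U.
Hypothesis hu : forall k, K k -> hilbert_adjoint ip iQ (u k) = e k.
Variables (p : pred nat).
Hypothesis pK : forall k, p k -> K k.

Lemma cylindrical_wiener_basis k : K k -> scalar_wiener P F (fun t => W t (u k)) 1.
Proof.
move=> Kk; have <- : u k (Q (u k)) = 1 :> R.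
  have := covariance_adjoint hH.1 hH (u k) (u k).
  by rewrite (hu Kk) (he.1 _ _ Kk Kk) eqxx.
exact: cylindrical_wiener_scalar.
Qed.

(** The functional Σ c k u k over the indices k < n with p k; the zero functional is written as -u 0
    + u 0. *)
Fixpoint dual_comb (c : nat -> R) n : dual_space U :=
  if n is n'.+1 then
    if p n' then bop_lincomb (c n') (u n') (dual_comb c n') else dual_comb c n'
  else bop_lincomb (-1) (u 0%N) (u 0%N).

(** The adjoint sends the combination to Σ c k e k, whose squared norm follows from
    orthonormality. *)
Lemma dual_comb_cov c n : dual_comb c n (Q (dual_comb c n)) = \sum_(k < n | p k) c k ^+ 2.
Proof.
have := covariance_adjoint hH.1 hH (dual_comb c n) (dual_comb c n).
rewrite -hH.1 => ->; rewrite -(orthonormal_sum_sqr hH.1 he n c pK).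
congr (`|_| ^+ 2); elim: n => [|n IH] /=.
  by rewrite big_ord0 (adjoint_lincomb hH.1 hH) scaleN1r addNr.
rewrite [RHS]big_mkcond big_ord_recr /= -[X in _ = X + _]big_mkcond /= -IH.
case: ifP => pn; last by rewrite addr0.
by rewrite (adjoint_lincomb hH.1 hH) hu 1?addrC//; exact: pK.
Qed.

Lemma dual_comb_wiener c n t : 0 <= t ->
  {ae P, forall w, W t (dual_comb c n) w = \sum_(k < n | p k) c k * W t (u k) w}.
Proof.
move=> t0; elim: n => [|n IH] /=.
  apply: filterS (cylindrical_wiener_lincomb (-1) (u 0%N) (u 0%N) t0) => w ->.
  by rewrite big_ord0 mulN1r addNr.
have E w : \sum_(k < n.+1 | p k) c k * W t (u k) w =
    \sum_(k < n | p k) c k * W t (u k) w + if p n then c n * W t (u n) w else 0.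
  by rewrite big_mkcond big_ord_recr /= -big_mkcond.
case: ifP => pn; last by apply: filterS IH => w ->; rewrite E pn addr0.
have := cylindrical_wiener_lincomb (c n) (u n) (dual_comb c n) t0.
by apply: filterS2 IH => w h1 ->; rewrite E pn h1 addrC.
Qed.

(** Exchange the sums over basis indices k and grid cells i. On cell i the weighted increments of
    the W(u k) are almost surely the increment of W along the single functional [x i], and
    [gaussian_step_sum] applies. *)
Lemma gaussian_dyadic_sum (T : R) (T_gt0 : 0 < T) m (c : nat -> nat -> R) n :
  has_gaussian_law P
    (fun w => \sum_(k < n | p k) sp_integral (dyadic_process hF T_gt0 m (c k)) (fun s => W s (u k)) w)
    0 (\sum_(k < n | p k) \sum_(i < 2 ^ m) T / 2 ^+ m * c k i ^+ 2).
Proof.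
pose x i := dual_comb (fun k => c k i) n.
have t0 : 0 <= dyadic T m 0 by rewrite dyadic0.
have tS i : dyadic T m i <= dyadic T m i.+1 by rewrite dyadic_le.
have tp i : 0 <= dyadic T m i by rewrite -(@dyadic0 _ T m) dyadic_le.
have [mY gY] := gaussian_step_sum x (2 ^ m) t0 tS.
have vE : \sum_(i < 2 ^ m) (dyadic T m i.+1 - dyadic T m i) * x i (Q (x i)) =
    \sum_(k < n | p k) \sum_(i < 2 ^ m) T / 2 ^+ m * c k i ^+ 2.
  rewrite exchange_big /=; apply: eq_bigr => i _.
  by rewrite dyadicS addrAC subrr add0r /x dual_comb_cov mulr_sumr.
move: gY; rewrite vE; apply: eq_has_gaussian_law.
- exact: (measurable_wrt_fun hF (tp _) mY).
- rewrite (_ : (fun w => _) = (fun w => \sum_(k < n) if p k then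
      sp_integral (dyadic_process hF T_gt0 m (c k)) (fun s => W s (u k)) w else 0)); last first.
    by apply/funext => w; rewrite big_mkcond.
  apply: measurable_sum => k; case: (p k) => //.
  under eq_fun do rewrite dyadic_process_int.
  apply: measurable_sum => i; apply: measurable_funM => //.
  by apply: measurable_funB; exact: cylindrical_wiener_measurable.
- have ae_all : {ae P, forall w, forall i, W (dyadic T m i.+1) (x i) w - W (dyadic T m i) (x i) w =
      \sum_(k < n | p k) c k i * (W (dyadic T m i.+1) (u k) w - W (dyadic T m i) (u k) w)}.
    apply/ae_foralln => i.
    have a1 := dual_comb_wiener (fun k => c k i) n (tp i.+1).
    have := dual_comb_wiener (fun k => c k i) n (tp i).
    apply: filterS2 a1 => w h1 h2; rewrite /x h1 h2 -sumrB.
    by apply: eq_bigr => k _; rewrite mulrBr.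
  apply: filterS ae_all => w h; under eq_bigr do rewrite h.
  rewrite exchange_big /=; apply: eq_bigr => k _.
  by rewrite dyadic_process_int.
Qed.

End combination.
End cylindrical_wiener.

Lemma msq_cvg_sum (R : realType) d (T : measurableType d) (P : probability T R)
    (p : pred nat) n (X : nat -> nat -> T -> R) (Y : nat -> T -> R) :
  (forall k m, p k -> sqint P (X k m)) -> (forall k, p k -> sqint P (Y k)) ->
  (forall k, p k -> msq_cvg P (X k) (Y k)) ->
  msq_cvg P (fun m w => \sum_(k < n | p k) X k m w) (fun w => \sum_(k < n | p k) Y k w).
Proof.
move=> sX sY c; elim: n => [|n IH].
  rewrite /msq_cvg (_ : (fun m => _) = fun=> 0); first exact: cvg_cst.
  apply/funext => m; rewrite /msq; under eq_Rintegral do rewrite !big_ord0 subrr expr0n.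
  by rewrite Rintegral_cst// mul0r.
have E (G : nat -> R) : \sum_(k < n.+1 | p k) G k =
    (if p n then G n else 0) + \sum_(k < n | p k) G k.
  by rewrite big_mkcond big_ord_recr /= -big_mkcond addrC.
have EX m w : \sum_(k < n.+1 | p k) X k m w =
    (if p n then X n m w else 0) + \sum_(k < n | p k) X k m w by exact: (E (fun k => X k m w)).
have EY w : \sum_(k < n.+1 | p k) Y k w =
    (if p n then Y n w else 0) + \sum_(k < n | p k) Y k w by exact: (E (fun k => Y k w)).
pose D m := msq P (fun w => \sum_(k < n.+1 | p k) X k m w - \sum_(k < n.+1 | p k) Y k w).
rewrite /msq_cvg -/D; have [pn|pn] := boolP (p n).
  have -> : D = (fun m => msq P (fun w => (1 * X n m w + \sum_(k < n | p k) X k m w) -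
      (1 * Y n w + \sum_(k < n | p k) Y k w))).
    by apply/funext => m; congr msq; apply/funext => w; rewrite EX EY pn !mul1r.
  exact: (msq_cvg_lin 1 (fun m => sX n m pn) (fun m => sqint_sum n (fun k pk => sX k m pk))
    (sY n pn) (sqint_sum n (fun k pk => sY k pk)) (c n pn) IH).
have -> : D = (fun m => msq P (fun w => \sum_(k < n | p k) X k m w - \sum_(k < n | p k) Y k w)).
  by apply/funext => m; congr msq; apply/funext => w; rewrite EX EY (negPf pn) !add0r.
exact: IH.
Qed.

(** * Finite sums of Itô integrals are Gaussian *)

Section ito_sums.
Context {R : realType} {d : measure_display} {Omega : measurableType d}.
Variables (P : probability Omega R) (F : R -> set (set Omega)).
Hypothesis hF : filtration F.
Variables (U : normedModType R) (W : R -> dual_space U -> Omega -> R) (Q : dual_space U -> U).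
Hypothesis hW : strongly_cylindrical_wiener P F W Q.
Variables (H : completeNormedModType R) (ip : {dot H for idfun}) (iQ : 'L(H, U)).
Hypothesis hH : reproducing_kernel_space Q ip iQ.
Variables (K : pred nat) (e : nat -> H).
Hypothesis he : orthonormal_basis ip K e.
Variable u : nat -> dual_space U.
Hypothesis hu : forall k, K k -> hilbert_adjoint ip iQ (u k) = e k.
Variable T : R.
Hypothesis T_gt0 : 0 < T.
Local Notation unif := (uniform_prob T_gt0 : probability (measurableTypeR R) R).
Local Notation leb := (@lebesgue_measure R).

(** Both sides are the second moment of one step integral against W(u k): the left from its Gaussian
    law, the right from the isometry. *)
Lemma dyadic_variance m (c : nat -> R) k : K k ->
  \sum_(i < 2 ^ m) T / 2 ^+ m * c i ^+ 2 = T * msq unif (dyadic_step T m c).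
Proof.
move=> Kk; have pK l : (l == k) -> K l by move=> /eqP ->.
set S := dyadic_process hF T_gt0 m c.
have := gaussian_dyadic_sum hF hW hH he hu pK T_gt0 m (fun=> c) k.+1.
rewrite (big_pred1 ord_max)//.
have hB := cylindrical_wiener_basis hF hW hH he hu Kk.
have sS := sp_integral_sqint hF hB S.
have -> : (fun w => \sum_(l < k.+1 | l == k :> nat) sp_integral S (fun s => W s (u l)) w) =
    sp_integral S (fun s => W s (u k)).
  by apply/funext => w; rewrite (big_pred1 ord_max).
move=> g.
have v0 : 0 <= \sum_(i < 2 ^ m) T / 2 ^+ m * c i ^+ 2.
  by apply: sumr_ge0 => i _; rewrite mulr_ge0 ?sqr_ge0// divr_ge0// ltW.
have [_ <-] := gaussian_sqint v0 sS.1 g.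
have s0 : sqint unif ((fun=> 0) \_ `[0, T]).
  rewrite (_ : _ \_ _ = fun=> 0); first exact: sqint_cst.
  by apply/funext => r; rewrite patchE; case: ifP.
have := msq_el_int hF hB (sp_list_elementaries S).
rewrite sp_list_int mul1e dyadic_process_err// => -[->]; congr (_ * _).
by congr msq; apply/funext => r; rewrite patchE; case: ifP; rewrite subr0.
Qed.

Section one.
Variables (f : R -> R) (k : nat).
Hypothesis Kk : K k.
Hypothesis mf : measurable_fun `[0, T] f.
Hypothesis f_fin : (\int[leb]_(r in `[0%R, T]) (f r ^+ 2)%:E < +oo)%E.

Lemma dyadic_err_cvg c :
  msq unif (fun r => dyadic_step T m (c m) r - (f \_ `[0, T]) r) @[m --> \oo] --> (0 : R) ->
  el_err P T (sp_list (dyadic_process hF T_gt0 m (c m))) f @[m --> \oo] --> 0%E.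
Proof.
move=> hc; have [sf _] := restrict_sqint T_gt0 mf f_fin.
under eq_fun do rewrite dyadic_process_err//.
by apply: cvg_EFin; [exact: nearW|have := cvgM (cvg_cst T) hc; rewrite mulr0; exact].
Qed.

Lemma basis_ito_exists : exists Z, is_ito_integral P F T (fun r _ => f r) (fun s => W s (u k)) Z.
Proof.
have [sf _] := restrict_sqint T_gt0 mf f_fin.
have [c hc] := dense_steps sf.
have [Z [? _ _]] := is_ito_integral_exists hF (cylindrical_wiener_basis hF hW hH he hu Kk) mf (dyadic_err_cvg hc).
by exists Z.
Qed.

(** Any version of the integral is the limit along any converging dyadic approximation, by almost
    sure uniqueness, which is [is_ito_integral_lin] with a = 0. *)
Lemma basis_ito_dyadic Z c :
  is_ito_integral P F T (fun r _ => f r) (fun s => W s (u k)) Z ->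
  msq unif (fun r => dyadic_step T m (c m) r - (f \_ `[0, T]) r) @[m --> \oo] --> (0 : R) ->
  sqint P Z /\
  msq_cvg P (fun m => sp_integral (dyadic_process hF T_gt0 m (c m)) (fun s => W s (u k))) Z.
Proof.
move=> hZ hc; have hB := cylindrical_wiener_basis hF hW hH he hu Kk.
have [Z' [hZ' sZ' cZ']] := is_ito_integral_exists hF hB mf (dyadic_err_cvg hc).
have E r : `[0, T]%classic r -> f r = 0 * f r + f r by rewrite mul0r add0r.
have [_ _ sZ ZZ'] := is_ito_integral_lin hF hB mf mf mf E hZ' hZ' hZ.
pose S m := sp_integral (dyadic_process hF T_gt0 m (c m)) (fun s => W s (u k)).
have mS m : measurable_fun setT (S m) by exact: (sp_integral_sqint hF hB _).1.
split => //; rewrite /msq_cvg.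
have -> : (fun m => msq P (fun w => S m w - Z w)) = (fun m => msq P (fun w => S m w - Z' w)).
  apply/funext => m; apply: eq_msq.
  - by apply: measurable_funB => //; exact: sZ.1.
  - by apply: measurable_funB => //; exact: sZ'.1.
  - by apply: filterS ZZ' => w ->; rewrite mul0r add0r.
exact: cZ'.
Qed.

End one.

Variables (f : nat -> R -> R) (p : pred nat).
Hypothesis pK : forall k, p k -> K k.
Hypothesis mf : forall k, p k -> measurable_fun `[0, T] (f k).
Hypothesis f_fin : forall k, p k -> (\int[leb]_(r in `[0%R, T]) (f k r ^+ 2)%:E < +oo)%E.

(** At level m all integrands are replaced by steps on the same grid, where the whole sum is
    Gaussian; then m tends to infinity. The predicate [p] covers partial sums as well as blocks
    between two indices. *)
Lemma gaussian_ito_sum (Z : nat -> Omega -> R) n :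
  (forall k, p k -> is_ito_integral P F T (fun r _ => f k r) (fun s => W s (u k)) (Z k)) ->
  has_gaussian_law P (fun w => \sum_(k < n | p k) Z k w) 0
    (\sum_(k < n | p k) T * msq unif (f k \_ `[0, T])).
Proof.
move=> hZ.
have sf k (pk : p k) := (restrict_sqint T_gt0 (mf pk) (f_fin pk)).1.
have /choice[c hc] : forall k, exists c, p k ->
    msq unif (fun r => dyadic_step T m (c m) r - (f k \_ `[0, T]) r) @[m --> \oo] --> (0 : R).
  move=> k; case: (boolP (p k)) => [pk|_]; last by exists (fun _ _ => 0).
  by have [c hc] := dense_steps (sf k pk); exists c.
have cZ k (pk : p k) := basis_ito_dyadic (pK pk) (mf pk) (f_fin pk) (hZ k pk) (hc k pk).
pose S k m := sp_integral (dyadic_process hF T_gt0 m (c k m)) (fun s => W s (u k)).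
have sS k m : p k -> sqint P (S k m).
  by move=> pk; apply: (sp_integral_sqint hF (cylindrical_wiener_basis hF hW hH he hu (pK pk))).
apply: (@gaussian_msq_limit _ _ _ P (fun m w => \sum_(k < n | p k) S k m w) _
  (fun m => \sum_(k < n | p k) T * msq unif (dyadic_step T m (c k m)))).
- by move=> m; exact: (sqint_sum n (fun k pk => sS k m pk)).
- exact: (sqint_sum n (fun k pk => (cZ k pk).1)).
- by apply: msq_cvg_sum => // k pk; [exact: (cZ k pk).1|exact: (cZ k pk).2].
- by move=> m; apply: sumr_ge0 => k _; rewrite mulr_ge0 ?msq_ge0// ltW.
- move=> m; have := gaussian_dyadic_sum hF hW hH he hu pK T_gt0 m (c^~ m) n.
  by congr has_gaussian_law; apply: eq_bigr => k pk; rewrite (dyadic_variance _ _ (pK pk)).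
- apply: (@cvg_big R _ +%R 0); first exact: add_continuous.
  move=> k pk.
  have := @msq_cvg_msq _ _ _ unif _ _ (fun m => @step_sqint _ T T_gt0 m (c k m)) (sf k pk) (hc k pk).
  move=> h; exact: cvgM (cvg_cst T) h.
Qed.

End ito_sums.

(** * Law and linearity of the cylindrical integral *)

Section cylindrical_integral_law.
Context {R : realType} {d : measure_display} {Omega : measurableType d}.
Variables (P : probability Omega R) (F : R -> set (set Omega)).
Hypothesis hF : filtration F.
Variables (U : normedModType R) (W : R -> dual_space U -> Omega -> R) (Q : dual_space U -> U).
Hypothesis hW : strongly_cylindrical_wiener P F W Q.
Variables (H : completeNormedModType R) (ip : {dot H for idfun}) (iQ : 'L(H, U)).
Hypothesis hH : reproducing_kernel_space Q ip iQ.
Variables (K : pred nat) (e : nat -> H).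
Hypothesis he : orthonormal_basis ip K e.
Variable u : nat -> dual_space U.
Hypothesis hu : forall k, K k -> hilbert_adjoint ip iQ (u k) = e k.
Variable T : R.
Hypothesis T_gt0 : 0 < T.
Local Notation unif := (uniform_prob T_gt0 : probability (measurableTypeR R) R).
Local Notation leb := (@lebesgue_measure R).
Variables (V : normedModType R) (Phi : R -> 'L(U, V)).
Hypothesis hPhi : M_space P F T (fun t _ => Phi t).
Implicit Types v w : dual_space V.

Local Notation adj s v := (hilbert_adjoint ip iQ (dual_op (Phi s) v)).

Let f v k s : R := v (Phi s (iQ (e k))).

Definition energy v : R := fine (\int[leb]_(s in `[0%R, T]) ((`|adj s v| ^+ 2)%R)%:E)%E.

Let f_ip v k s : f v k s = ip (adj s v) (e k).
Proof. by rewrite (adjointP hH.1 hH). Qed.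

Let mf v k : measurable_fun `[0, T] (f v k).
Proof. exact: measurable_dual_eval hPhi v (iQ (e k)). Qed.

Let f_parseval v s : \sum_(k < n | K k) f v k s ^+ 2 @[n --> \oo] --> `|adj s v| ^+ 2.
Proof.
rewrite (_ : (fun n => _) = fun n => \sum_(k < n | K k) ip (adj s v) (e k) ^+ 2).
  exact: (@parseval _ _ _ hH.1 _ _ he).
by apply/funext => n; apply: eq_bigr => k _; rewrite f_ip.
Qed.

Let sum_mkcond n (G : nat -> R) :
  \sum_(k < n | K k) G k = \sum_(k <- iota 0 n) if K k then G k else 0.
Proof. by rewrite -(big_mkord K) big_mkcond /index_iota subn0. Qed.

Let msum v n : measurable_fun `[0, T] (fun s => \sum_(k < n | K k) f v k s ^+ 2).
Proof.
rewrite (_ : (fun s => _) = (fun s => \sum_(k <- iota 0 n) if K k then f v k s ^+ 2 else 0)).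
2: by apply/funext => s; exact: (sum_mkcond n (fun k => f v k s ^+ 2)).
apply: measurable_sum => k; case: (K k) => //; exact: (measurable_funX 2 (mf v k)).
Qed.

(** Parseval's identity writes the squared norm as a limit of finite sums of squares of measurable
    real functions. *)
Lemma measurable_adjoint_sqr v : measurable_fun `[0, T] (fun s => `|adj s v| ^+ 2).
Proof.
apply: (@measurable_fun_cvg _ _ _ _ (fun n s => \sum_(k < n | K k) f v k s ^+ 2)) => //.
Qed.

Lemma adjoint_bound : exists2 M : R, 0 <= M &
  forall s v, `|adj s v| <= M * opnorm (dual_op (Phi s) v).
Proof.
have [M M0 HM] := bop_bounded iQ; exists M => // s v.
have [->|h0] := eqVneq (adj s v) 0; first by rewrite normr0 mulr_ge0 ?opnorm_ge0.
rewrite -(ler_pM2r (_ : 0 < `|adj s v|)) ?normr_gt0// -expr2 hH.1 (adjointP hH.1 hH).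
apply: le_trans (ler_norm _) _; apply: le_trans (le_opnorm _ _) _.
by rewrite -mulrA mulrCA ler_wpM2l ?opnorm_ge0.
Qed.

Let opnorm_scaled_fin v (M : R) : 0 <= M ->
  (\int[leb]_(s in `[0%R, T]) ((M * opnorm (dual_op (Phi s) v) ^+ 2)%R)%:E < +oo)%E.
Proof.
move=> M0; have mo : measurable_fun `[0, T] (fun s => ((opnorm (dual_op (Phi s) v) ^+ 2)%:E)).
  by apply/measurable_EFinP; apply: measurable_funX; exact: measurable_dual_opnorm hPhi v.
under eq_integral do rewrite EFinM.
rewrite ge0_integralZl_EFin//; first by apply: lte_mul_pinfty; rewrite ?lee_fin//; exact: dual_opnorm_sqr_fin hPhi v.
by move=> s _; rewrite lee_fin sqr_ge0.
Qed.

Lemma energy_integral v :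
  (\int[leb]_(s in `[0%R, T]) ((`|adj s v| ^+ 2)%R)%:E = (energy v)%:E)%E.
Proof.
rewrite fineK// ge0_fin_numE; last by apply: integral_ge0 => s _; rewrite lee_fin sqr_ge0.
have [M M0 HM] := adjoint_bound.
apply: le_lt_trans (opnorm_scaled_fin v (sqr_ge0 M)).
apply: ge0_le_integral => //.
- by apply/measurable_EFinP; exact: measurable_adjoint_sqr.
- apply/measurable_EFinP; apply: measurable_funM => //.
  by apply: measurable_funX; exact: measurable_dual_opnorm hPhi v.
- move=> s _; rewrite lee_fin -exprMn ler_sqr ?nnegrE ?mulr_ge0 ?opnorm_ge0//.
Qed.

Lemma energy_ge0 v : 0 <= energy v.
Proof. by apply: fine_ge0; apply: integral_ge0 => s _; rewrite lee_fin sqr_ge0. Qed.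

Let f_fin v k : (\int[leb]_(s in `[0%R, T]) (f v k s ^+ 2)%:E < +oo)%E.
Proof.
apply: le_lt_trans (opnorm_scaled_fin v (sqr_ge0 `|iQ (e k)|)).
apply: ge0_le_integral => //.
- by move=> s _; rewrite lee_fin sqr_ge0.
- by apply/measurable_EFinP; exact: (measurable_funX 2 (mf v k)).
- apply/measurable_EFinP; apply: measurable_funM => //.
  by apply: measurable_funX; exact: measurable_dual_opnorm hPhi v.
- move=> s _; rewrite lee_fin -exprMn -[leLHS]real_normK ?num_real//.
  rewrite ler_sqr ?nnegrE ?mulr_ge0 ?opnorm_ge0// mulrC.
  exact: le_opnorm (dual_op (Phi s) v) (iQ (e k)).
Qed.

Let J v k := T * msq unif (f v k \_ `[0, T]).

Let JE v k : (\int[leb]_(s in `[0%R, T]) (f v k s ^+ 2)%:E)%E = (J v k)%:E.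
Proof. exact: (restrict_sqint T_gt0 (mf v k) (f_fin v k)).2. Qed.

Let J_ge0 v k : 0 <= J v k.
Proof. by rewrite mulr_ge0 ?msq_ge0// ltW. Qed.

Let J_sum v n : (\sum_(k < n | K k) J v k)%:E =
  (\int[leb]_(s in `[0%R, T]) ((\sum_(k < n | K k) f v k s ^+ 2)%R)%:E)%E.
Proof.
rewrite (sum_mkcond n (J v)).
under eq_integral do rewrite (sum_mkcond n (fun k => f v k _ ^+ 2)) -sumEFin.
rewrite ge0_integral_sum//.
- rewrite -sumEFin; apply: eq_bigr => k _; case: (K k); first by rewrite JE.
  by rewrite integral0.
- by move=> k; apply/measurable_EFinP; case: (K k) => //; exact: (measurable_funX 2 (mf v k)).
- by move=> k s _; case: (K k) => //; rewrite lee_fin sqr_ge0.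
Qed.

(** Monotone convergence applied to Parseval's identity at each time. *)
Lemma energy_sum v : \sum_(k < n | K k) J v k @[n --> \oo] --> energy v.
Proof.
have mono s : {homo (fun n => (\sum_(k < n | K k) f v k s ^+ 2)%:E) : n m / (n <= m)%N >-> (n <= m)%E}.
  move=> n m nm; rewrite lee_fin -!(big_mkord K (fun k => f v k s ^+ 2)).
  by rewrite [leRHS](big_cat_nat _ nm)//= lerDl sumr_ge0// => k _; exact: sqr_ge0.
have := @cvg_monotone_convergence _ _ _ leb `[0, T] (measurable_itv _)
  (fun n s => (\sum_(k < n | K k) f v k s ^+ 2)%:E).
move=> /(_ _ _ (fun s _ => mono s)) h.
have {}h : (\sum_(k < n | K k) J v k)%:E @[n --> \oo] --> (energy v)%:E.
  rewrite -energy_integral; under eq_fun do rewrite J_sum.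
  rewrite (_ : (\int[leb]_(s in `[0%R, T]) _)%E = (\int[leb]_(s in `[0%R, T]) limn (fun n => (\sum_(k < n | K k) f v k s ^+ 2)%:E))%E).
    apply: h => [n|n s _]; first by apply/measurable_EFinP; exact: msum.
    by rewrite lee_fin sumr_ge0// => k _; exact: sqr_ge0.
  apply: eq_integral => s _; apply/esym/cvg_lim => //.
  by apply: cvg_EFin; [exact: nearW|exact: f_parseval].
exact: (fine_cvg h).
Qed.

Let Z v k : Omega -> R :=
  ito_integral P F T (fun s _ => v (Phi s (iQ (e k)))) (fun s => W s (u k)).

Let Z_ito v k : K k ->
  is_ito_integral P F T (fun s _ => f v k s) (fun s => W s (u k)) (Z v k).
Proof.
move=> Kk; suff : [set X | is_ito_integral P F T (fun s _ => f v k s) (fun s => W s (u k)) X] (Z v k) by [].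
apply: xgetPex.
exact: (basis_ito_exists hF hW hH he hu T_gt0 Kk (mf v k) (f_fin v k)).
Qed.

Let Y v n (w : Omega) : R := \sum_(k < n | K k) Z v k w.

Let Z_law v (p : pred nat) n : (forall k, p k -> K k) ->
  has_gaussian_law P (fun o => \sum_(k < n | p k) Z v k o) 0 (\sum_(k < n | p k) J v k).
Proof.
move=> pK; apply: (gaussian_ito_sum hF hW hH he hu T_gt0 pK).
- by move=> k _; exact: mf.
- by move=> k _; exact: f_fin.
- by move=> k pk; exact: (Z_ito v (pK k pk)).
Qed.

Let Z_sqint v k : K k -> sqint P (Z v k).
Proof.
move=> Kk; have E r : `[0, T]%classic r -> f v k r = 0 * f v k r + f v k r by rewrite mul0r add0r.
have z := Z_ito v Kk.
by have [] := is_ito_integral_lin hF (cylindrical_wiener_basis hF hW hH he hu Kk)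
  (mf v k) (mf v k) (mf v k) E z z z.
Qed.

Let Y_sqint v n : sqint P (Y v n).
Proof. by apply: (@sqint_sum _ _ _ P n (Z v) K) => k Kk; exact: Z_sqint. Qed.

(** The block of terms with n <= k < m is itself a Gaussian sum of Itô integrals, so its second
    moment is read off its law. *)
Let Y_dist v n m : (n <= m)%N ->
  msq P (fun o => Y v m o - Y v n o) = \sum_(k < m | K k) J v k - \sum_(k < n | K k) J v k.
Proof.
move=> nm; pose p k := K k && (n <= k)%N.
have split_sum (G : nat -> R) :
    \sum_(k < m | K k) G k = \sum_(k < n | K k) G k + \sum_(k < m | p k) G k.
  rewrite -(big_mkord K G) (big_cat_nat _ nm)//= big_mkord; congr (_ + _).
  rewrite -(big_mkord p G) [RHS](big_cat_nat _ nm)//= [X in _ = X + _]big1_seq ?add0r//; last first.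
    move=> k; rewrite mem_index_iota /p => /andP[/andP[_ nk] /andP[_ kn]].
    by move: kn; rewrite ltnNge nk.
  rewrite [LHS]big_nat_cond [RHS]big_nat_cond; apply: eq_bigl => k; rewrite /p.
  by case: (n <= k)%N; rewrite ?andbF ?andbT.
have pK k : p k -> K k by case/andP.
have v0 : 0 <= \sum_(k < m | p k) J v k by apply: sumr_ge0.
have sp : sqint P (fun o => \sum_(k < m | p k) Z v k o).
  by apply: (@sqint_sum _ _ _ P m (Z v) p) => k pk; apply: Z_sqint; exact: pK.
have [_ pE] := gaussian_sqint v0 sp.1 (Z_law v m pK).
rewrite split_sum addrAC subrr add0r -pE; congr msq; apply/funext => o.
by rewrite /Y (split_sum (Z v ^~ o)) addrAC subrr add0r.
Qed.

Let X v : Omega -> R := cylindrical_integral P F W iQ K e u (fun t _ => Phi t) T v.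

(** The series of variances converges, so the partial sums are Cauchy in mean square; hence the
    value chosen by [cylindrical_integral] is a genuine limit and not the default 0. *)
Lemma cylindrical_integral_limit v : sqint P (X v) /\ msq_cvg P (Y v) (X v).
Proof.
have [X0 sX0 cX0] : exists2 X0, sqint P X0 & msq_cvg P (Y v) X0.
  apply: msq_complete => // eps eps0.
  have e2 : 0 < eps / 2 by rewrite divr_gt0.
  have [N _ HN] := (cvgrPdist_le _ _).1 (@energy_sum v) _ e2.
  have le_dist n m : (N <= n)%N -> (n <= m)%N -> msq P (fun o => Y v m o - Y v n o) <= eps.
    move=> Nn nm; rewrite Y_dist//.
    have := HN n Nn; have := HN m (leq_trans Nn nm); rewrite /= !ler_norml => /andP[h1 h2] /andP[h3 h4].
    by lra.
  exists N => n m Nn Nm; have [nm|/ltnW mn] := leqP n m; last exact: le_dist.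
  by rewrite msqBC; exact: le_dist.
have : [set X1 | measurable_fun setT X1 /\ cvg_L2 P (Y v) X1] (X v).
  by apply: xgetPex; exists X0; split; [exact: sX0.1|apply/(cvg_L2P (Y_sqint v) sX0.1).2].
by move=> [mX /(cvg_L2P (Y_sqint v) mX).1].
Qed.

Lemma cylindrical_integral_law v : has_gaussian_law P (X v) 0 (energy v).
Proof.
have [sX cX] := cylindrical_integral_limit v.
apply: (gaussian_msq_limit (Y_sqint v) sX cX _ _ (@energy_sum v)).
- by move=> n; exact: sumr_ge0.
- by move=> n; exact: Z_law.
Qed.

(** Each Itô term is linear off a null set, and the countably many null sets are discarded together
    before passing to the limit. *)
Lemma cylindrical_integral_lincomb a v w :
  {ae P, forall o, X (bop_lincomb a v w) o = a * X v o + X w o}.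
Proof.
have [sv cv] := cylindrical_integral_limit v.
have [sw cw] := cylindrical_integral_limit w.
have [sx cx] := cylindrical_integral_limit (bop_lincomb a v w).
have ae_Z : {ae P, forall o, forall k, K k -> Z (bop_lincomb a v w) k o = a * Z v k o + Z w k o}.
  apply/ae_foralln => k; case: (boolP (K k)) => [Kk|_]; last by apply: aeW.
  have E r : `[0, T]%classic r -> f (bop_lincomb a v w) k r = a * f v k r + f w k r by [].
  have [_ _ _] := is_ito_integral_lin hF (cylindrical_wiener_basis hF hW hH he hu Kk)
    (mf v k) (mf w k) (mf (bop_lincomb a v w) k) E (Z_ito v Kk) (Z_ito w Kk) (Z_ito _ Kk).
  by apply: filterS => o h _.
have s n : sqint P (fun o => a * Y v n o + Y w n o) by apply: sqintD => //; exact: sqintZ.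
have sl : sqint P (fun o => a * X v o + X w o) by apply: sqintD => //; exact: sqintZ.
apply: (msq_cvg_ae (Y_sqint (bop_lincomb a v w)) sx sl cx).
have := msq_cvg_lin a (Y_sqint v) (Y_sqint w) sv sw cv cw.
rewrite /msq_cvg; set D := fun n => _; set D' := fun n => _; suff -> : D = D' by [].
apply/funext => n; apply: eq_msq.
- by apply: measurable_funB; [exact: (s n).1|exact: sl.1].
- by apply: measurable_funB; [exact: (Y_sqint _ n).1|exact: sl.1].
apply: filterS ae_Z => o h; congr (_ - _).
rewrite /Y mulr_sumr -big_split /=; apply: eq_bigr => k Kk.
by rewrite h.
Qed.

End cylindrical_integral_law.

(** * Hahn-Banach and countable norming families *)

Section hahn_banach.
Context {R : realType} (V : normedModType R).
Implicit Types (x y : V) (a b c t : R) (G : set (V * R)).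

(** A partial linear functional is encoded by its graph, a linear subset of V × R; domination by the
    norm forces the graph to be single-valued. *)
Let lin_graph G := forall x y a b k, G (x, a) -> G (y, b) -> G (k *: x + y, k * a + b).

Let dominated G := forall x a, G (x, a) -> a <= `|x|.

Let graph0 G x a : lin_graph G -> G (x, a) -> G (0, 0).
Proof. by move=> lG Gx; have := lG _ _ _ _ (-1) Gx Gx; rewrite scaleN1r addNr mulN1r addNr. Qed.

Let graphZ G x a k : lin_graph G -> G (x, a) -> G (k *: x, k * a).
Proof.
move=> lG Gx; have := lG _ _ _ _ k Gx (graph0 lG Gx).
by rewrite !addr0.
Qed.

Let graphD G x y a b : lin_graph G -> G (x, a) -> G (y, b) -> G (x + y, a + b).
Proof. by move=> lG Gx Gy; have := lG _ _ _ _ 1 Gx Gy; rewrite scale1r mul1r. Qed.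

Let graph_unique G x a b : lin_graph G -> dominated G -> G (x, a) -> G (x, b) -> a = b.
Proof.
move=> lG dG Ga Gb.
have le c c' : G (x, c) -> G (x, c') -> c <= c'.
  move=> Gc Gc'; have := lG _ _ _ _ (-1) Gc' Gc.
  by rewrite scaleN1r addNr mulN1r => /dG; rewrite normr0; lra.
by apply/eqP; rewrite eq_le !le.
Qed.

Let extension G y c : set (V * R) :=
  [set q | exists x a t, [/\ G (x, a), q.1 = x + t *: y & q.2 = a + t * c]].

Let lin_extension G y c : lin_graph G -> lin_graph (extension G y c).
Proof.
move=> lG _ _ _ _ k [x [a [t [Gx /= -> ->]]]] [x' [a' [t' [Gx' /= -> ->]]]].
exists (k *: x + x'), (k * a + a'), (k * t + t'); split; first exact: lG.
  by rewrite /= scalerDr scalerDl scalerA addrACA.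
by rewrite /=; ring.
Qed.

(** The value [c] at the new vector y is the supremum of a - |x - y| over the graph. It is at most
    every |x' + y| - a', because a + a' <= |x + x'| <= |x - y| + |x' + y|; these two bounds,
    rescaled by t, are the domination for negative and positive t. *)
Let dominated_extension G y x0 a0 : lin_graph G -> dominated G -> G (x0, a0) ->
  exists c, dominated (extension G y c).
Proof.
move=> lG dG G0; pose E := [set r | exists x a, G (x, a) /\ r = a - `|x - y|].
have ubE x a : G (x, a) -> ubound E (`|x + y| - a).
  move=> Gx _ [x' [a' [Gx' ->]]].
  have h1 := dG _ _ (graphD lG Gx Gx').
  have h2 : `|x + x'| <= `|x + y| + `|x' - y|.
    by rewrite (_ : x + x' = (x + y) + (x' - y)) ?ler_normD// addrACA subrr addr0.
  by lra.
have supE : has_sup E.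
  by split; [exists (a0 - `|x0 - y|), x0, a0|exists (`|x0 + y| - a0); exact: ubE].
pose c := sup E.
have c_le x a : G (x, a) -> c <= `|x + y| - a.
  by move=> Gx; apply: ge_sup; [exact: supE.1|exact: ubE].
have le_c x a : G (x, a) -> a - `|x - y| <= c.
  by move=> Gx; apply: ub_le_sup; [exact: supE.2|exists x, a].
exists c => _ _ [x [a [t [Gx /= -> ->]]]].
have [t0|t0|->] := ltgtP t 0; last by rewrite mul0r scale0r !addr0; exact: dG.
- have s0 : 0 < - t by lra.
  have := le_c _ _ (graphZ (- t)^-1 lG Gx).
  have -> : x + t *: y = (- t) *: ((- t)^-1 *: x - y).
    by rewrite scalerBr scalerA mulfV ?gt_eqF// scale1r scaleNr opprK.
  rewrite normrZ gtr0_norm// -(ler_pM2l s0) mulrBr mulrA mulfV ?gt_eqF// mul1r.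
  by rewrite mulNr; lra.
- have := c_le _ _ (graphZ t^-1 lG Gx).
  have -> : x + t *: y = t *: (t^-1 *: x + y).
    by rewrite scalerDr scalerA mulfV ?gt_eqF// scale1r.
  rewrite normrZ gtr0_norm// -(ler_pM2l t0) mulrBr mulrA mulfV ?gt_eqF// mul1r.
  by lra.
Qed.

Lemma norming_functional x0 : exists2 w : dual_space V,
  forall y, `|w y : R| <= `|y| & w x0 = `|x0|.
Proof.
(* The last clause is conditional because Zorn's lemma also tests the empty chain, whose union is
   empty. Maximality against the line through x0 shows afterwards that the maximal graph is not
   empty. *)
pose good G := [/\ lin_graph G, dominated G & G !=set0 -> G (x0, `|x0|)].
have [|A [[lA dA A0] maxA]] := @Zorn_bigcup _ good.
  move=> C Cg tC; split.
  - move=> x y a b k [G CG Gx] [G' CG' Gy].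
    have [GG'|GG'] := tC _ _ CG CG'.
      by exists G' => //; have [lG _ _] := Cg _ CG'; apply: lG => //; exact: GG'.
    by exists G => //; have [lG _ _] := Cg _ CG; apply: lG => //; exact: GG'.
  - by move=> x a [G CG Gx]; have [_ dG _] := Cg _ CG; exact: dG.
  - move=> [q [G CG Gq]]; exists G => //; have [_ _] := Cg _ CG; apply; by exists q.
pose L := [set q : V * R | exists t, q = (t *: x0, t * `|x0|)].
have goodL : good L.
  split.
  - move=> x y a b k [t [-> ->]] [t' [-> ->]]; exists (k * t + t').
    by rewrite scalerA -scalerDl; congr pair; ring.
  - by move=> x a [t [-> ->]]; rewrite normrZ ler_wpM2r// ler_norm.
  - by move=> _; exists 1; rewrite scale1r mul1r.
have An : A !=set0.
  apply/set0P/eqP => A_0; apply: (maxA L) => //; rewrite A_0; split.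
    by move=> ?.
  by move/(_ (x0, `|x0|)); apply; exists 1; rewrite scale1r mul1r.
have {}A0 := A0 An.
have tot y : exists a, A (y, a).
  apply: contrapT => yA; have [c dc] := dominated_extension y lA dA A0.
  have AE : A `<=` extension A y c.
    by move=> [x a] Ax; exists x, a, 0; rewrite scale0r mul0r !addr0.
  apply: (maxA (extension A y c)).
    split => // EA; apply: yA; exists c; apply: EA.
    exists 0, 0, 1; rewrite scale1r mul1r !add0r; split => //; exact: graph0 A0.
  by split => //; [exact: lin_extension|move=> _; exact: AE].
have /choice[w Aw] := tot.
have lin : linear (w : V -> R^o).
  by move=> k x y; apply: (graph_unique lA dA (Aw _)); exact: lA.
pose wl := HB.pack_for {linear V -> R^o} w (GRing.isLinear.Build R V R^o *:%R w lin).
have wb y : `|w y| <= `|y|.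
  rewrite ler_norml dA// andbT.
  have := dA _ _ (graphZ (-1) lA (Aw y)); rewrite scaleN1r normrN; lra.
have wc : continuous wl.
  apply: bounded_linear_continuous; apply/linear_boundedP.
  exists 1; split => // r r1 x; apply: (le_trans (wb x)).
  by rewrite ler_peMl// ltW.
exists (BoundedOp wc); first exact: wb.
exact: (graph_unique lA dA (Aw x0) A0).
Qed.

Lemma dense_sequence : separable_space V -> exists x : nat -> V,
  forall y e, 0 < e -> exists j, `|y - x j| < e.
Proof.
move=> [D /countable_injP[f fI] dD].
exists (fun n => xget 0 [set z | D z /\ f z = n]) => y eps e0.
have oB : open (ball y eps) by exact: ball_open.
have [z [zB Dz]] := dD _ (ex_intro _ y (ballxx y e0)) oB.
exists (f z); set z' := xget _ _.
have [Dz' fz'] : [set z0 | D z0 /\ f z0 = f z] z' by apply: xgetPex; exists z.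
have -> : z' = z by apply: fI; rewrite ?inE.
by move: (zB : ball y eps z); rewrite -(@ball_normE R V).
Qed.

(** Let w_j norm the point x_j of a dense sequence. Then |y| <= |y - x_j| + w_j(x_j) <= 2|y - x_j| +
    |w_j(y)|, and x_j can be taken arbitrarily close to y. *)
Lemma norming_sequence : separable_space V -> exists x : nat -> V, exists w : nat -> dual_space V,
  [/\ forall y e, 0 < e -> exists j, `|y - x j| < e,
      forall j y, `|w j y : R| <= `|y| &
      forall y r, (forall j, `|w j y : R| <= r) -> `|y| <= r].
Proof.
move=> /dense_sequence[x dx].
have /choice[w hw] : forall j, exists w : dual_space V,
    (forall y, `|w y : R| <= `|y|) /\ w (x j) = `|x j|.
  by move=> j; have [w] := norming_functional (x j); exists w.
exists x, w; split => //; first by move=> j; exact: (hw j).1.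
move=> y r hr; apply/ler_addgt0Pr => eps eps0.
have e20 : 0 < eps / 2 by rewrite divr_gt0.
have [j hj] := dx y _ e20.
have h1 : `|y| <= `|y - x j| + `|x j| by rewrite -{1}(subrK (x j) y) ler_normD.
have h2 : `|x j| = (w j y : R) - (w j (y - x j) : R).
  by rewrite linearB opprB addrC subrK (hw j).2.
have h3 : `|w j (y - x j) : R| <= `|y - x j| := (hw j).1 _.
have := hr j; rewrite ler_norml => /andP[_ h4].
move: h3; rewrite ler_norml => /andP[h5 _].
by lra.
Qed.

End hahn_banach.

(** * Weak integrals of V-valued variables *)

Lemma Rintegral_mul_le (R : realType) d (T : measurableType d) (P : probability T R)
    (X Y : T -> R) (eta : R) : 0 < eta -> sqint P X -> sqint P Y ->
  `|\int[P]_o (X o * Y o)| <= msq P X / eta + eta * msq P Y.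
Proof.
move=> eta0 sX sY; have iXY := sqint_mul sX sY; have [_ iX] := sX; have [_ iY] := sY.
have iX' : P.-integrable setT (EFin \o (fun o => eta^-1 * X o ^+ 2)).
  by have := integrableZl measurableT eta^-1 iX; apply: eq_integrable => // o _; rewrite /= -EFinM.
have iY' : P.-integrable setT (EFin \o (fun o => eta * Y o ^+ 2)).
  by have := integrableZl measurableT eta iY; apply: eq_integrable => // o _; rewrite /= -EFinM.
apply: le_trans (le_normr_Rintegral measurableT iXY) _.
rewrite [X in X + _]mulrC -!RintegralZl// -RintegralD//.
apply: le_Rintegral => //; first exact: (integrable_abse iXY).
  by have := integrableD measurableT iX' iY'; apply: eq_integrable => // o _; rewrite /= -EFinD.
move=> o _; rewrite normrM -[X o ^+ 2]real_normK ?num_real// -[Y o ^+ 2]real_normK ?num_real//.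
have [z z0 ->] : exists2 z, 0 <= z & `|X o| = eta * z.
  by exists (`|X o| / eta); [rewrite divr_ge0// ltW|rewrite mulrCA mulfV ?gt_eqF// mulr1].
rewrite -mulrA exprMn expr2 -!mulrA mulKf ?gt_eqF// -mulrDr ler_pM2l//.
by have := sqr_ge0 (z - `|Y o|); have := normr_ge0 (Y o); nra.
Qed.

Section pettis.
Context {R : realType} (V : completeNormedModType R).
Hypothesis sepV : separable_space V.
Context {d : measure_display} {Omega : measurableType d} (P : probability Omega R).
Variable Z : Omega -> V.
Hypothesis mZ : measurable_fun setT (Z : Omega -> borelType V).
Variable c : R.
Let contraction (w : dual_space V) := forall y, `|w y : R| <= `|y|.
Hypothesis hZ : forall w : dual_space V, contraction w ->
  sqint P (fun o => w (Z o) : R) /\ msq P (fun o => w (Z o) : R) <= c.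
Variable G : Omega -> R.
Hypothesis sG : sqint P G.

Section approximation.
Variables (x : nat -> V) (delta : R).
Hypothesis delta0 : 0 < delta.
Hypothesis dx : forall y, exists j, `|y - x j| < delta.

Let B j := Z @^-1` (ball (x j) delta).

Let mB j : measurable (B j).
Proof.
rewrite -[B j]setTI; apply: mZ => //; apply: sub_gen_smallest; exact: ball_open.
Qed.

Let b j : Omega -> R := \1_(B j).

Let mb j : measurable_fun setT (b j).
Proof. exact: measurable_indic. Qed.

(** The indicator that Z avoids the first n balls; [phi n] below is then the indicator of the n-th
    cell of the disjoint partition cut out by the balls. *)
Fixpoint outside n (o : Omega) : R := if n is m.+1 then outside m o * (1 - b m o) else 1.

Let b01 j o : 0 <= b j o <= 1.
Proof. by rewrite /b indicE; case: (_ \in _); rewrite /= ?lexx ?ler01. Qed.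

Lemma outside01 n o : 0 <= outside n o <= 1.
Proof.
elim: n => [|n /andP[h0 h1]] /=; first by rewrite ler01 lexx.
have /andP[b0 b1] := b01 n o.
by rewrite mulr_ge0 ?subr_ge0//= mulr_ile1 ?subr_ge0// gerBl.
Qed.

Lemma moutside n : measurable_fun setT (outside n).
Proof.
elim: n => [|n IH] //=; apply: measurable_funM => //; exact: measurable_funB.
Qed.

Let mo n : measurable_fun setT (outside n) := @moutside n.

Let phi n o := outside n o * b n o.

Let outsideS n o : 1 - outside n.+1 o = (1 - outside n o) + phi n o.
Proof. by rewrite /phi /=; ring. Qed.

Let phi_ge0 n o : 0 <= phi n o.
Proof.
have /andP[? _] := outside01 n o; have /andP[? _] := b01 n o.
exact: mulr_ge0.
Qed.

Let phi_bd n o : `|phi n o| <= 1.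
Proof.
rewrite ger0_norm//; have /andP[? ?] := outside01 n o; have /andP[? ?] := b01 n o.
exact: mulr_ile1.
Qed.

Let mphi n : measurable_fun setT (phi n).
Proof. exact: measurable_funM. Qed.

Let phi_near n o (w : dual_space V) : contraction w ->
  `|phi n o * ((w (Z o) : R) - w (x n))| <= delta * phi n o.
Proof.
move=> cw; rewrite normrM ger0_norm// mulrC.
have [oB|oB] := boolP (o \in B n); last first.
  by rewrite /phi /b indicE (negPf oB)/= mulr0 !mulr0.
rewrite ler_wpM2r//; apply: le_trans (ltW _); last first.
  by move: (set_mem oB : ball (x n) delta (Z o)); rewrite -(@ball_normE R V) /=; exact.
by have := cw (x n - Z o); rewrite linearB distrC.
Qed.

Lemma outside_eventually o : exists n, forall m, (n <= m)%N -> outside m o = 0.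
Proof.
have [j hj] := dx (Z o); exists j.+1; elim => // m IH; rewrite leq_eqVlt => /orP[/eqP[<-]|jm].
  rewrite /= /b indicE mem_set ?subrr ?mulr0//.
  by rewrite /B /= -(@ball_normE R V) /= distrC.
by rewrite /= IH ?mul0r.
Qed.

Let wZ (w : dual_space V) o : R := w (Z o).

Let sphi n : sqint P (fun o => phi n o * G o).
Proof. by apply: sqint_bdM => //; exists 1 => o; exact: phi_bd. Qed.

Let out_bd n o : `|1 - outside n o| <= 1.
Proof. by have /andP[? ?] := outside01 n o; rewrite ger0_norm ?subr_ge0// gerBl. Qed.

Let sin n : sqint P (fun o => (1 - outside n o) * G o).
Proof.
apply: sqint_bdM => //; first exact: measurable_funB.
by exists 1 => o; exact: out_bd.
Qed.

(** On the n-th cell Z is within [delta] of x n, so replacing w(Z) by w(x n) there costs at most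
    [delta] times the mass of |G| on that cell. The vector y sums the points x n weighted by the
    mean of G on their cells, and does not depend on w. *)
Lemma inside_near n : exists y, forall w, contraction w ->
  `|\int[P]_o ((1 - outside n o) * G o * wZ w o) - w y| <=
    delta * \int[P]_o ((1 - outside n o) * `|G o|).
Proof.
have sGn : sqint P (fun o => `|G o|).
  by apply: (sqint_le (measurableT_comp (@normr_measurable R setT) sG.1) sG) => o; rewrite real_normK ?num_real.
have iphi m : P.-integrable setT (EFin \o (fun o => phi m o * `|G o|)).
  by apply: sqint_integrable; apply: sqint_bdM => //; exists 1 => o; exact: phi_bd.
have iin m : P.-integrable setT (EFin \o (fun o => (1 - outside m o) * `|G o|)).
  apply: sqint_integrable; apply: sqint_bdM => //; first exact: measurable_funB.
  by exists 1 => o; exact: out_bd.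
elim: n => [|n [y hy]].
  exists 0 => w _; rewrite linear0 subr0 /=.
  under eq_Rintegral do rewrite subrr !mul0r.
  under [X in _ <= _ * X]eq_Rintegral do rewrite subrr mul0r.
  by rewrite Rintegral_cst// mul0r normr0 mulr0.
exists ((\int[P]_o (phi n o * G o)) *: x n + y) => w cw.
have [sw _] := hZ cw.
have -> : \int[P]_o ((1 - outside n.+1 o) * `|G o|) =
    \int[P]_o ((1 - outside n o) * `|G o|) + \int[P]_o (phi n o * `|G o|).
  by rewrite -RintegralD//; apply: eq_Rintegral => o _; rewrite outsideS mulrDl.
have -> : \int[P]_o ((1 - outside n.+1 o) * G o * wZ w o) =
    \int[P]_o ((1 - outside n o) * G o * wZ w o) + \int[P]_o (phi n o * G o * wZ w o).
  rewrite -RintegralD//; [|exact: sqint_mul (sin n) sw|exact: sqint_mul (sphi n) sw].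
  by apply: eq_Rintegral => o _; rewrite outsideS !mulrDl.
have -> : (w (\int[P]_o (phi n o * G o) *: x n + y) : R) =
    \int[P]_o (w (x n) * (phi n o * G o)) + w y.
  rewrite linearD linearZ RintegralZl//; last exact: sqint_integrable.
  by rewrite mulrC.
have -> (p q r s : R) : p + q - (r + s) = (p - s) + (q - r) by ring.
rewrite mulrDr; apply: le_trans (ler_normD _ _) _; rewrite lerD ?hy//.
have i1 := sqint_mul (sphi n) sw.
have i2 := sqint_integrable (sqintZ (w (x n)) (sphi n)).
have i12 : P.-integrable setT
    (EFin \o (fun o => phi n o * G o * wZ w o - w (x n) * (phi n o * G o))).
  by have := integrableB measurableT i1 i2; apply: eq_integrable => // o _; rewrite /= -EFinB.
rewrite -RintegralB//.
apply: le_trans (le_normr_Rintegral measurableT i12) _.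
rewrite -RintegralZl//; apply: le_Rintegral => //.
- exact: (integrable_abse i12).
- have := integrableZl measurableT delta (iphi n).
  by apply: eq_integrable => // o _; rewrite /= -EFinM.
- move=> o _.
  have -> : phi n o * G o * wZ w o - w (x n) * (phi n o * G o) =
     (phi n o * (wZ w o - w (x n))) * G o by ring.
  by rewrite normrM mulrA ler_wpM2r// phi_near.
Qed.

Lemma outside_msq_cvg : msq P (fun o => outside n o * G o) @[n --> \oo] --> (0 : R).
Proof.
have [mG iG] := sG.
have := @cvg_Rintegral _ _ _ P (fun n o => (outside n o * G o) ^+ 2) (fun=> 0) (fun o => G o ^+ 2).
rewrite Rintegral_cst// mul0r => h; apply: (h _ _ iG _).2.
- by move=> n; apply: measurable_funX; exact: measurable_funM.
- move=> o; have [n hn] := outside_eventually o.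
  apply/cvgrPdist_le => eps eps0; exists n => // m /= nm.
  by rewrite hn// mul0r expr0n subrr normr0 ltW.
- move=> n o; rewrite ger0_norm ?sqr_ge0// exprMn ler_piMl ?sqr_ge0//.
  by have /andP[? ?] := outside01 n o; rewrite exprn_ile1.
Qed.

End approximation.

(** Finitely many cells carry all but a small part of G in mean square. On that remainder,
    [Rintegral_mul_le] together with the bound [c], uniform over contractions, makes the error small
    for all w at once. *)
Lemma nearly_represented eps : 0 < eps -> exists y, forall w : dual_space V, contraction w ->
  `|\int[P]_o (G o * (w (Z o) : R)) - w y| <= eps.
Proof.
move=> eps0; have [x dx] := dense_sequence sepV.
pose a := \int[P]_o `|G o|.
have sGn : sqint P (fun o => `|G o|).
  by apply: (sqint_le (measurableT_comp (@normr_measurable R setT) sG.1) sG) => o; rewrite real_normK ?num_real.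
have a0 : 0 <= a by apply: Rintegral_ge0.
have a1 : 0 < a + 1 by rewrite ltr_wpDl.
(* [delta] lets the cells cost at most eps/2; [eta] below shares the other half equally between the
   two terms of [Rintegral_mul_le]. *)
pose delta := eps / 2 / (a + 1).
have delta0 : 0 < delta by rewrite !divr_gt0.
have {}dx y : exists j, `|y - x j| < delta by exact: dx.
have c1 : 0 < `|c| + 1 by rewrite ltr_wpDl.
pose eta := eps / 4 / (`|c| + 1).
have eta0 : 0 < eta by rewrite !divr_gt0.
have [N _ /(_ N (leqnn N))] := (cvgrPdist_le _ _).1 (outside_msq_cvg dx) _
  (mulr_gt0 eta0 (divr_gt0 eps0 (ltr0n R 4))).
rewrite sub0r normrN ger0_norm ?msq_ge0// => hN.
have [y hy] := inside_near x delta N; exists y => w cw.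
have [sw mw] := hZ cw.
pose b := outside x delta N.
have b01 o : 0 <= b o <= 1 by exact: outside01.
have mb : measurable_fun setT b by exact: moutside.
have sb : sqint P (fun o => b o * G o).
  apply: sqint_bdM => //; exists 1 => o; have /andP[? ?] := b01 o.
  by rewrite ger0_norm.
have mb1 : measurable_fun setT (fun o => 1 - b o) by exact: measurable_funB.
have b1 o : `|1 - b o| <= 1.
  by have /andP[? ?] := b01 o; rewrite ger0_norm ?subr_ge0// gerBl.
have sb1 : sqint P (fun o => (1 - b o) * G o) by apply: sqint_bdM => //; exists 1.
have -> : \int[P]_o (G o * (w (Z o) : R)) =
    \int[P]_o ((1 - b o) * G o * (w (Z o) : R)) + \int[P]_o (b o * G o * (w (Z o) : R)).
  rewrite -RintegralD//; [|exact: sqint_mul|exact: sqint_mul].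
  by apply: eq_Rintegral => o _; ring.
have e1 := hy w cw.
have e2 : delta * \int[P]_o ((1 - b o) * `|G o|) <= eps / 2.
  apply: (@le_trans _ _ (delta * a)).
    rewrite ler_wpM2l ?(ltW delta0)// /a; apply: le_Rintegral => //.
    - by apply: sqint_integrable; apply: sqint_bdM => //; exists 1.
    - exact: sqint_integrable.
    - by move=> o _; have /andP[? ?] := b01 o; rewrite ler_piMl// gerBl.
  have e20 : 0 <= eps / 2 by rewrite divr_ge0// ltW.
  by rewrite /delta -mulrA ler_piMr// ler_pdivrMl// mulr1 lerDl.
have e3 := Rintegral_mul_le eta0 sb sw.
have e4 : msq P (fun o => b o * G o) / eta <= eps / 4.
  by rewrite ler_pdivrMr// mulrC.
have e5 : eta * msq P (fun o => w (Z o) : R) <= eps / 4.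
  apply: (@le_trans _ _ (eta * (`|c| + 1))); last by rewrite /eta mulfVK ?gt_eqF.
  by rewrite ler_pM2l// (le_trans mw)// (le_trans (ler_norm c))// lerDl.
rewrite addrAC; apply: le_trans (ler_normD _ _) _.
by lra.
Qed.

(** Vectors representing the integral up to 1/(n + 1) form a Cauchy sequence: a contraction that
    norms y n - y m evaluates both close to the same number. Completeness of V supplies the
    limit. *)
Lemma pettis_integral : exists y, forall w : dual_space V,
  w y = \int[P]_o (G o * (w (Z o) : R)) :> R.
Proof.
have e0 n : 0 < (n.+1%:R : R)^-1 by rewrite invr_gt0 ltr0n.
have /choice[y hy] := fun n => nearly_represented (e0 n).
have dist n m : `|y n - y m| <= (n.+1%:R : R)^-1 + (m.+1%:R : R)^-1.
  have [w cw wE] := norming_functional (y n - y m).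
  have E : w (y n - y m) = (w (y n) : R) - (w (y m) : R) :> R by exact: linearB.
  have := hy n w cw; have := hy m w cw; rewrite -wE E !ler_norml.
  set p := _^-1; set q := _^-1; set L := \int[P]_o _ => /andP[h1 h2] /andP[h3 h4].
  by lra.
have cvy : cvgn y.
  apply: cauchy_cvg; apply: cauchy_exP => eps eps0.
  have [N _ /(_ N (leqnn N))] := (cvgrPdist_lt _ _).1 (@cvg_harmonic R) _
    (divr_gt0 eps0 (ltr0n R 2)).
  rewrite /= sub0r normrN ger0_norm ?invr_ge0// => hN.
  exists (y N); exists N => // m /= Nm; rewrite -(@ball_normE R V) /=.
  apply: le_lt_trans (dist N m) _.
  have mN : (m.+1%:R : R)^-1 <= (N.+1%:R : R)^-1 by rewrite lef_pV2 ?posrE ?ltr0n// ler_nat.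
  by rewrite [ltRHS]splitr ltrD// (le_lt_trans mN).
exists (limn y).
have contr (w : dual_space V) : contraction w ->
    w (limn y) = \int[P]_o (G o * (w (Z o) : R)) :> R.
  move=> cw; set L := \int[P]_o _.
  have c1 : (w (y n) : R) @[n --> \oo] --> (w (limn y) : R).
    by apply: (@cvg_comp _ _ _ y w); [exact: cvy|exact: bop_continuous].
  have c2 : (w (y n) : R) @[n --> \oo] --> L.
    apply/cvgrPdist_le => eps eps0.
    have [N _ HN] := (cvgrPdist_le _ _).1 (@cvg_harmonic R) _ eps0.
    exists N => // n /= Nn; apply: (le_trans (hy n w cw)).
    by have := HN n Nn; rewrite /= sub0r normrN ger0_norm ?invr_ge0.
  exact: (cvg_unique _ c1 c2).
move=> w; have [M M0 HM] := bop_bounded w.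
have M1 : 0 < M + 1 by rewrite ltr_wpDl.
(* A general functional is rescaled to a contraction; the inner combination is the zero
   functional. *)
pose w' := bop_lincomb (M + 1)^-1 w (bop_lincomb (-1) w w).
have w'E z : (w' z : R) = (M + 1)^-1 * w z by rewrite /= scaleN1r addNr addr0.
have cw' : contraction w'.
  move=> z; rewrite w'E normrM gtr0_norm ?invr_gt0// ler_pdivrMl//.
  by apply: (le_trans (HM z)); rewrite ler_wpM2r// lerDl.
have wE z : w z = (M + 1) * (w' z : R) :> R by rewrite w'E mulVKf// gt_eqF.
have [sw' _] := hZ cw'.
rewrite wE contr// -RintegralZl//; last exact: sqint_mul.
by apply: eq_Rintegral => o _; rewrite wE; ring.
Qed.

End pettis.

(** * Borel measurability from countably many functionals *)

Lemma measurable_continuous_comp (R : realType) (V : normedModType R) d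
    (T : measurableType d) (Z : T -> V) (f : V -> R) : continuous f ->
  measurable_fun setT (Z : T -> borelType V) -> measurable_fun setT (fun t => f (Z t)).
Proof.
move=> cf mZ; apply: (@measurableT_comp _ _ _ _ (borelType V) R f) => //.
move=> mT; apply: (measurability _ (@RGenOpens.measurableE R)) => //.
move=> _ [_ [a [b ->]] <-]; rewrite setTI; apply: sub_gen_smallest.
by move/continuousP: cf; apply; exact: interval_open.
Qed.

Section weak_measurability.
Context {R : realType} (V : normedModType R).
Variables (x : nat -> V) (w : nat -> dual_space V).
Hypothesis dx : forall y e, 0 < e -> exists j, `|y - x j| < e.
Hypothesis cw : forall j y, `|w j y : R| <= `|y|.
Hypothesis nw : forall y r, (forall j, `|w j y : R| <= r) -> `|y| <= r.
Context {d : measure_display} {T : measurableType d}.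

Lemma norming_ball y z r : (forall n, `|(w n y : R) - (w n z : R)| <= r) <-> `|y - z| <= r.
Proof.
have E n : (w n (y - z) : R) = (w n y : R) - (w n z : R) by exact: linearB.
split=> [h|h n]; first by apply: nw => n; rewrite E.
by rewrite -E (le_trans (cw _ _)).
Qed.

(** A closed ball is the intersection of the countably many slabs given by the norming family, and
    an open set is a countable union of closed balls centred in the dense sequence. *)
Lemma weak_measurable (Z : T -> V) :
  (forall n, measurable_fun setT (fun t => w n (Z t) : R)) ->
  measurable_fun setT (Z : T -> borelType V).
Proof.
move=> mw; apply: (@measurability _ _ T (borelType V) setT Z (@open V)) => //.
move=> _ [A oA <-]; rewrite setTI.
pose r k : R := (k.+1%:R)^-1.
pose good j k := forall z, `|z - x j| <= r k -> A z.
have -> : Z @^-1` A = \bigcup_j \bigcup_k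
    [set t | good j k /\ forall n, `[(w n (x j) : R) - r k, (w n (x j) : R) + r k]%classic (w n (Z t) : R)].
  apply/seteqP; split => [ t /= Ao|t [j _ [k _ [g h]]]]; last first.
    apply: g; apply/norming_ball => n; have := h n; rewrite /= in_itv/=.
    by rewrite ler_distl.
  have /nbhs_ballP[e /= e0 eA] := open_nbhs_nbhs (conj oA Ao).
  have [k _ /(_ k (leqnn k))] := (cvgrPdist_lt _ _).1 (@cvg_harmonic R) _ (divr_gt0 e0 (ltr0n R 2)).
  rewrite /= sub0r normrN ger0_norm ?invr_ge0// -/(r k) => rk.
  have rk0 : 0 < r k by rewrite invr_gt0 ltr0n.
  have [j hj] := dx (Z t) rk0; exists j => //; exists k => //; split.
    move=> z zx; apply: eA; rewrite -(@ball_normE R V) /=.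
    have -> : Z t - z = (Z t - x j) - (z - x j) by rewrite opprB addrA subrK.
    rewrite (le_lt_trans (ler_normB _ _))// [ltRHS]splitr ltrD//.
      exact: lt_trans rk.
    exact: le_lt_trans rk.
  move=> n; rewrite /= in_itv/= -ler_distl; move: n.
  by apply/norming_ball; exact: ltW.
apply: bigcupT_measurable => j; apply: bigcupT_measurable => k.
have [g|ng] := pselect (good j k); last first.
  by rewrite (_ : [set _ | _] = set0)//; apply/seteqP; split => // t [].
rewrite (_ : [set _ | _] = \bigcap_n ((fun t => w n (Z t) : R) @^-1`
    `[(w n (x j) : R) - r k, (w n (x j) : R) + r k])).
  apply: bigcapT_measurable => n; rewrite -[X in measurable X]setTI.
  by apply: mw => //; exact: measurable_itv.
by apply/seteqP; split => t; [move=> [_ h] n _; exact: h|move=> h; split => // n; exact: h].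
Qed.

End weak_measurability.

(** * Transferring a V-valued realisation to the given probability space *)

Section transfer.
Context {R : realType} (V : completeNormedModType R).
Hypothesis sepV : separable_space V.
Context {d1 : measure_display} {T1 : measurableType d1} (P1 : probability T1 R).
Context {d2 : measure_display} {T2 : measurableType d2} (P2 : probability T2 R).
Variables (X : dual_space V -> T1 -> R) (Y : T2 -> V).
Hypothesis mX : forall v, measurable_fun setT (X v).
Hypothesis X_lin : forall a v v',
  {ae P1, forall t, X (bop_lincomb a v v') t = a * X v t + X v' t}.
Hypothesis mY : forall v : dual_space V, measurable_fun setT (fun t => v (Y t) : R).
Hypothesis XY_cos : forall v : dual_space V,
  \int[P1]_t cos (X v t) = \int[P2]_t cos (v (Y t) : R).
Hypothesis XY_sin : forall v : dual_space V,
  \int[P1]_t sin (X v t) = \int[P2]_t sin (v (Y t) : R).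

(** [X] is linear in v only up to null sets, so the first component is allowed to differ from [X v]
    on one; the family is then closed under exact linear combinations. *)
Let L (f : T1 -> R) (g : T2 -> R) := exists v : dual_space V,
  [/\ measurable_fun setT f, {ae P1, forall t, f t = X v t} & g = fun t => v (Y t) : R].

Let L_meas f g : L f g -> measurable_fun setT f /\ measurable_fun setT g.
Proof. by move=> [v [mf _ ->]]. Qed.

Let L_refl v : L (X v) (fun t => v (Y t) : R).
Proof. by exists v; split => //; apply: aeW. Qed.

Let L_lin a f g f' g' : L f g -> L f' g' ->
  L (fun t => a * f t + f' t) (fun t => a * g t + g' t).
Proof.
move=> [v [mf fv ->]] [v' [mf' fv' ->]]; exists (bop_lincomb a v v'); split => //.
  by apply: measurable_funD => //; exact: measurable_funM.
have := X_lin a v v'; move: fv'.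
by apply: filterS3 fv => t -> -> ->.
Qed.

Let L0 : L (fun=> 0) (fun=> 0).
Proof.
have [v _ _] := norming_functional (0 : V).
have := L_lin (-1) (L_refl v) (L_refl v).
by congr L; apply/funext => t; rewrite mulN1r addNr.
Qed.

Let L_cf f g : L f g -> \int[P1]_t cos (f t) = \int[P2]_t cos (g t) /\
  \int[P1]_t sin (f t) = \int[P2]_t sin (g t).
Proof.
move=> [v [mf fv ->]]; rewrite -XY_cos -XY_sin; split; apply: eq_Rintegral_ae.
- exact: (bdmeas_cos mf).1.
- exact: (bdmeas_cos (mX v)).1.
- by apply: filterS fv => t ->.
- exact: (bdmeas_sin mf).1.
- exact: (bdmeas_sin (mX v)).1.
- by apply: filterS fv => t ->.
Qed.

(** That the numbers X(w_n) are the coordinates of a point of V can be expressed by countably many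
    interval conditions. The same conditions hold surely for the V-valued variable Y, and the two
    models give equal probabilities to such events, so on the first space the conditions hold almost
    surely. *)
Lemma induced_transfer : induced_by_rv P1 X.
Proof.
have [x [w [dx cw nw]]] := norming_sequence sepV.
pose r k : R := (k.+1%:R)^-1.
have r0 k : 0 < r k by rewrite invr_gt0 ltr0n.
have r_small e : 0 < e -> exists k, r k < e.
  move=> e0; have [k _ /(_ k (leqnn k))] := (cvgrPdist_lt _ _).1 (@cvg_harmonic R) _ e0.
  by rewrite /= sub0r normrN ger0_norm ?invr_ge0//; exists k.
pose itv (v : dual_space V) j (s : R) : set R := `[(v (x j) : R) - s, (v (x j) : R) + s]%classic.
pose near1 k j := \bigcap_n (X (w n) @^-1` itv (w n) j (r k)).
pose near2 k j := \bigcap_n ((fun t => w n (Y t) : R) @^-1` itv (w n) j (r k)).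
have cf_near k j : cf_event P1 P2 L (near1 k j) (near2 k j).
  apply: (cf_event_bigcap L_meas) => n.
  by apply: (cf_event_preimage P1 P2 L_meas L0 L_lin (L_refl (w n))); exact: measurable_itv.
(* At every precision [r k] some x j looks close to the sought point through all w n, and X v agrees
   with v(x j) within the bound that |v| <= M imposes. *)
pose G M v := \bigcap_k \bigcup_j (near1 k j `&` X v @^-1` itv v j (M * r k)).
have G1 (M : R) (v : dual_space V) : 0 <= M -> (forall y, `|v y : R| <= M * `|y|) ->
    measurable (G M v) /\ P1 (G M v) = 1%E.
  move=> M0 vM.
  pose G2 := \bigcap_k \bigcup_j (near2 k j `&` (fun t => v (Y t) : R) @^-1` itv v j (M * r k)).
  have cfG : cf_event P1 P2 L (G M v) G2.
    apply: (cf_event_bigcap L_meas) => k; apply: (cf_event_bigcup L_meas) => j.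
    apply: cf_eventI => //.
    by apply: (cf_event_preimage P1 P2 L_meas L0 L_lin (L_refl v)); exact: measurable_itv.
  split; first by have [] := cfG.
  (* On the side of Y the event is sure: by density some x j lies within [r k] of Y. *)
  rewrite (cf_event_prob L0 L_cf cfG) (_ : G2 = setT); first exact: probability_setT.
  apply/seteqP; split => // t _ k _; have [j hj] := dx (Y t) _ (r0 k).
  exists j => //; split.
    move=> n _; rewrite /itv /= in_itv/= -ler_distl.
    exact: (norming_ball cw nw _ _ _).2 (ltW hj) n.
  rewrite /itv /= in_itv/= -ler_distl.
  have -> : (v (Y t) : R) - (v (x j) : R) = v (Y t - x j) by rewrite linearB.
  by rewrite (le_trans (vM _))// ler_wpM2l// ltW.
(* The approximating points x (j k) are Cauchy through every w n with the same bounds, hence in norm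
   since the family is norming; their limit has the prescribed coordinates. *)
have limit_point M v t : G M v t -> exists z, forall n, w n z = X (w n) t :> R.
  move=> Gt.
  have /choice[j hj] : forall k, exists j, near1 k j t.
    by move=> k; have [j _ [h _]] := Gt k I; exists j.
  have near k n : `|X (w n) t - (w n (x (j k)) : R)| <= r k.
    by have := hj k n I; rewrite /itv /= in_itv/= -ler_distl.
  have dist k l : `|x (j k) - x (j l)| <= r k + r l.
    apply/(norming_ball cw nw) => n.
    have := near k n; have := near l n; rewrite !ler_norml => /andP[h1 h2] /andP[h3 h4].
    by lra.
  have cvx : cvgn (x \o j).
    apply: cauchy_cvg; apply: cauchy_exP => e e0.
    have [N hN] := r_small _ (divr_gt0 e0 (ltr0n R 2)).
    exists (x (j N)); exists N => // m /= Nm; rewrite -(@ball_normE R V) /=.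
    apply: le_lt_trans (dist N m) _.
    have mN : r m <= r N by rewrite lef_pV2 ?posrE ?ltr0n// ler_nat.
    by rewrite [ltRHS]splitr ltrD// (le_lt_trans mN).
  exists (limn (x \o j)) => n.
  have c1 : (w n (x (j k)) : R) @[k --> \oo] --> (w n (limn (x \o j)) : R).
    by apply: (@cvg_comp _ _ _ (x \o j) (w n)); [exact: cvx|exact: bop_continuous].
  have c2 : (w n (x (j k)) : R) @[k --> \oo] --> X (w n) t.
    apply/cvgrPdist_le => e e0.
    have [N _ HN] := (cvgrPdist_le _ _).1 (@cvg_harmonic R) _ e0.
    exists N => // k /= Nk; apply: (le_trans (near k n)).
    by have := HN k Nk; rewrite /= sub0r normrN ger0_norm ?invr_ge0.
  exact: (cvg_unique _ c1 c2).
(* One event of probability one, taken for [w 0], serves to define Z for all functionals; Z is 0 off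
   this event. *)
have [M0 M00 hM0] := bop_bounded (w 0%N).
have [mG0 pG0] := G1 M0 (w 0%N) M00 hM0; set G0 := G M0 (w 0%N) in mG0 pG0.
pose Z t := if t \in G0 then xget 0 [set z | forall n, w n z = X (w n) t :> R] else 0.
have wZ n t : w n (Z t) = X (w n) t * \1_G0 t :> R.
  rewrite /Z indicE; case: ifPn => [/set_mem tG|_]; last by rewrite linear0 mulr0.
  rewrite mulr1; have [z hz] := limit_point _ _ _ tG.
  suff : [set z | forall n, w n z = X (w n) t :> R] (xget 0 [set z | forall n, w n z = X (w n) t :> R]).
    by apply.
  by apply: xgetPex; exists z.
exists Z.
  apply: (weak_measurable dx cw nw) => n.
  rewrite (_ : (fun t => _) = (fun t => X (w n) t * \1_G0 t)); last by apply/funext => t; exact: wZ.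
  by apply: measurable_funM => //; exact: measurable_indic.
move=> v; have [M MM hM] := bop_bounded v.
have [mG pG] := G1 M v MM hM.
have full A : measurable A -> P1 A = 1%E -> {ae P1, forall t, A t}.
  move=> mA pA; exists (~` A); split => //; first exact: measurableC.
  rewrite probability_setC// pA subee//.
have := full _ mG0 pG0; apply: filterS2 (full _ mG pG) => t Gt G0t.
have wZt n : w n (Z t) = X (w n) t :> R by rewrite wZ indicE mem_set// mulr1.
apply/eqP; rewrite -subr_eq0 -normr_le0; apply/ler_addgt0Pr => e e0; rewrite add0r.
have M2 : 0 < 2 * (M + 1) by rewrite mulr_gt0// ltr_wpDl.
have [k hk] := r_small _ (divr_gt0 e0 M2).
(* X v and v(Z) are compared through v(x j): each is within M r k of it, and k was chosen so that
   twice this is below e. *)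
have [j _ [nj]] := Gt k I; rewrite /itv /= in_itv/= -ler_distl => hv.
have hZ : `|Z t - x j| <= r k.
  apply/(norming_ball cw nw) => n; rewrite wZt.
  by have := nj n I; rewrite /itv /= in_itv/= -ler_distl.
have h2 : `|(v (Z t) : R) - (v (x j) : R)| <= M * r k.
  have -> : (v (Z t) : R) - (v (x j) : R) = v (Z t - x j) by rewrite linearB.
  by rewrite (le_trans (hM _))// ler_wpM2l.
have h3 : r k * (2 * (M + 1)) < e by rewrite -ltr_pdivlMr.
have -> : X v t - (v (Z t) : R) =
    (X v t - (v (x j) : R)) - ((v (Z t) : R) - (v (x j) : R)) by ring.
apply: le_trans (ler_normB _ _) _; apply: le_trans (lerD hv h2) _.
by have := r0 k; move: h3; lra.
Qed.

End transfer.

(** * The covariance operator of an inducing variable *)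

Section induced_gaussian.
Context {R : realType} (V : completeNormedModType R).
Hypothesis sepV : separable_space V.
Context {d : measure_display} {Omega : measurableType d} (P : probability Omega R).
Variables (Z : Omega -> V) (q : dual_space V -> R).
Hypothesis mZ : measurable_fun setT (Z : Omega -> borelType V).
Hypothesis q0 : forall v, 0 <= q v.
Hypothesis Zq : forall v : dual_space V, has_gaussian_law P (fun t => v (Z t) : R) 0 (q v).

Lemma measurable_dual_rv (v : dual_space V) : measurable_fun setT (fun t => v (Z t) : R).
Proof. apply: measurable_continuous_comp mZ; exact: bop_continuous. Qed.

Lemma cos_lower (x y : R) : `|x| <= y -> 1 - Num.min 2 (y ^+ 2 / 2) <= cos x.
Proof.
move=> xy; rewrite lerBlDr -lerBlDl le_min; apply/andP; split.
  by have := cos_geN1 x; lra.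
have := one_sub_cos x; have /= := @normr_sin_le R (x / 2).
set s := sin _ => h E.
have : s ^+ 2 <= (x / 2) ^+ 2 by rewrite -[leLHS]real_normK ?num_real// -[leRHS]real_normK ?num_real// ler_sqr ?nnegrE.
have : x ^+ 2 <= y ^+ 2 by rewrite -[leLHS]real_normK ?num_real// ler_sqr ?nnegrE// (le_trans _ xy).
by move: E; rewrite !expr2; lra.
Qed.

(** By dominated convergence min(2, a²|Z|²/2) has mean at most 1/2 for some a = 1/(N + 1). For
    contractive v, [cos_lower] then gives exp(-s) = E cos(a v(Z)) >= 1/2 with s = a² q(v)/2. Since 1
    + s <= exp(s) <= 2, s is at most 1 and q(v) at most 2(N + 1)². *)
Lemma bounded_variance : exists c : R, forall v : dual_space V,
  (forall y, `|v y : R| <= `|y|) -> q v <= c.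
Proof.
pose h n t : R := Num.min 2 ((n.+1%:R^-1 * `|Z t|) ^+ 2 / 2).
have mN : measurable_fun setT (fun t => `|Z t|).
  by apply: measurable_continuous_comp mZ; exact: norm_continuous.
have mh n : measurable_fun setT (h n).
  apply: measurable_minr => //; apply: measurable_funM => //; apply: measurable_funX.
  exact: measurable_funM.
have h02 n t : 0 <= h n t <= 2.
  by rewrite /h le_min ge_min lexx ler0n/= andbT divr_ge0// sqr_ge0.
have hb n t : `|h n t| <= 2 by have /andP[? ?] := h02 n t; rewrite ger0_norm.
have hc t : h n t @[n --> \oo] --> (0 : R).
  apply: (@squeeze_cvgr _ _ _ _ (fun=> 0) (fun n => (n.+1%:R^-1 * `|Z t|) ^+ 2 / 2)).
  - by apply: nearW => n; have /andP[-> _] := h02 n t; rewrite /h ge_min lexx orbT.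
  - exact: cvg_cst.
  - have c1 : (n.+1%:R^-1 * `|Z t| : R) @[n --> \oo] --> 0 * `|Z t|.
      exact: cvgM (@cvg_harmonic R) (cvg_cst _).
    have c2 : ((n.+1%:R^-1 * `|Z t|) ^+ 2 / 2 : R) @[n --> \oo] --> (0 * `|Z t|) * (0 * `|Z t|) / 2.
      exact: cvgM (cvgM c1 c1) (cvg_cst _).
    by move: c2; rewrite !mul0r.
have [_ c0] := cvg_Rintegral mh hc (bdmeas_integrable P (bdmeas_cst Omega (2 : R))) hb.
have [N _ /(_ N (leqnn N))] := (cvgrPdist_le _ _).1 c0 _ (divr_gt0 ltr01 (ltr0n R 2)).
rewrite Rintegral_cst// mul0r sub0r normrN => hN.
exists (2 * N.+1%:R ^+ 2) => v cv.
have [Ec _] := centred_cf (q0 v) (measurable_dual_rv v) (Zq v).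
pose a : R := N.+1%:R^-1.
have a0 : 0 < a by rewrite invr_gt0 ltr0n.
have := Ec a; set s := a ^+ 2 * q v / 2 => Ea.
have mc : measurable_fun setT (fun t => a * (v (Z t) : R)).
  by apply: measurable_funM => //; exact: measurable_dual_rv.
have ih : P.-integrable setT (EFin \o h N).
  by apply: bdmeas_integrable; split => //; exists 2.
have i1 : P.-integrable setT (EFin \o (fun t => 1 - h N t)).
  by apply: bdmeas_integrable; split; [exact: measurable_funB|exists 1 => t; have /andP[? ?] := h02 N t; rewrite ler_norml; lra].
have i0 : P.-integrable setT (EFin \o (fun=> 1)) := bdmeas_integrable P (bdmeas_cst Omega (1 : R)).
have low : 1 / 2 <= expR (- s).
  rewrite -Ea; apply: (@le_trans _ _ (\int[P]_t (1 - h N t))).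
    rewrite RintegralB//.
    rewrite Rintegral_cst// (_ : fine (P setT) = 1) ?mulr1; last by rewrite [P setT]probability_setT.
    by move: hN; rewrite ler_norml => /andP[_]; lra.
  have ic := bdmeas_integrable P (bdmeas_cos mc).
  apply: le_Rintegral => //.
  move=> t _; apply: cos_lower; rewrite normrM gtr0_norm// ler_wpM2l ?(ltW a0)//.
have s1 := expR_ge1Dx s.
have s2 : s <= 1.
  have E : expR (- s) * expR s = 1 by rewrite -expRD addNr expR0.
  have := expR_gt0 s; nra.
have -> : q v = 2 * N.+1%:R ^+ 2 * s.
  rewrite /s (_ : N.+1%:R = a^-1) ?invrK// exprVn; field.
  by rewrite gt_eqF.
by rewrite ler_piMr// mulr_ge0// exprn_ge0.
Qed.

(** C v is the weak integral of v(Z) Z; [bounded_variance] supplies the uniform second moment bound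
    over contractions. *)
Lemma covariance_exists : exists C : dual_space V -> V, forall v w : dual_space V,
  w (C v) = \int[P]_t ((v (Z t) : R) * (w (Z t) : R)) :> R.
Proof.
have [c hc] := bounded_variance.
have sv (v : dual_space V) : sqint P (fun t => v (Z t) : R) /\ msq P (fun t => v (Z t) : R) = q v.
  exact: gaussian_sqint (q0 v) (measurable_dual_rv v) (Zq v).
have hZ (w : dual_space V) : (forall y, `|w y : R| <= `|y|) ->
    sqint P (fun t => w (Z t) : R) /\ msq P (fun t => w (Z t) : R) <= c.
  by move=> cw; rewrite (sv w).2; split; [exact: (sv w).1|exact: hc].
have /choice[C hC] := fun v => pettis_integral sepV mZ hZ (sv v).1.
by exists C.
Qed.

Let Zm : {mfun Omega >-> borelType V} := mfun_Sub (mem_set mZ).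
Let mu : probability (borelType V) R := distribution P Zm.

Lemma induced_covariance : exists (mu : probability (borelType V) R) (C : dual_space V -> V),
  [/\ gaussian_measure mu, covariance_operator mu C & forall v : dual_space V, v (C v) = q v :> R].
Proof.
have [C hC] := covariance_exists.
have sv (v : dual_space V) : sqint P (fun t => v (Z t) : R) /\ msq P (fun t => v (Z t) : R) = q v.
  exact: gaussian_sqint (q0 v) (measurable_dual_rv v) (Zq v).
have mv (v : dual_space V) : measurable_fun setT (v : borelType V -> R).
  exact: (@measurable_continuous_comp _ V _ (borelType V) id (v : V -> R) (@bop_continuous _ _ _ v) (@measurable_id _ _ _)).
have E (f : borelType V -> R) : measurable_fun setT f ->
    P.-integrable setT (EFin \o (f \o Z)) ->
    (\int[mu]_x (f x)%:E = (\int[P]_t f (Z t))%:E)%E.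
  move=> mf iF.
  rewrite (integral_pushforward mZ (f := EFin \o f))//; last exact/measurable_EFinP.
  by rewrite /Rintegral fineK// integrable_fin_num.
exists mu, C; split.
- move=> v; exists 0, (q v); split => //; exact: Zq.
- move=> v w; rewrite !E//.
  + have [_ v0 _] := gaussian_law_moments (q0 v) (measurable_dual_rv v) (Zq v).
    by rewrite hC v0 -EFinM mul0r sube0.
  + exact: sqint_integrable (sv w).1.
  + exact: sqint_integrable (sv v).1.
  + exact: measurable_funM.
  + exact: sqint_mul (sv v).1 (sv w).1.
- by move=> v; rewrite hC -(sv v).2 /msq; apply: eq_Rintegral => t _; rewrite expr2.
Qed.

End induced_gaussian.

(** * From a Gaussian measure to an inducing variable *)

Section symmetrization.
Context {R : realType} (V : completeNormedModType R).
Hypothesis sepV : separable_space V.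
Variables (mu : probability (borelType V) R) (C : dual_space V -> V).
Hypothesis gmu : gaussian_measure mu.
Hypothesis covC : covariance_operator mu C.

Let mv (v : dual_space V) : measurable_fun setT (v : borelType V -> R).
Proof. exact: (@measurable_continuous_comp _ V _ (borelType V) id (v : V -> R) (@bop_continuous _ _ _ v) (@measurable_id _ _ _)). Qed.

Lemma gaussian_measure_law (v : dual_space V) :
  exists m, 0 <= (v (C v) : R) /\ has_gaussian_law mu (v : borelType V -> R) m (v (C v)).
Proof.
have [m [s [s0 law]]] := gmu v; exists m.
suff -> : (v (C v) : R) = s by [].
have [sv Ev Mv] := gaussian_law_moments s0 (mv v) law.
have := covC v v.
have -> : (\int[mu]_x ((v x : R) * (v x : R))%:E = (msq mu (v : borelType V -> R))%:E)%E.
  by rewrite (EFin_msq sv); apply: eq_integral => x _; rewrite expr2.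
have -> : (\int[mu]_x (v x : R)%:E = m%:E)%E.
  by rewrite -Ev /Rintegral fineK// integrable_fin_num//; exact: sqint_integrable.
by rewrite Mv -EFinM -EFinB => -[->]; rewrite expr2; ring.
Qed.

Let nu := (mu \x mu)%E : probability (borelType V * borelType V)%type R.

(** A Gaussian measure may have a nonzero mean. Under the product of [mu] with itself the means
    cancel in the difference, and the factor 1/√2 restores the covariance. *)
Definition symmetrized (z : borelType V * borelType V) : V :=
  (Num.sqrt 2)^-1 *: ((z.1 : V) - (z.2 : V)).

Lemma symmetrized_cf (v : dual_space V) :
  \int[nu]_z cos (v (symmetrized z) : R) = expR (- ((v (C v) : R) / 2)) /\
  \int[nu]_z sin (v (symmetrized z) : R) = 0.
Proof.
have [m [s0 law]] := gaussian_measure_law v; set s : R := v (C v) in s0 law *.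
pose a : R := (Num.sqrt 2)^-1.
have a2 : a ^+ 2 = 2^-1 by rewrite exprVn sqr_sqrtr.
have [Ec Es] := gaussian_law_cf (mv v) s0 law a.
have vE z : (v (symmetrized z) : R) = a * v z.1 - a * v z.2.
  by rewrite /symmetrized linearZ linearB -mulrBr.
have mav : measurable_fun setT (fun x : borelType V => a * (v x : R)) by exact: measurable_funM.
have bc := bdmeas_integrable mu (bdmeas_cos mav).
have bs := bdmeas_integrable mu (bdmeas_sin mav).
have [icc Ecc] := Rintegral_productM bc bc.
have [iss Ess] := Rintegral_productM bs bs.
have [isc Esc] := Rintegral_productM bs bc.
have [ics Ecs] := Rintegral_productM bc bs.
have expE : expR (- (a ^+ 2 * s / 2)) * expR (- (a ^+ 2 * s / 2)) = expR (- (s / 2)).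
  by rewrite -expRD a2; congr expR; field.
split.
  transitivity (\int[nu]_z (cos (a * v z.1) * cos (a * v z.2) + sin (a * v z.1) * sin (a * v z.2))).
    by apply: eq_Rintegral => z _; rewrite vE cosB.
  rewrite RintegralD// Ecc Ess Ec Es -expE.
  by rewrite mulrACA (mulrACA (sin _)) -mulrDl -!expr2 cos2Dsin2 mul1r.
transitivity (\int[nu]_z (sin (a * v z.1) * cos (a * v z.2) - cos (a * v z.1) * sin (a * v z.2))).
  by apply: eq_Rintegral => z _; rewrite vE sinB.
by rewrite RintegralB// Esc Ecs mulrC subrr.
Qed.

Context {d : measure_display} {Omega : measurableType d} (P : probability Omega R).
Variables (X : dual_space V -> Omega -> R).
Hypothesis mX : forall v, measurable_fun setT (X v).
Hypothesis X_lin : forall a v v',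
  {ae P, forall t, X (bop_lincomb a v v') t = a * X v t + X v' t}.
Hypothesis X_law : forall v : dual_space V, has_gaussian_law P (X v) 0 (v (C v)).

Lemma gaussian_induced : induced_by_rv P X.
Proof.
have cf v := centred_cf (let: ex_intro _ (conj h _) := gaussian_measure_law v in h) (mX v) (X_law v).
apply: (induced_transfer sepV (P2 := nu) (Y := symmetrized)) => //.
- move=> v; rewrite (_ : (fun t => _) = (fun z : borelType V * borelType V =>
      (Num.sqrt 2)^-1 * ((v z.1 : R) - (v z.2 : R)))).
    apply: measurable_funM => //; apply: measurable_funB.
      exact: (measurableT_comp (mv v) measurable_fst).
    exact: (measurableT_comp (mv v) measurable_snd).
  by apply/funext => z; rewrite /symmetrized linearZ linearB.
- move=> v; rewrite (symmetrized_cf v).1; have [/(_ 1) + _] := cf v.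
  rewrite expr1n mul1r => <-; by apply: eq_Rintegral => t _; rewrite mul1r.
- move=> v; rewrite (symmetrized_cf v).2; have [_ /(_ 1) <-] := cf v.
  by apply: eq_Rintegral => t _; rewrite mul1r.
Qed.

End symmetrization.

(** * The equivalence *)

Theorem corollary9p6 (R : realType) (U V : completeNormedModType R)
  (sepU : separable_space U) (sepV : separable_space V)
  (d : measure_display) (Omega : measurableType d) (P : probability Omega R)
  (F : R -> set (set Omega)) (hF : filtration F)
  (W : R -> dual_space U -> Omega -> R) (Q : dual_space U -> U)
  (hW : strongly_cylindrical_wiener P F W Q)
  (H : completeNormedModType R) (ip : {dot H for idfun}) (iQ : 'L(H, U))
  (hH : reproducing_kernel_space Q ip iQ)
  (K : pred nat) (e : nat -> H) (he : orthonormal_basis ip K e)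
  (u : nat -> dual_space U) (hu : forall k, K k -> hilbert_adjoint ip iQ (u k) = e k)
  (T : R) (hT : 0 < T)
  (Phi : R -> 'L(U, V)) (hPhi : M_space P F T (fun t _ => Phi t)) :
  induced_by_rv P (cylindrical_integral P F W iQ K e u (fun t _ => Phi t) T)
  <->
  exists (mu : probability (borelType V) R) (C : dual_space V -> V),
    [/\ gaussian_measure mu,
        covariance_operator mu C &
        forall v : dual_space V,
          (\int[lebesgue_measure]_(s in `[0%R, T])
             ((`|hilbert_adjoint ip iQ (dual_op (Phi s) v)| ^+ 2)%R)%:E
           = (v (C v))%:E)%E].
Proof.
set X := cylindrical_integral P F W iQ K e u (fun t _ => Phi t) T.
have mX v : measurable_fun setT (X v).
  by have [[]] := cylindrical_integral_limit hF hW hH he hu hT hPhi v.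
have lawX v : has_gaussian_law P (X v) 0 (energy ip iQ T Phi v).
  exact: (@cylindrical_integral_law _ _ _ _ _ hF _ _ _ hW _ _ _ hH _ _ he _ hu _ hT _ _ hPhi v).
have EI v := energy_integral hH he hPhi v.
split=> [[Z mZ XZ]|[mu [C [gmu covC EC]]]].
  (* From (a) to (b): almost sure equality gives v(Z) the centred Gaussian law of X v, and the
     measure sought is the law of Z. *)
  have lawZ (v : dual_space V) :
      has_gaussian_law P (fun t => v (Z t) : R) 0 (energy ip iQ T Phi v).
    apply: eq_has_gaussian_law (lawX v) => //; exact: measurable_dual_rv.
  have [mu [C [gmu covC EC]]] := induced_covariance sepV mZ (energy_ge0 ip iQ T Phi) lawZ.
  by exists mu, C; split => // v; rewrite EI EC.
(* From (b) to (a): by hypothesis the variance [energy] of X v is v(C v), so X has the laws of the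
   symmetrised measure. *)
apply: (gaussian_induced sepV gmu covC) => //.
- by move=> a v w; exact: (cylindrical_integral_lincomb hF hW hH he hu hT hPhi).
- by move=> v; have := EC v; rewrite EI => -[<-].
Qed.
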